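(* Let $A\in\mathbb{R}^{n\times n}$ satisfy $\operatorname{Re}(z^*Az)\ge 0$ for all $z\in\mathbb{C}^n$, let $g\in\mathbb{R}^n$ with $\|g\|=1$, let $t\ge 0$ and $k\ge 1$. Let $y_k(t)=V_k\,t\,\varphi(-tH_k)e_1$ be the Krylov subspace approximation, obtained after $k$ Arnoldi steps, to $y(t)=t\varphi(-tA)g$, and let $r_k(t)=-Ay_k(t)+g-y_k'(t)$ be its residual. Let $\Phi_j$, $j\ge 0$, be the Faber polynomials of the numerical range $W(A)$, and let $f_j(t)$ be the coefficients of the Faber series $$f(z;t)\equiv t\varphi(-tz)=\frac{1-e^{-tz}}{z}=\sum_{j=0}^{\infty}f_j(t)\Phi_j(z),\qquad z\in W(A),$$ where $t$ is regarded as a parameter. Then $$\|r_k(t)\|\le 2h_{k+1,k}\sum_{j=k-1}^{\infty}|f_j(t)|\le 2\|A\|\sum_{j=k-1}^{\infty}|f_j(t)|.$$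
   Context: $\|\cdot\|$ is the vector/matrix 2-norm. $\varphi$ is the entire function $\varphi(z)=(e^z-1)/z$ for $z\ne0$, $\varphi(0)=1$, applied to matrices as a matrix function. Arnoldi process: $k$ steps of the Arnoldi process for $A$ started with $v_1=g/\|g\|$ (assumed not to break down before step $k$) produce a matrix $V_{k+1}=[v_1,\dots,v_k,v_{k+1}]\in\mathbb{R}^{n\times(k+1)}$ with orthonormal columns and an upper Hessenberg matrix $\underline{H}_k\in\mathbb{R}^{(k+1)\times k}$ such that $$AV_k=V_{k+1}\underline{H}_k=V_kH_k+h_{k+1,k}v_{k+1}e_k^T,$$ where $V_k=[v_1,\dots,v_k]$, its columns span $\mathrm{span}(g,Ag,\dots,A^{k-1}g)$, $H_k=V_k^TAV_k$ consists of the first $k$ rows of $\underline{H}_k$, $h_{k+1,k}\ge 0$ is the $(k+1,k)$ entry of $\underline{H}_k$, and $e_1,e_k$ are the first and last standard basis vectors of $\mathbb{R}^k$ (if $h_{k+1,k}=0$ the last term is zero). Numerical range: $W(A)=\{z^*Az: z\in\mathbb{C}^n,\ z^*z=1\}$, a compact convex set (understood not to be a single point, so that Faber polynomials are defined). Faber polynomials: let $\phi$ be the conformal map of $\overline{\mathbb{C}}\setminus W(A)$ onto $\{|w|>1\}\cup\{\infty\}$ with $\phi(\infty)=\infty$ and $\lim_{z\to\infty}\phi(z)/z>0$; then $\Phi_j$ is the polynomial part (of degree $j$) of the Laurent expansion of $\phi(z)^j$ at $\infty$. (For the segment $[-1,1]$ this gives $\Phi_0=1$ and $\Phi_j=2T_j$,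 $j\ge1$, with $T_j$ the Chebyshev polynomials of the first kind.) With $\psi=\phi^{-1}$, the Faber coefficients of a function $f$ analytic in a neighbourhood of $W(A)$ are $f_j=\frac{1}{2\pi i}\oint_{|w|=R}f(\psi(w))w^{-j-1}\,dw$ with $R>1$ sufficiently close to $1$; the Faber series converges to $f$ on $W(A)$. *)

(* Defs.v *)
From HB Require Import structures.
From mathcomp Require Import all_boot all_order all_algebra.
From mathcomp Require Import all_classical all_reals all_analysis.
From mathcomp Require Import complex.

Set Implicit Arguments.
Unset Strict Implicit.
Unset Printing Implicit Defensive.

Import Order.TTheory GRing.Theory Num.Theory.
Import numFieldNormedType.Exports.
Import ComplexField.Normc.

Local Open Scope classical_set_scope.
Local Open Scope ring_scope.
Local Open Scope complex_scope.
Local Open Scope sesquilinear_scope.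

(* The norm that MathComp-Analysis puts on matrices is the entrywise maximum. *)
Definition vnorm2 (R : realType) (n : nat) (x : 'cV[R]_n) : R :=
  Num.sqrt (\sum_i x i 0 ^+ 2).

Definition mxnorm2 (R : realType) (m n : nat) (A : 'M[R]_(m, n)) : R :=
  sup [set vnorm2 (A *m x) | x in [set x : 'cV[R]_n | vnorm2 x <= 1]].

Definition cexp (R : realType) (z : R[i]) : R[i] :=
  (expR (complex.Re z))%:C * (cos (complex.Im z) +i* sin (complex.Im z)).

Definition phi1 (R : realType) (z : R[i]) : R[i] :=
  if z == 0 then 1 else (cexp z - 1) / z.

(* phi1 is entire with Taylor series \sum_j z^j / (j+1)! at 0; its value at a
   matrix is the sum of that power series. *)
Definition phi1_mx (R : realType) (n : nat) (M : 'M[R]_n) : 'M[R]_n :=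
  limn (series (fun j => (j.+1)`!%:R^-1 *: M ^+ j)).

(* Defined for every k, but a basis vector only when 0 < k. *)
Definition e_first (R : realType) (k : nat) : 'cV[R]_k :=
  \col_i (i == 0 :> nat)%:R.

Definition e_last (R : realType) (k : nat) : 'cV[R]_k :=
  \col_i (i.+1 == k)%:R.

Definition krylov_mx (R : realType) (n : nat) (A : 'M[R]_n) (g : 'cV[R]_n)
    (k : nat) : 'M[R]_(k, n) :=
  \matrix_(i < k) (A ^+ i *m g)^T.

(* [arnoldi A g V v H h]: here V is V_k, v is v_{k+1}, H is H_k and h is
   h_{k+1,k}, so that row_mx V v is V_{k+1} and col_mx H (h *: e_k^T) is the
   (k+1) x k Hessenberg matrix.  When h = 0 there need not be any v_{k+1} (for
   instance if k = n), and v is then arbitrary. *)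
Record arnoldi (R : realType) (n k : nat) (A : 'M[R]_n) (g : 'cV[R]_n)
    (V : 'M[R]_(n, k)) (v : 'cV[R]_n) (H : 'M[R]_k) (h : R) : Prop := Arnoldi {
  arnoldi_start : V *m e_first R k = (vnorm2 g)^-1 *: g ;
  arnoldi_orthonormal : V^T *m V = 1%:M ;
  arnoldi_orthonormal_next :
    h != 0 -> (row_mx V v)^T *m row_mx V v = 1%:M ;
  arnoldi_krylov : (V^T == krylov_mx A g k)%MS ;
  arnoldi_hessenberg : forall i j : 'I_k, (j.+1 < i)%N -> H i j = 0 ;
  arnoldi_subdiag : 0 <= h ;
  arnoldi_compression : H = V^T *m A *m V ;
  arnoldi_relation :
    A *m V = row_mx V v *m col_mx H (h *: (e_last R k)^T) }.

Definition krylov_approx (R : realType) (n k : nat)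
    (V : 'M[R]_(n, k)) (H : 'M[R]_k) (t : R) : 'cV[R]_n :=
  V *m (t *: (phi1_mx (- t *: H) *m e_first R k)).

(* Residual of the trial solution y for y' = - A y + g, y(0) = 0. *)
Definition residual (R : realType) (n : nat) (A : 'M[R]_n) (g : 'cV[R]_n)
    (y : R -> 'cV[R]_n) (t : R) : 'cV[R]_n :=
  - (A *m y t) + g - derive1 y t.

Definition cmx (R : realType) (m n : nat) (A : 'M[R]_(m, n)) : 'M[R[i]]_(m, n) :=
  map_mx (real_complex R) A.

Definition qform (R : realType) (n : nat) (A : 'M[R]_n) (z : 'cV[R[i]]_n) :
    R[i] :=
  (z ^t* *m cmx A *m z) 0 0.

Definition numerical_range (R : realType) (n : nat) (A : 'M[R]_n) : set R[i] :=
  [set qform A z | z in [set z : 'cV[R[i]]_n | z ^t* *m z = 1%:M]].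

(* Neighbourhoods of the point at infinity of the Riemann sphere. *)
Definition cinfty (R : realType) : set_system R[i] :=
  filter_from [set: R] (fun M => [set z | M < normc z]).

(* phi restricts to the conformal map of the complement of W in the Riemann
   sphere onto {|w| > 1} u {oo} fixing oo.  Outside W it is a holomorphic
   bijection between the finite parts; holomorphy, a simple pole and the
   normalization at oo are all expressed by the limit of phi(z) / z.  The values
   of phi on W are irrelevant. *)
Definition exterior_map (R : realType) (W : set R[i]) (phi : R[i] -> R[i]) :
    Prop :=
  [/\ forall z, ~ W z -> derivable (phi : R[i]^o -> R[i]^o) z 1,
      set_bij (~` W) [set w | 1 < normc w] phi &
      exists2 c : R, 0 < c &
        (fun z => phi z / z : R[i]^o) @ @cinfty R --> (c%:C : R[i]^o)].

(* The Laurent expansion of F at oo is p(z) + \sum_m b_m z^-(m+1). *)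
Definition polynomial_part (R : realType) (F : R[i] -> R[i])
    (p : {poly R[i]}) : Prop :=
  exists b : nat -> R[i], \forall z \near @cinfty R,
    series (fun m => b m * z ^- m.+1 : R[i]^o) @ \oo --> (F z - p.[z] : R[i]^o).

Definition faber_polynomials (R : realType) (phi : R[i] -> R[i])
    (Phi : nat -> {poly R[i]}) : Prop :=
  forall j, polynomial_part (fun z => phi z ^+ j) (Phi j).

Definition cintegral (R : realType) (a b : R) (F : R -> R[i]) : R[i] :=
  (\int[lebesgue_measure]_(x in `[a, b]) complex.Re (F x)) +i*
  (\int[lebesgue_measure]_(x in `[a, b]) complex.Im (F x)).

(* Integral of F over |w| = rho, counterclockwise: w = rho e^{i x} and
   dw = i w dx. *)
Definition circle_integral (R : realType) (rho : R) (F : R[i] -> R[i]) : R[i] :=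
  cintegral 0 (2 * pi)
    (fun x => let w := rho%:C * (cos x +i* sin x) in F w * ('i%C * w)).

Definition faber_coef (R : realType) (W : set R[i]) (phi : R[i] -> R[i])
    (f : R[i] -> R[i]) (rho : R) (j : nat) : R[i] :=
  let psi := 'pinv_(fun=> 0) (~` W) phi in
  (2 * pi%:C * 'i%C)^-1 * circle_integral rho (fun w => f (psi w) * w ^- j.+1).

(* Main.v *)
Require Import Defs.
From HB Require Import structures.
From mathcomp Require Import all_boot all_order all_algebra.
From mathcomp Require Import all_classical all_reals all_analysis.
From mathcomp Require Import complex ring lra.

Set Implicit Arguments.
Unset Strict Implicit.
Unset Printing Implicit Defensive.

Import Order.TTheory GRing.Theory Num.Theory.
Import numFieldNormedType.Exports.
Import ComplexField.Normc.

Local Open Scope classical_set_scope.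
Local Open Scope ring_scope.
Local Open Scope complex_scope.

(** The residual is a multiple of [v], with factor [- h] times the last entry of
[t phi1 (- t H) e_1]: by the Arnoldi relation everything else cancels, since
[exp (- t H) = 1 - H (t phi1 (- t H))] ([residualE], [exp_mxE]).  That corner
entry can be computed from the Faber series of [z |-> t phi1 (- t z)], evaluated
at [H].  As [H] is a Hessenberg matrix and [Phi_j] has degree at most [j], the terms with
[j < k - 1] vanish there ([hessenberg_horner], [faber_size]), and each of the
others is at most [2 |f_j|], by Beckermann's theorem: [|Phi_j(M)| <= 2] for every
matrix [M] whose numerical range lies in [W], the numerical range of [A]
([faber_bound]).  The second inequality holds because [h = v^T A V e_k], with unit
vectors [v] and [V e_k] ([subdiag_le]).

Beckermann's theorem rests on the convexity of [W].  For [z] in [W] the dilations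
with centre [z] and ratio greater than [1] map the complement of [W] into itself;
the maximum principle, applied as in Schwarz's lemma, shows that they increase
[|phi|] ([phi_dilation_ge]).  Differentiating in the ratio gives
[Re (phi' (zeta) (zeta - z) / phi zeta) >= 0] for [zeta] outside [W]
([phi_starlike]).  With [psi] the inverse of [phi], this says that the generating
function [w psi'(w) (psi w - M)^-1] of the polynomials [Phi_j(M)] has nonnegative
Hermitian part on [|w| > 1] ([Re_kernel_ge0]), and the coefficients of such a
function are bounded by twice its value [1] at infinity.

The function theory is developed from means over roots of unity instead of contour
integrals.  Goursat's bisection, for trapezoidal sums around subdivided squares
([goursat]), makes such means invariant under homotopy of the circle in the limit
([circle_homotopy]); this gives Cauchy's formula, the existence of all derivatives,
and the extraction of the coefficients of the generating function
([mean_faber_kernel_pos]).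

Convergence of the Faber series is known at the points of [W] only, so it can be
used directly at diagonalizable matrices, whose eigenvalues are points of [W].
[H] is therefore approximated by diagonalizable matrices with numerical range in
[W] ([diagonalizable_approx]).  The exponential series, truncated at a fixed
order, is compared there with the Faber series ([diag_estimate]); the limit is
taken first in the matrix and then in the order of truncation
([corner_entry_le]). *)

(** * The modulus, limits and derivatives of complex functions *)

Section Modulus.
Context {R : realType}.
Implicit Types (x y z : R[i]) (f g : R[i] -> R[i]) (u v : nat -> R[i]).

Lemma normrE z : `|z| = (normc z)%:C.
Proof. by []. Qed.

Lemma normc_ge0 z : 0 <= normc z.
Proof. by case: z => a b; exact: sqrtr_ge0. Qed.

Lemma normc_eq0 z : (normc z == 0) = (z == 0).
Proof.
apply/eqP/eqP => [/eq0_normc //|->]; exact: normc0.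
Qed.

Lemma normc_gt0 z : (0 < normc z) = (z != 0).
Proof. by rewrite lt_def normc_ge0 andbT normc_eq0. Qed.

Lemma normcB x y : normc (x - y) = normc (y - x).
Proof. by rewrite -normcN opprB. Qed.

Lemma le_normcB x y : normc (x - y) <= normc x + normc y.
Proof. by rewrite -(normcN y); exact: le_normcD. Qed.

Lemma lB_normcD x y : normc x - normc y <= normc (x + y).
Proof. by rewrite lerBlDr -{1}(addrK y x) -(normcN y) le_normcD. Qed.

Lemma lB_normcB x y : normc x - normc y <= normc (x - y).
Proof. by rewrite -(normcN y) lB_normcD. Qed.

Lemma normcX z n : normc (z ^+ n) = normc z ^+ n.
Proof. by elim: n => [|n IH]; rewrite ?expr0 ?normc1// !exprS normcM IH. Qed.

Lemma normcR (a : R) : normc a%:C = `|a|.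
Proof. by rewrite /normc /= expr0n /= addr0 sqrtr_sqr. Qed.

Lemma normc_nat n : normc (n%:R : R[i]) = n%:R.
Proof. by rewrite -(rmorph_nat (real_complex R)) normcR normr_nat. Qed.

Lemma normc_f x y : normc (x / y) = normc x / normc y.
Proof. by rewrite normcM normcV. Qed.

Lemma normc_sum I (r : seq I) (P : pred I) (F : I -> R[i]) :
  normc (\sum_(i <- r | P i) F i) <= \sum_(i <- r | P i) normc (F i).
Proof.
elim/big_rec2: _ => [|i y z _ H]; first by rewrite normc0.
by rewrite (le_trans (le_normcD _ _))// lerD2l.
Qed.

Lemma ReD x y : complex.Re (x + y) = complex.Re x + complex.Re y.
Proof. by case: x y => a b []. Qed.

Lemma ReB x y : complex.Re (x - y) = complex.Re x - complex.Re y.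
Proof. by case: x y => a b []. Qed.

Lemma Re_mulR (a : R) z : complex.Re (a%:C * z) = a * complex.Re z.
Proof. by case: z => x y /=; rewrite mul0r subr0. Qed.

Lemma ReJ z : complex.Re (conjc z) = complex.Re z.
Proof. by case: z. Qed.

Lemma normc_sqr z : normc z ^+ 2 = complex.Re z ^+ 2 + complex.Im z ^+ 2.
Proof. by case: z => a b /=; rewrite sqr_sqrtr// addr_ge0 ?sqr_ge0. Qed.

Lemma normc_sqrD x y :
  normc (x + y) ^+ 2 = normc x ^+ 2 + 2 * complex.Re (conjc x * y) + normc y ^+ 2.
Proof. by rewrite !normc_sqr; case: x y => a b [c d] /=; ring. Qed.

Lemma Re_le_normc z : `|complex.Re z| <= normc z.
Proof.
case: z => a b /=; rewrite -sqrtr_sqr ler_wsqrtr// lerDl sqr_ge0 //.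
Qed.

Lemma Im_le_normc z : `|complex.Im z| <= normc z.
Proof.
case: z => a b /=; rewrite -sqrtr_sqr ler_wsqrtr// lerDr sqr_ge0 //.
Qed.

Lemma normc_le_ReIm z : normc z <= `|complex.Re z| + `|complex.Im z|.
Proof.
rewrite {1}[z]complexE (le_trans (le_normcD _ _))// normcM !normcR.
by rewrite /= expr0n /= add0r expr1n sqrtr1 mul1r.
Qed.

Lemma conjcM x y : conjc (x * y) = conjc x * conjc y.
Proof. exact: rmorphM. Qed.

Lemma conjcX x n : conjc (x ^+ n) = conjc x ^+ n.
Proof. exact: rmorphXn. Qed.

Lemma normcJ z : normc (conjc z) = normc z.
Proof. by case: z => a b /=; rewrite sqrrN. Qed.

Lemma mulcJ z : z * conjc z = (normc z ^+ 2)%:C.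
Proof. by rewrite -sqr_normc normrE rmorphXn. Qed.

Lemma phase z : exists2 u : R[i], normc u = 1 & u * z = (normc z)%:C.
Proof.
have [->|z0] := eqVneq z 0; first by exists 1; rewrite ?normc1// mulr0 normc0.
have nz : (normc z)%:C != 0 :> R[i] by rewrite -normc_gt0 normcR normr_gt0 normc_eq0.
exists (conjc z / (normc z)%:C).
  by rewrite normc_f normcJ normcR ger0_norm ?normc_ge0// divff// normc_eq0.
by rewrite mulrAC [conjc z * z]mulrC mulcJ expr2 rmorphM mulfK.
Qed.

(** Limits of complex sequences and continuity are used through the real
modulus, so that all estimates take place in the ordered field [R]. *)
Definition clim u (l : R[i]) := forall e : R, 0 < e ->
  exists N, forall n, (N <= n)%N -> normc (u n - l) < e.

Definition ccont f z := forall e : R, 0 < e ->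
  exists2 d : R, 0 < d & forall w, normc (w - z) < d -> normc (f w - f z) < e.

Lemma climP u l : clim u l <-> (u : nat -> R[i]^o) @ \oo --> (l : R[i]^o).
Proof.
split=> [H|/cvgrPdist_lt H].
  apply/cvgrPdist_lt => e e0.
  have e1 : 0 < complex.Re e by move: e0; rewrite ltcE => /andP[].
  have [N HN] := H _ e1; near=> n.
  rewrite normrE ltcE /=; move: (e0); rewrite ltcE => /andP[/eqP -> _] /=.
  by rewrite eqxx /= normcB; apply: HN; near: n; exact: nbhs_infty_ge.
move=> e e0; have e1 : 0 < e%:C by rewrite ltcR.
have [N _ HN] := H _ e1; exists N => n Nn.
by have := HN n Nn; rewrite /= normrE ltcR normcB.
Unshelve. all: by end_near. Qed.

Lemma ccontP f z :
  ccont f z <-> {for z, continuous (f : R[i]^o -> R[i]^o)}.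
Proof.
have E : {for z, continuous (f : R[i]^o -> R[i]^o)} <->
    forall e : R[i], 0 < e -> nbhs (z : R[i]^o) (fun w => `|f z - f w| < e).
  exact: (@cvgrPdist_lt _ R[i]^o R[i]^o (nbhs (z : R[i]^o)) _ f (f z)).
split=> [H|/E H].
  apply/E => e e0.
  have e1 : 0 < complex.Re e by move: e0; rewrite ltcE => /andP[].
  have [d d0 Hd] := H _ e1.
  apply/nbhs_ballP; exists d%:C; first by rewrite /= ltcR.
  move=> w; rewrite /ball /= !normrE ltcR => zw.
  rewrite ltcE /=; move: (e0); rewrite ltcE => /andP[/eqP -> _] /=.
  by rewrite eqxx /= normcB; apply: Hd; rewrite normcB.
move=> e e0; have e1 : 0 < e%:C by rewrite ltcR.
have /nbhs_ballP[d /= d0 Hd] := H _ e1.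
have d1 : 0 < complex.Re d by move: d0; rewrite ltcE => /andP[].
exists (complex.Re d) => // w Hw.
have := Hd w; rewrite /= normrE ltcR normcB; apply.
rewrite /ball /= normrE ltcE /=; move: (d0); rewrite ltcE => /andP[/eqP -> _] /=.
by rewrite eqxx /= normcB.
Qed.

Lemma clim_unique u l l' : clim u l -> clim u l' -> l = l'.
Proof.
move=> H H'; apply: (@cvg_unique R[i]^o _ (u @ \oo)).
- exact: norm_hausdorff.
- exact: (climP u l).1 H.
- exact: (climP u l').1 H'.
Qed.

Lemma climD u v l l' : clim u l -> clim v l' -> clim (fun n => u n + v n) (l + l').
Proof.
move=> H H'; apply: (climP _ _).2.
exact: (@cvgD _ R[i]^o _ \oo _ u v l l' ((climP u l).1 H) ((climP v l').1 H')).
Qed.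

Lemma climB u v l l' : clim u l -> clim v l' -> clim (fun n => u n - v n) (l - l').
Proof.
move=> H H'; apply: (climP _ _).2.
exact: (@cvgB _ R[i]^o _ \oo _ u v l l' ((climP u l).1 H) ((climP v l').1 H')).
Qed.

Lemma climM u v l l' : clim u l -> clim v l' -> clim (fun n => u n * v n) (l * l').
Proof.
move=> H H'; apply: (climP _ _).2.
exact: (@cvgM R[i] _ \oo _ u v l l' ((climP u l).1 H) ((climP v l').1 H')).
Qed.

Lemma clim_cst c : clim (fun=> c) c.
Proof. by move=> e e0; exists 0%N => n _; rewrite subrr normc0. Qed.

Lemma climZ c u l : clim u l -> clim (fun n => c * u n) (c * l).
Proof. by apply: climM; exact: clim_cst. Qed.

Lemma eq_clim u v l : (forall n, u n = v n) -> clim u l -> clim v l.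
Proof. by move=> /funext ->. Qed.

Lemma clim_sum (I : finType) (F : I -> nat -> R[i]) (L : I -> R[i]) :
  (forall i, clim (F i) (L i)) ->
  clim (fun n => \sum_i F i n) (\sum_i L i).
Proof.
move=> H; elim: (index_enum I) => [|i r IH].
  by under eq_fun do rewrite big_nil; rewrite big_nil; exact: clim_cst.
by under eq_fun do rewrite big_cons; rewrite big_cons; exact: climD.
Qed.

Lemma clim_le u l B : (exists N, forall n, (N <= n)%N -> normc (u n) <= B) ->
  clim u l -> normc l <= B.
Proof.
move=> [N HN] H; rewrite leNgt; apply/negP => lB.
have [M HM] := H (normc l - B) ltac:(by rewrite subr_gt0).
have := HM _ (leq_maxr N M); have := HN _ (leq_maxl N M).
have := lB_normcB l (u (maxn N M)); rewrite normcB.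
by move=> *; lra.
Qed.

(** Comparison with auxiliary sequences [v] that may depend on [e]: in Cauchy's
formula the radius of the comparison circle does. *)
Lemma clim_near u l : (forall e : R, 0 < e -> exists2 v : nat -> R[i],
   (exists N, forall n, (N <= n)%N -> normc (u n - v n) <= e) &
   exists N, forall n, (N <= n)%N -> normc (v n - l) <= e) -> clim u l.
Proof.
move=> H e e0; have e3 : 0 < e / 3 by rewrite divr_gt0.
have [v [N HN] [M HM]] := H _ e3.
exists (maxn N M) => n; rewrite geq_max => /andP[/HN un /HM vn].
have -> : u n - l = (u n - v n) + (v n - l) by ring.
by rewrite (le_lt_trans (le_normcD _ _))//; lra.
Qed.

Lemma ccont_cst c z : ccont (fun=> c) z.
Proof. by move=> e e0; exists 1 => // w _; rewrite subrr normc0. Qed.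

Lemma ccont_id z : ccont id z.
Proof. by move=> e e0; exists e. Qed.

Lemma ccontD f g z : ccont f z -> ccont g z -> ccont (fun w => f w + g w) z.
Proof.
move=> H H'; apply: (ccontP _ _).2.
exact: (@cvgD _ R[i]^o _ (nbhs (z : R[i]^o)) _ f g (f z) (g z)
          ((ccontP f z).1 H) ((ccontP g z).1 H')).
Qed.

Lemma ccontM f g z : ccont f z -> ccont g z -> ccont (fun w => f w * g w) z.
Proof.
move=> H H'; apply: (ccontP _ _).2.
exact: (@cvgM R[i] _ (nbhs (z : R[i]^o)) _ f g (f z) (g z)
          ((ccontP f z).1 H) ((ccontP g z).1 H')).
Qed.

Lemma ccontV f z : f z != 0 -> ccont f z -> ccont (fun w => (f w)^-1) z.
Proof.
move=> fz H; apply: (ccontP _ _).2.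
exact: (@cvgV R[i] _ (nbhs (z : R[i]^o)) _ f (f z) fz ((ccontP f z).1 H)).
Qed.

Lemma ccont_comp f g z : ccont g z -> ccont f (g z) -> ccont (fun w => f (g w)) z.
Proof.
move=> Hg Hf e /Hf[d d0 Hd]; have [d' d'0 Hd'] := Hg _ d0.
by exists d' => // w /Hd' /Hd.
Qed.

Lemma ccont_near f g z r : 0 < r -> (forall w, normc (w - z) < r -> f w = g w) ->
  ccont f z -> ccont g z.
Proof.
move=> r0 H Hf e e0; have [d d0 Hd] := Hf _ e0.
exists (Num.min d r); first by rewrite lt_min d0 r0.
move=> w; rewrite lt_min => /andP[/Hd ? /H <-].
by rewrite -H// subrr normc0.
Qed.

Lemma ccont_neq0 f z : ccont f z -> f z != 0 ->
  exists2 r : R, 0 < r & forall w, normc (w - z) < r -> f w != 0.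
Proof.
rewrite -normc_gt0 => H /H[d d0 Hd]; exists d => // w /Hd Hw.
by apply: contraTneq Hw => ->; rewrite sub0r normcN ltxx.
Qed.

(** Caratheodory's form of the derivative: the difference quotient, a function
of [w], extends continuously to [z].  It turns the rules of differentiation into
algebraic identities. *)
Definition cderiv f z a := exists q : R[i] -> R[i],
  [/\ ccont q z, q z = a & forall w, f w - f z = q w * (w - z)].

Lemma cderiv_ccont f z a : cderiv f z a -> ccont f z.
Proof.
move=> [q [qc _ fq]].
have -> : f = (fun w => f z + q w * (w - z)).
  by apply/funext => w; rewrite -fq addrC subrK.
apply: ccontD; first exact: ccont_cst.
apply: ccontM => //; apply: ccontD; [exact: ccont_id|exact: ccont_cst].
Qed.

Lemma cderivP f z a : cderiv f z a <-> forall e : R, 0 < e ->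
  exists2 d : R, 0 < d & forall w, normc (w - z) < d ->
    normc (f w - f z - a * (w - z)) <= e * normc (w - z).
Proof.
split=> [[q [qc <- fq]] e e0|H].
  have [d d0 Hd] := qc _ e0; exists d => // w /Hd /ltW wz.
  by rewrite fq -mulrBl normcM ler_wpM2r// normc_ge0.
exists (fun w => if w == z then a else (f w - f z) / (w - z)); split.
- move=> e e0; have e2 : 0 < e / 2 by rewrite divr_gt0.
  have [d d0 Hd] := H _ e2; exists d => // w wz.
  rewrite eqxx; case: eqVneq => [_|wNz]; first by rewrite subrr normc0.
  have wz0 : w - z != 0 by rewrite subr_eq0.
  have -> : (f w - f z) / (w - z) - a = (f w - f z - a * (w - z)) / (w - z).
    by rewrite [RHS]mulrBl mulfK.
  rewrite normc_f ltr_pdivrMr ?normc_gt0// (le_lt_trans (Hd _ wz))//.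
  by rewrite ltr_pM2r ?normc_gt0//; lra.
- by rewrite eqxx.
- move=> w; case: eqVneq => [->|wz]; first by rewrite !subrr mulr0.
  by rewrite mulfVK// subr_eq0.
Qed.

Lemma cderiv_near f g z a r : 0 < r ->
  (forall w, normc (w - z) < r -> f w = g w) -> cderiv f z a -> cderiv g z a.
Proof.
move=> r0 H /cderivP Hf; apply/cderivP => e e0; have [d d0 Hd] := Hf _ e0.
exists (Num.min d r); first by rewrite lt_min d0 r0.
move=> w; rewrite lt_min => /andP[/Hd ? /H <-].
by rewrite -H// subrr normc0.
Qed.

Lemma cderiv_unique f z a b : cderiv f z a -> cderiv f z b -> a = b.
Proof.
move=> /cderivP Ha /cderivP Hb; apply/eqP; rewrite -subr_eq0 -normc_eq0.
rewrite eq_le normc_ge0 andbT leNgt; apply/negP => ab0.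
have e0 : 0 < normc (a - b) / 4 by rewrite divr_gt0.
have [d1 d10 H1] := Ha _ e0; have [d2 d20 H2] := Hb _ e0.
pose d := Num.min d1 d2 / 2; have d0 : 0 < d by rewrite divr_gt0// lt_min d10.
have dd : normc (z + d%:C - z) = d by rewrite addrC addKr normcR gtr0_norm.
have ddm : d < Num.min d1 d2 by rewrite /d ltr_pdivrMr// ltr_pMr ?ltr1n// lt_min d10.
have := H1 (z + d%:C); have := H2 (z + d%:C).
rewrite dd; move: ddm; rewrite lt_min => /andP[-> ->] /(_ isT) h2 /(_ isT) h1.
have := le_normcB (f (z + d%:C) - f z - b * (z + d%:C - z))
                  (f (z + d%:C) - f z - a * (z + d%:C - z)).
have -> : f (z + d%:C) - f z - b * (z + d%:C - z) -
   (f (z + d%:C) - f z - a * (z + d%:C - z)) = (a - b) * (z + d%:C - z) by ring.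
rewrite normcM dd => h3; have : normc (a - b) * d <= normc (a - b) / 4 * d * 2 by lra.
rewrite -mulrA -mulrA ler_pM2l// => ?; lra.
Qed.

Lemma cderiv_cst c z : cderiv (fun=> c) z 0.
Proof.
by exists (fun=> 0); split; [exact: ccont_cst| |move=> w; rewrite subrr mul0r].
Qed.

Lemma cderiv_id z : cderiv id z 1.
Proof. by exists (fun=> 1); split; [exact: ccont_cst| |move=> w; rewrite mul1r]. Qed.

Lemma cderivD f g z a b : cderiv f z a -> cderiv g z b ->
  cderiv (fun w => f w + g w) z (a + b).
Proof.
move=> [q [qc <- fq]] [p [pc <- gp]]; exists (fun w => q w + p w); split=> //.
  exact: ccontD.
by move=> w; rewrite mulrDl -fq -gp; ring.
Qed.

Lemma cderivM f g z a b : cderiv f z a -> cderiv g z b ->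
  cderiv (fun w => f w * g w) z (a * g z + f z * b).
Proof.
move=> [q [qc <- fq]] gb; have gc := cderiv_ccont gb.
move: gb => [p [pc <- gp]].
exists (fun w => q w * g w + f z * p w); split=> //.
  by apply: ccontD; apply: ccontM => //; exact: ccont_cst.
move=> w; rewrite mulrDl mulrAC -fq -[f z * _ * _]mulrA -gp; ring.
Qed.

Lemma cderivV f z a : f z != 0 -> cderiv f z a ->
  cderiv (fun w => (f w)^-1) z (- a / f z ^+ 2).
Proof.
move=> fz fa; have fc := cderiv_ccont fa; have [r r0 fN] := ccont_neq0 fc fz.
move: fa => [q [qc <- fq]].
pose g w := if normc (w - z) < r then (f w)^-1 else (f z)^-1 - q w / f z ^+2 * (w - z).
apply: (@cderiv_near g _ _ _ r) => [//|w|]; first by rewrite /g => ->.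
exists (fun w => if normc (w - z) < r then - q w / (f w * f z) else - q w / f z ^+2); split.
- have H : ccont (fun w => - q w / (f w * f z)) z.
    apply: ccontM.
      have -> : (fun w => - q w) = (fun w => -1 * q w) by apply/funext => w; rewrite mulN1r.
      by apply: ccontM => //; exact: ccont_cst.
    apply: ccontV; first by rewrite mulf_neq0.
    by apply: ccontM => //; exact: ccont_cst.
  by apply: (ccont_near r0 _ H) => w ->.
- by rewrite subrr normc0 r0 expr2.
- move=> w; rewrite /g subrr normc0 r0; case: ifPn => wr.
    by have := fN _ wr => fw; rewrite mulrAC mulNr -fq; field; rewrite fz fw.
  by ring.
Qed.

Lemma cderiv_comp f g z a b : cderiv g z b -> cderiv f (g z) a ->
  cderiv (fun w => f (g w)) z (a * b).
Proof.
move=> gb [q [qc <- fq]]; have gc := cderiv_ccont gb.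
move: gb => [p [pc <- gp]].
exists (fun w => q (g w) * p w); split=> //.
  by apply: ccontM => //; exact: ccont_comp.
by move=> w; rewrite fq gp mulrA.
Qed.

Lemma cderivZ c f z a : cderiv f z a -> cderiv (fun w => c * f w) z (c * a).
Proof.
by move=> /(cderivM (cderiv_cst c z)); rewrite mul0r add0r.
Qed.

Lemma cderivB f g z a b : cderiv f z a -> cderiv g z b ->
  cderiv (fun w => f w - g w) z (a - b).
Proof.
move=> fa /(cderivZ (-1)) /(cderivD fa); rewrite mulN1r.
by under eq_fun do rewrite mulN1r.
Qed.

Lemma cderivX f n z a : cderiv f z a ->
  cderiv (fun w => f w ^+ n) z (n%:R * f z ^+ n.-1 * a).
Proof.
move=> fa; elim: n => [|n IH].
  under eq_fun do rewrite expr0.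
  by rewrite !mul0r; exact: cderiv_cst.
under eq_fun do rewrite exprS.
have -> : n.+1%:R * f z ^+ n.+1.-1 * a = a * f z ^+ n + f z * (n%:R * f z ^+ n.-1 * a).
  by case: n {IH} => [|n] /=; rewrite ?expr0 -?natr1 ?exprS; ring.
exact: cderivM.
Qed.

Lemma cderiv_poly (p : {poly R[i]}) z : cderiv (fun w => p.[w]) z p^`().[z].
Proof.
elim/poly_ind: p => [|p c IH].
  under eq_fun do rewrite horner0.
  by rewrite deriv0 horner0; exact: cderiv_cst.
under eq_fun do rewrite hornerMXaddC.
rewrite derivD derivM derivX derivC addr0 mulr1 !hornerE.
rewrite -[_ + p.[z]]addr0; apply: cderivD; last exact: cderiv_cst.
rewrite -[X in _ + X]mulr1; apply: cderivM => //; exact: cderiv_id.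
Qed.

Definition chol f z := exists a, cderiv f z a.

Definition cderivative f z : R[i] := xget 0 [set a | cderiv f z a].

Lemma cderivativeP f z : chol f z -> cderiv f z (cderivative f z).
Proof. by move=> [a fa]; rewrite /cderivative; case: xgetP => // /(_ a). Qed.

Lemma cderivativeE f z a : cderiv f z a -> cderivative f z = a.
Proof. by move=> fa; apply: (cderiv_unique _ fa); apply: cderivativeP; exists a. Qed.

Lemma chol_ccont f z : chol f z -> ccont f z.
Proof. by move=> [a /cderiv_ccont]. Qed.

Lemma chol_cst c z : chol (fun=> c) z.
Proof. by exists 0; exact: cderiv_cst. Qed.

Lemma chol_id z : chol id z.
Proof. by exists 1; exact: cderiv_id. Qed.

Lemma cholD f g z : chol f z -> chol g z -> chol (fun w => f w + g w) z.
Proof. by move=> [a fa] [b gb]; exists (a + b); exact: cderivD. Qed.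

Lemma cholB f g z : chol f z -> chol g z -> chol (fun w => f w - g w) z.
Proof. by move=> [a fa] [b gb]; exists (a - b); exact: cderivB. Qed.

Lemma cholM f g z : chol f z -> chol g z -> chol (fun w => f w * g w) z.
Proof. by move=> [a fa] [b gb]; exists (a * g z + f z * b); exact: cderivM. Qed.

Lemma cholV f z : f z != 0 -> chol f z -> chol (fun w => (f w)^-1) z.
Proof. by move=> fz [a fa]; exists (- a / f z ^+ 2); exact: cderivV. Qed.

Lemma cholX f n z : chol f z -> chol (fun w => f w ^+ n) z.
Proof. by move=> [a fa]; eexists; exact: cderivX fa. Qed.

Lemma chol_comp f g z : chol g z -> chol f (g z) -> chol (fun w => f (g w)) z.
Proof. by move=> [b gb] [a fa]; exists (a * b); exact: cderiv_comp. Qed.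

End Modulus.

(** * Goursat's theorem for trapezoidal sums *)

Section Goursat.
Context {R : realType}.
Implicit Types (f g h : R[i] -> R[i]) (gam : R -> R[i]) (a b d x y : R).

Definition trap g (z w : R[i]) : R[i] := (g z + g w) / 2 * (w - z).

(** Trapezoidal sum for the integral of [g] along [gam] over [2 ^ N] equal parts
of the interval from [a] to [b]; halving first makes the sums around a square
the exact sum of those around its four quarters. *)
Fixpoint edge g gam N a b : R[i] :=
  if N is N'.+1 then
    edge g gam N' a ((a + b) / 2) + edge g gam N' ((a + b) / 2) b
  else trap g (gam a) (gam b).

Definition square_sum g (G : R -> R -> R[i]) N x y d : R[i] :=
  edge g (G^~ y) N x (x + d) + edge g (G (x + d)) N y (y + d)
  - edge g (G^~ (y + d)) N x (x + d) - edge g (G x) N y (y + d).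

Lemma square_sumS g G N x y d :
  square_sum g G N.+1 x y d =
    square_sum g G N x y (d / 2) + square_sum g G N (x + d / 2) y (d / 2) +
    square_sum g G N x (y + d / 2) (d / 2) +
    square_sum g G N (x + d / 2) (y + d / 2) (d / 2).
Proof.
have E c : (c + (c + d)) / 2 = c + d / 2 by field.
have F c : c + d / 2 + d / 2 = c + d by field.
by rewrite /square_sum /= !E !F; ring.
Qed.

(** The trapezoidal rule integrates affine functions exactly. *)
Lemma edge_affine (u v z0 : R[i]) gam N a b :
  let F z := u * z + v * (z - z0) ^+ 2 / 2 in
  edge (fun z => u + v * (z - z0)) gam N a b = F (gam b) - F (gam a).
Proof.
move=> F; elim: N a b => [|N IH] a b /=; last by rewrite !IH; ring.
by rewrite /trap /F; field.
Qed.

Lemma edge_near g h gam N a b (K L : R) : a <= b -> 0 <= K -> 0 <= L ->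
  (forall s, a <= s <= b -> normc (g (gam s) - h (gam s)) <= K) ->
  (forall s t, a <= s <= b -> a <= t <= b ->
     normc (gam s - gam t) <= L * `|s - t|) ->
  normc (edge g gam N a b - edge h gam N a b) <= K * L * (b - a).
Proof.
move=> + K0 L0; elim: N a b => [|N IH] a b ab gh gamL /=.
  rewrite /trap.
  have -> : (g (gam a) + g (gam b)) / 2 * (gam b - gam a) -
      (h (gam a) + h (gam b)) / 2 * (gam b - gam a) =
      ((g (gam a) - h (gam a)) + (g (gam b) - h (gam b))) / 2 * (gam b - gam a) by field.
  have Ka : normc (g (gam a) - h (gam a)) <= K by apply: gh; rewrite lexx.
  have Kb : normc (g (gam b) - h (gam b)) <= K by apply: gh; rewrite lexx ab.
  have Lab : normc (gam b - gam a) <= L * (b - a).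
    rewrite -[X in _ * X]ger0_norm ?subr_ge0//; apply: gamL; rewrite ?lexx ?ab //.
  rewrite normcM -mulrA ler_pM ?normc_ge0// normc_f normc_nat ler_pdivrMr//.
  by rewrite (le_trans (le_normcD _ _))//; lra.
have am : a <= (a + b) / 2 by lra.
have mb : (a + b) / 2 <= b by lra.
have H1 : normc (edge g gam N a ((a + b) / 2) - edge h gam N a ((a + b) / 2))
    <= K * L * ((a + b) / 2 - a).
  by apply: IH => // [s Hs|s t Hs Ht]; [apply: gh|apply: gamL]; lra.
have H2 : normc (edge g gam N ((a + b) / 2) b - edge h gam N ((a + b) / 2) b)
    <= K * L * (b - (a + b) / 2).
  by apply: IH => // [s Hs|s t Hs Ht]; [apply: gh|apply: gamL]; lra.
rewrite opprD addrACA (le_trans (le_normcD _ _))//.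
by rewrite (le_trans (lerD H1 H2))// -mulrDr ler_wpM2l ?mulr_ge0//; lra.
Qed.

Section Nested.
Variable s : nat -> R.
Hypothesis sS : forall n, s n <= s n.+1 <= s n + (2 ^- n.+1).

Lemma nested_halves : exists p, forall n, s n <= p <= s n + 2 ^- n.
Proof.
have half n : (2 : R) ^- n = 2 ^- n.+1 + 2 ^- n.+1.
  by rewrite exprS invfM; field; rewrite expf_neq0.
have up n m : s n <= s (m + n)%N.
  by elim: m => // m /le_trans; apply; rewrite addSn; case/andP: (sS (m + n)).
have dn n m : s (m + n)%N + 2 ^- (m + n) <= s n + 2 ^- n.
  elim: m => // m; apply: le_trans; rewrite addSn.
  by have /andP[_] := sS (m + n); rewrite (half (m + n)%N); lra.
have pos n : 0 <= (2 : R) ^- n by rewrite invr_ge0 exprn_ge0.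
have bnd n m : s m <= s n + 2 ^- n.
  have [nm|/ltnW mn] := leqP n m.
    by rewrite (le_trans _ (dn n (m - n)%N))// subnK// lerDl.
  by rewrite (le_trans (up m (n - m)%N))// subnK// lerDl.
have hs : has_sup (range s).
  by split; [exists (s 0%N), 0%N|exists (s 0%N + 2 ^- 0) => _ [m _ <-]].
exists (sup (range s)) => n; apply/andP; split.
  by apply: ub_le_sup; [exact: hs.2|exists n].
by apply: ge_sup; [exact: hs.1|move=> _ [m _ <-]].
Qed.

End Nested.

Lemma half_expn_lt (e : R) : 0 < e -> exists n, 2 ^- n < e.
Proof.
move=> e0; exists (Num.bound e^-1).
rewrite invf_plt ?posrE ?exprn_gt0//.
have /archi_boundP : 0 <= e^-1 by rewrite invr_ge0 ltW.
move=> /lt_trans; apply; rewrite -natrX ltr_nat; exact: ltn_expl.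
Qed.

(** Goursat's bisection.  The trapezoidal rule is exact on affine functions, so
the sum around a small square, on which [g] is nearly affine, is negligible
compared with the area, however finely its sides are subdivided; squares
violating such a bound would be nested around a point where [g] is not
differentiable. *)
Lemma goursat g (G : R -> R -> R[i]) (L : R) :
  (forall x y x' y', 0 <= x <= 1 -> 0 <= y <= 1 -> 0 <= x' <= 1 -> 0 <= y' <= 1 ->
     normc (G x y - G x' y') <= L * (`|x - x'| + `|y - y'|)) ->
  (forall x y, 0 <= x <= 1 -> 0 <= y <= 1 -> chol g (G x y)) ->
  clim (fun N => square_sum g G N 0 0 1) 0.
Proof.
move=> GL gG e e0.
have L0 : 0 <= L.
  have := GL 0 0 0 1; rewrite !lexx ler01 => /(_ isT isT isT isT).
  rewrite subrr sub0r normrN normr0 normr1 add0r mulr1; apply: le_trans.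
  exact: normc_ge0.
(* bounds proportional to the area are inherited from the four quarters *)
pose good n x y := exists N0, forall N, (N0 <= N)%N ->
  normc (square_sum g G N x y (2 ^- n)) <= e / 2 * 4 ^- n.
suff [N0 HN0] : good 0%N 0 0.
  exists N0 => N /HN0; rewrite expr0 invr1 mulr1 subr0 => /le_lt_trans; apply.
  by lra.
have step n x y : ~ good n x y -> exists ij : bool * bool,
    ~ good n.+1 (x + ij.1%:R * 2 ^- n.+1) (y + ij.2%:R * 2 ^- n.+1).
  move=> bad; apply: contrapT => allgood; apply: bad.
  have gd i j : good n.+1 (x + (i : bool)%:R * 2 ^- n.+1) (y + (j : bool)%:R * 2 ^- n.+1).
    by apply: contrapT => bad; apply: allgood; exists (i, j).
  have [N00 H00] := gd false false; have [N01 H01] := gd false true.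
  have [N10 H10] := gd true false; have [N11 H11] := gd true true.
  exists (maxn (maxn N00 N01) (maxn N10 N11)).+1 => -[//|N].
  rewrite ltnS !geq_max => /andP[/andP[/H00 K00 /H01 K01] /andP[/H10 K10 /H11 K11]].
  have half : (2 : R) ^- n / 2 = 2 ^- n.+1 by rewrite exprSr invfM.
  rewrite square_sumS half.
  move: K00 K01 K10 K11; rewrite !mul0r !mul1r !addr0 => K00 K01 K10 K11.
  rewrite !(le_trans (le_normcD _ _))//.
  have -> : (4 : R) ^- n = 4 * 4 ^- n.+1 by rewrite exprS invfM mulrA divff ?mul1r.
  have := le_normcD (square_sum g G N x y (2 ^- n.+1) +
     square_sum g G N (x + 2 ^- n.+1) y (2 ^- n.+1))
     (square_sum g G N x (y + 2 ^- n.+1) (2 ^- n.+1)).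
  have := le_normcD (square_sum g G N x y (2 ^- n.+1))
     (square_sum g G N (x + 2 ^- n.+1) y (2 ^- n.+1)).
  by lra.
apply: contrapT => bad0.
have /choice[pick Hpick] : forall nxy : nat * (R * R), exists ij : bool * bool,
    ~ good nxy.1 nxy.2.1 nxy.2.2 ->
    ~ good nxy.1.+1 (nxy.2.1 + ij.1%:R * 2 ^- nxy.1.+1) (nxy.2.2 + ij.2%:R * 2 ^- nxy.1.+1).
  move=> [n [x y]] /=; have [gd|/step[ij Hij]] := pselect (good n x y).
    by exists (false, false).
  by exists ij.
pose next n (xy : R * R) := let ij := pick (n, xy) in
  (xy.1 + ij.1%:R * 2 ^- n.+1, xy.2 + ij.2%:R * 2 ^- n.+1).
pose fix s n := if n is n'.+1 then next n' (s n') else (0, 0) : R * R.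
have sbad n : ~ good n (s n).1 (s n).2.
  elim: n => //= n IH.
  by have := Hpick (n, s n) IH.
have b2 (i : bool) n : 0 <= i%:R * (2 : R) ^- n.+1 <= 2 ^- n.+1.
  have p0 : 0 <= (2 : R) ^- n.+1 by rewrite invr_ge0 exprn_ge0.
  by case: i; rewrite ?mul1r ?mul0r lexx p0.
have [p Hp] : exists p, forall n, (s n).1 <= p <= (s n).1 + 2 ^- n.
  apply: (@nested_halves (fun n => (s n).1)) => n /=.
  by have := b2 (pick (n, s n)).1 n; rewrite lerDl lerD2l.
have [q Hq] : exists q, forall n, (s n).2 <= q <= (s n).2 + 2 ^- n.
  apply: (@nested_halves (fun n => (s n).2)) => n /=.
  by have := b2 (pick (n, s n)).2 n; rewrite lerDl lerD2l.
have sin n : (0 <= (s n).1 /\ (s n).1 + 2 ^- n <= 1) /\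
             (0 <= (s n).2 /\ (s n).2 + 2 ^- n <= 1).
  elim: n => [|n [[h1 h2] [h3 h4]]] /=; first by rewrite expr0 invr1 lexx add0r lexx.
  have half : (2 : R) ^- n = 2 ^- n.+1 + 2 ^- n.+1.
    by rewrite exprS invfM; field; rewrite expf_neq0.
  have := b2 (pick (n, s n)).1 n; have := b2 (pick (n, s n)).2 n.
  by lra.
have Hp0 := Hp 0%N; have Hq0 := Hq 0%N; rewrite /= expr0 invr1 add0r in Hp0 Hq0.
have [a /cderivP ga] := gG p q Hp0 Hq0.
(* the four sides of a square of side [r] contribute [8 L ^+ 2 eta r ^+ 2] *)
pose eta := e / (16 * L ^+ 2 + 1).
have den : 0 < 16 * L ^+ 2 + 1 by rewrite ltr_wpDl// mulr_ge0// sqr_ge0.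
have eta0 : 0 < eta by rewrite divr_gt0.
have [d d0 Hd] := ga _ eta0.
have [n Hn] : exists n, 2 ^- n < d / (2 * L + 1).
  by apply: half_expn_lt; rewrite divr_gt0// ltr_wpDl// mulr_ge0.
apply: (sbad n); exists 0%N => N _.
set r := 2 ^- n in Hn *.
have r0 : 0 < r by rewrite invr_gt0 exprn_gt0.
have {}Hn : 2 * L * r < d.
  move: Hn; rewrite ltr_pdivlMr ?ltr_wpDl ?mulr_ge0// mulrDr mulr1 => H.
  by rewrite mulrC; lra.
have [[x0 x1] [y0 y1]] := sin n; have Hpn := Hp n; have Hqn := Hq n.
rewrite -/r in x1 y1 Hpn Hqn.
set x := (s n).1 in x0 x1 Hpn *; set y := (s n).2 in y0 y1 Hqn *.
pose h z := g (G p q) + a * (z - G p q).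
pose K := eta * (2 * L * r).
have K0 : 0 <= K.
  by apply: mulr_ge0; [exact: ltW|apply: mulr_ge0; [apply: mulr_ge0|exact: ltW]].
have inx x' : x <= x' <= x + r -> 0 <= x' <= 1 by lra.
have iny y' : y <= y' <= y + r -> 0 <= y' <= 1 by lra.
have near x' y' : x <= x' <= x + r -> y <= y' <= y + r ->
    normc (g (G x' y') - h (G x' y')) <= K.
  move=> xx yy.
  have GG : normc (G x' y' - G p q) <= 2 * L * r.
    apply: (le_trans (GL _ _ _ _ (inx _ xx) (iny _ yy) Hp0 Hq0)).
    have h1 : `|x' - p| <= r by rewrite ler_norml; lra.
    have h2 : `|y' - q| <= r by rewrite ler_norml; lra.
    have -> : 2 * L * r = L * (r + r) by ring.
    by rewrite ler_wpM2l// lerD.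
  rewrite /h opprD addrA (le_trans (Hd _ (le_lt_trans GG Hn)))//.
  by rewrite ler_pM2l.
have ed1 gam c : 0 <= c -> c + r <= 1 ->
    (forall s, c <= s <= c + r -> normc (g (gam s) - h (gam s)) <= K) ->
    (forall s t, c <= s <= c + r -> c <= t <= c + r ->
       normc (gam s - gam t) <= L * `|s - t|) ->
    normc (edge g gam N c (c + r) - edge h gam N c (c + r)) <= K * L * r.
  move=> c0 c1 H1 H2; have -> : K * L * r = K * L * (c + r - c) by rewrite addrC addKr.
  by apply: edge_near => //; lra.
have hx y' : y <= y' <= y + r ->
  normc (edge g (G^~ y') N x (x + r) - edge h (G^~ y') N x (x + r)) <= K * L * r.
  move=> yy; apply: ed1 => // [s' ss|s' t ss tt]; first exact: near.
  have := GL _ _ _ _ (inx _ ss) (iny _ yy) (inx _ tt) (iny _ yy).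
  by rewrite subrr normr0 addr0.
have hy x' : x <= x' <= x + r ->
  normc (edge g (G x') N y (y + r) - edge h (G x') N y (y + r)) <= K * L * r.
  move=> xx; apply: ed1 => // [s' ss|s' t ss tt]; first exact: near.
  have := GL _ _ _ _ (inx _ xx) (iny _ ss) (inx _ xx) (iny _ tt).
  by rewrite subrr normr0 add0r.
(* exactness on affine functions: the sum telescopes around the square *)
have hsq : square_sum h G N x y r = 0.
  by rewrite /square_sum /h !edge_affine; ring.
rewrite -[square_sum g _ _ _ _ _]subr0 -hsq /square_sum.
have le0 c : c <= c <= c + r by rewrite lexx lerDl ltW.
have ler c : c <= c + r <= c + r by rewrite lexx lerDl ltW.
have := hx y (le0 y); have := hx (y + r) (ler y).
have := hy x (le0 x); have := hy (x + r) (ler x).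
set e1 := edge g _ _ _ _; set e1' := edge h _ _ _ _.
set e2 := edge g _ _ _ _; set e2' := edge h _ _ _ _.
set e3 := edge g _ _ _ _; set e3' := edge h _ _ _ _.
set e4 := edge g _ _ _ _; set e4' := edge h _ _ _ _ => H1 H2 H3 H4.
have -> : e4 + e1 - e3 - e2 - (e4' + e1' - e3' - e2') =
  (e4 - e4') + (e1 - e1') - (e3 - e3') - (e2 - e2') by ring.
have := le_normcB ((e4 - e4') + (e1 - e1') - (e3 - e3')) (e2 - e2').
have := le_normcB ((e4 - e4') + (e1 - e1')) (e3 - e3').
have := le_normcD (e4 - e4') (e1 - e1').
have -> : (4 : R) ^- n = r * r.
  by rewrite /r -invfM -exprMn; congr (_ ^- _); ring.
suff : 4 * (K * L * r) <= e / 2 * (r * r) by lra.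
rewrite /K.
have -> : 4 * (eta * (2 * L * r) * L * r) = (8 * L ^+ 2 * eta) * (r * r) by ring.
apply: ler_wpM2r; first by rewrite mulr_ge0 ?ltW.
rewrite /eta mulrA ler_pdivrMr// -subr_ge0.
have -> : e / 2 * (16 * L ^+ 2 + 1) - 8 * L ^+ 2 * e = e / 2 by field.
by rewrite divr_ge0// ltW.
Qed.

End Goursat.

(** * Means over roots of unity and Cauchy's formula *)

Section Circle.
Context {R : realType}.
Implicit Types (f g F : R[i] -> R[i]) (x y r : R) (c z u : R[i]).

Definition cis x : R[i] := cos (2 * pi * x) +i* sin (2 * pi * x).

Lemma cis0 : cis 0 = 1.
Proof. by rewrite /cis mulr0 cos0 sin0. Qed.

Lemma cis1 : cis 1 = 1.
Proof. by rewrite /cis mulr1 mulr_natl cos2pi sin2pi. Qed.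

Lemma cisD x y : cis (x + y) = cis x * cis y.
Proof.
rewrite /cis mulrDr cosD sinD; apply/eqP.
by rewrite eq_complex /= eqxx addrC mulrC [_ * cos _]mulrC !eqxx.
Qed.

Lemma normc_cis x : normc (cis x) = 1.
Proof. by rewrite /cis /= cos2Dsin2 sqrtr1. Qed.

Lemma cis_neq0 x : cis x != 0.
Proof. by rewrite -normc_eq0 normc_cis oner_eq0. Qed.

Lemma cisV x : (cis x)^-1 = conjc (cis x).
Proof.
apply: (mulfI (cis_neq0 x)); rewrite divff ?cis_neq0// mulcJ normc_cis.
by rewrite expr1n.
Qed.

Lemma cisX x n : cis (x * n%:R) = cis x ^+ n.
Proof.
elim: n => [|n IH]; first by rewrite mulr0 cis0.
by rewrite -natr1 mulrDr mulr1 cisD IH exprSr.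
Qed.

Lemma cis_half : cis (2^-1) = -1.
Proof.
rewrite /cis mulrAC divff// mul1r cospi sinpi.
by apply/eqP; rewrite eq_complex /= oppr0 !eqxx.
Qed.

Lemma cos_lip x y : `|cos x - cos y| <= `|x - y|.
Proof.
wlog xy : x y / x <= y => [H|].
  have [|/ltW] := leP x y; first exact: H.
  by move/H; rewrite distrC [`|y - x|]distrC.
rewrite distrC [`|x - y|]distrC.
have cc : {within `[x, y], continuous (@cos R)}.
  by apply: continuous_subspaceT; exact: continuous_cos.
have [xi _ ->] := @MVT_segment R cos (fun x => - sin x) x y xy
  (fun x _ => is_derive_cos x) cc.
by rewrite normrM normrN ler_piMl// sin_max.
Qed.

Lemma sin_lip x y : `|sin x - sin y| <= `|x - y|.
Proof.
have -> : x - y = (x - pi / 2) - (y - pi / 2) by ring.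
by rewrite -!cosBpihalf cos_lip.
Qed.

Lemma cis_lip x y : normc (cis x - cis y) <= 4 * pi * `|x - y|.
Proof.
rewrite (le_trans (normc_le_ReIm _))//=.
have -> : 4 * pi * `|x - y| = `|2 * pi * x - 2 * pi * y| + `|2 * pi * x - 2 * pi * y|.
  by rewrite -mulrBr !normrM normr_nat (ger0_norm (pi_ge0 R)); ring.
by rewrite lerD// ?cos_lip ?sin_lip.
Qed.

Lemma pow2_neq0 (K : numDomainType) N : (2 ^ N)%:R != 0 :> K.
Proof. by rewrite pnatr_eq0 -lt0n expn_gt0. Qed.

(** Taking the mean over a power of two many roots of unity makes its sample
points those of [edge]. *)
Definition rmean F N : R[i] :=
  ((2 ^ N)%:R)^-1 * \sum_(m < 2 ^ N) F (cis (m%:R / (2 ^ N)%:R)).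

Lemma sample_in01 N (m : 'I_(2 ^ N)) : 0 <= (m%:R / (2 ^ N)%:R : R) <= 1.
Proof.
by rewrite divr_ge0//= ler_pdivrMr ?ltr0n ?expn_gt0// mul1r ler_nat ltnW.
Qed.

Lemma rmean_le01 F N (B : R) :
  (forall x, 0 <= x <= 1 -> normc (F (cis x)) <= B) -> normc (rmean F N) <= B.
Proof.
move=> FB; rewrite /rmean normcM normcV normc_nat mulrC ler_pdivrMr ?ltr0n ?expn_gt0//.
rewrite (le_trans (normc_sum _ _ _))//.
apply: (le_trans (ler_sum _ (fun i _ => FB _ (sample_in01 i)))).
by rewrite sumr_const card_ord mulr_natr.
Qed.

Lemma rmean_le F N (B : R) : (forall x, normc (F (cis x)) <= B) ->
  normc (rmean F N) <= B.
Proof. by move=> H; apply: rmean_le01. Qed.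

Lemma Re_rmean F N :
  complex.Re (rmean F N) =
  (2 ^ N)%:R^-1 * \sum_(m < 2 ^ N) complex.Re (F (cis (m%:R / (2 ^ N)%:R))).
Proof.
rewrite /rmean -raddf_sum -(rmorph_nat (real_complex R)) -fmorphV.
by case: (\sum_(m < _) _) => a b /=; rewrite mul0r subr0.
Qed.

Lemma Re_rmean_le F N (B : R) : (forall x, complex.Re (F (cis x)) <= B) ->
  complex.Re (rmean F N) <= B.
Proof.
move=> FB; rewrite Re_rmean mulrC ler_pdivrMr ?ltr0n ?expn_gt0//.
apply: (le_trans (ler_sum _ (fun i _ => FB _))).
by rewrite sumr_const card_ord mulr_natr.
Qed.

Lemma rmean_rot F N :
  rmean (fun w => F (w * cis ((2 ^ N)%:R)^-1)) N = rmean F N.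
Proof.
congr (_ * _); set n := (2 ^ N)%N.
have nR : n%:R != 0 :> R by rewrite pow2_neq0.
have H : F (cis (0%N%:R / n%:R)) + \sum_(m < n) F (cis (m.+1%:R / n%:R)) =
    \sum_(m < n) F (cis (m%:R / n%:R)) + F (cis (n%:R / n%:R)).
  transitivity (\sum_(m < n.+1) F (cis (m%:R / n%:R))).
    by rewrite big_ord_recl.
  by rewrite big_ord_recr.
rewrite mul0r cis0 divff// cis1 [RHS]addrC in H.
move/addrI: H => <-; apply: eq_bigr => m _.
by rewrite -cisD -natr1 mulrDl mul1r.
Qed.

Lemma rmeanD F G N : rmean (fun w => F w + G w) N = rmean F N + rmean G N.
Proof. by rewrite /rmean big_split mulrDr. Qed.

Lemma rmeanZ a F N : rmean (fun w => a * F w) N = a * rmean F N.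
Proof. by rewrite /rmean -mulr_sumr mulrCA. Qed.

Lemma rmeanB F G N : rmean (fun w => F w - G w) N = rmean F N - rmean G N.
Proof.
by rewrite /rmean big_split mulrDr /= sumrN mulrN.
Qed.

Lemma eq_rmean F G N : (forall x, F (cis x) = G (cis x)) -> rmean F N = rmean G N.
Proof. by move=> FG; rewrite /rmean; under eq_bigr do rewrite FG. Qed.

Lemma rmean_cst a N : rmean (fun=> a) N = a.
Proof.
by rewrite /rmean sumr_const card_ord -[a *+ _]mulr_natl mulKf// pow2_neq0.
Qed.

Lemma rmean_dist F G N (B : R) : (forall x, normc (F (cis x) - G (cis x)) <= B) ->
  normc (rmean F N - rmean G N) <= B.
Proof. by rewrite -rmeanB; exact: rmean_le. Qed.

Lemma rmeanJ F N : rmean (fun w => (conjc (F w))) N = conjc (rmean F N).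
Proof. by rewrite /rmean rmorphM fmorphV rmorph_nat rmorph_sum. Qed.

Lemma edge_sum g (gam : R -> R[i]) N a b : edge g gam N a b =
  \sum_(m < 2 ^ N) trap g (gam (a + (b - a) * (m%:R / (2 ^ N)%:R)))
                          (gam (a + (b - a) * (m.+1%:R / (2 ^ N)%:R))).
Proof.
elim: N a b => [|N IH] a b /=.
  by rewrite expn0 big_ord1 mul0r mulr0 addr0 divr1 mulr1 addrC subrK.
have e2 := pow2_neq0 R N.
have -> : (2 ^ N.+1 = 2 ^ N + 2 ^ N)%N by rewrite expnS mul2n addnn.
rewrite big_split_ord /= !IH; congr (_ + _); apply: eq_bigr => m _;
  congr (trap _ (gam _) (gam _)); rewrite ?natrD -?addnS ?natrD -?natr1; field;
  by rewrite ?e2 // -natrD pnatr_eq0 addn_eq0 expn_eq0.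
Qed.

Definition root2 N : R[i] := cis ((2 ^ N)%:R)^-1.

(** Lower bound for the chord, by halving the angle:
[|u ^ 2 - 1| <= 2 |u - 1|] on the unit circle. *)
Lemma root2_dist N : 4 / (2 ^ N.+1)%:R <= normc (root2 N.+1 - 1).
Proof.
elim: N => [|N IH].
  rewrite /root2 expn1 cis_half; have -> : -1 - 1 = - 2%:R :> R[i] by ring.
  by rewrite normcN normc_nat; lra.
have sq : root2 N.+1 = root2 N.+2 ^+ 2.
  rewrite -cisX /root2; congr cis; rewrite [(2 ^ N.+2)%N]expnS natrM.
  by field; exact: pow2_neq0.
have : normc (root2 N.+1 - 1) <= 2 * normc (root2 N.+2 - 1).
  rewrite sq subr_sqr_1 normcM mulrC ler_wpM2r ?normc_ge0//.
  by rewrite (le_trans (le_normcD _ _))// normc_cis normc1.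
have -> : 4 / (2 ^ N.+2)%:R = 4 / (2 ^ N.+1)%:R / 2 :> R.
  by rewrite [(2 ^ N.+2)%N]expnS natrM; field; rewrite pnatr_eq0 -lt0n expn_gt0.
by lra.
Qed.

(** By rotation invariance the trapezoidal sum over a circle is a mean, up to a
factor that depends on [N] alone.  The factor tends to [2 pi i]; all that matters
is that it stays away from zero. *)
Lemma edge_circle g c r N : edge g (fun y => c + r%:C * cis y) N 0 1 =
  ((2 ^ N)%:R * (root2 N - (root2 N)^-1) / 2)
   * rmean (fun w => g (c + r%:C * w) * (r%:C * w)) N.
Proof.
set n := (2 ^ N)%N; have n0 : (0 < n)%N by rewrite expn_gt0.
have nR : n%:R != 0 :> R by rewrite pnatr_eq0 -lt0n.
have nC : n%:R != 0 :> R[i] by rewrite pnatr_eq0 -lt0n.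
pose z m := c + r%:C * cis (m%:R / n%:R).
have wS m : cis (m.+1%:R / n%:R) = cis (m%:R / n%:R) * root2 N.
  by rewrite -cisD -natr1 mulrDl mul1r.
pose G m := g (z m) * (z m - (c + r%:C * (cis (m%:R / n%:R) / root2 N))).
have shift : \sum_(m < n) G m.+1 = \sum_(m < n) G m.
  have H : G 0%N + \sum_(m < n) G m.+1 = \sum_(m < n) G m + G n.
    by transitivity (\sum_(m < n.+1) G m); [rewrite big_ord_recl|rewrite big_ord_recr].
  have Gn : G n = G 0%N by rewrite /G /z divff// mul0r cis0 cis1.
  by apply: (@addrI _ (G 0%N)); rewrite H Gn addrC.
have rN : root2 N != 0 by exact: cis_neq0.
rewrite edge_sum -/n.
transitivity (\sum_(m < n) (g (z m) * (z m.+1 - z m) / 2 + G m.+1 / 2)).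
  apply: eq_bigr => m _; rewrite /trap !subr0 !add0r !mul1r -/(z m) -/(z m.+1).
  by rewrite /G wS mulfK// -/(z m); field.
rewrite big_split /= -mulr_suml -[X in _ + X]mulr_suml shift -mulrDl -big_split /=.
rewrite /rmean -/n mulrA.
have -> : n%:R * (root2 N - (root2 N)^-1) / 2 / n%:R = (root2 N - (root2 N)^-1) / 2.
  by field; rewrite nC rN.
rewrite mulr_suml mulr_sumr; apply: eq_bigr => m _.
by rewrite /G /z wS; field.
Qed.

Lemma circle_weight_ge N :
  4 <= normc ((2 ^ N.+2)%:R * (root2 N.+2 - (root2 N.+2)^-1) / 2).
Proof.
have rN : root2 N.+2 != 0 by exact: cis_neq0.
have sq : root2 N.+1 = root2 N.+2 ^+ 2.
  rewrite -cisX /root2; congr cis; rewrite [(2 ^ N.+2)%N]expnS natrM.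
  by field; exact: pow2_neq0.
have -> : root2 N.+2 - (root2 N.+2)^-1 = (root2 N.+1 - 1) / root2 N.+2.
  by rewrite sq; field.
rewrite !normc_f normcM !normc_f !normc_nat normc_cis divr1.
have := root2_dist N; rewrite ler_pdivrMr ?ltr0n ?expn_gt0// => H.
rewrite expnS natrM ler_pdivlMr//; lra.
Qed.

(** Homotopy invariance, for the linear homotopy between two circles.  The sums
over opposite sides of the parameter square that correspond to the end points of
the circles cancel, so that [goursat] compares the two circles. *)
Lemma circle_homotopy g c1 c2 r1 r2 :
  (forall x y, 0 <= x <= 1 ->
     chol g (((1 - x)%:C * c1 + x%:C * c2) + ((1 - x) * r1 + x * r2)%:C * cis y)) ->
  clim (fun N => rmean (fun w => g (c1 + r1%:C * w) * (r1%:C * w)) N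
               - rmean (fun w => g (c2 + r2%:C * w) * (r2%:C * w)) N) 0.
Proof.
move=> gG.
pose G x y := ((1 - x)%:C * c1 + x%:C * c2) + ((1 - x) * r1 + x * r2)%:C * cis y.
pose L := normc (c2 - c1) + normc ((r2 - r1)%:C) + (`|r1| + `|r2|) * (4 * pi).
have pi0 := pi_ge0 R.
have GL x y x' y' : 0 <= x <= 1 -> 0 <= y <= 1 -> 0 <= x' <= 1 -> 0 <= y' <= 1 ->
    normc (G x y - G x' y') <= L * (`|x - x'| + `|y - y'|).
  move=> x01 _ x'01 _.
  have -> : G x y - G x' y' = (x - x')%:C * ((c2 - c1) + (r2 - r1)%:C * cis y)
     + ((1 - x') * r1 + x' * r2)%:C * (cis y - cis y').
    by rewrite /G !(rmorphB, rmorphD, rmorphM, rmorph1) /=; ring.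
  have H1 : normc ((x - x')%:C * (c2 - c1 + (r2 - r1)%:C * cis y))
     <= `|x - x'| * (normc (c2 - c1) + normc ((r2 - r1)%:C)).
    rewrite normcM normcR ler_wpM2l// (le_trans (le_normcD _ _))//.
    by rewrite normcM normc_cis mulr1.
  have H2 : normc (((1 - x') * r1 + x' * r2)%:C * (cis y - cis y'))
     <= (`|r1| + `|r2|) * (4 * pi * `|y - y'|).
    rewrite normcM normcR ler_pM ?normc_ge0 ?cis_lip//.
    rewrite (le_trans (ler_normD _ _))// !normrM lerD//.
      by rewrite ler_piMl// ler_norml; lra.
    by rewrite ler_piMl// ler_norml; lra.
  apply: (le_trans (le_normcD _ _)); apply: (le_trans (lerD H1 H2)); rewrite /L.
  set A := normc (c2 - c1) + _; set B := `|r1| + `|r2|.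
  have A0 : 0 <= A by rewrite addr_ge0 ?normc_ge0.
  have B0 : 0 <= B * (4 * pi).
    by apply: mulr_ge0; [exact: addr_ge0|apply: mulr_ge0].
  rewrite [leRHS]mulrDr lerD//.
    by rewrite mulrC ler_wpM2r// lerDl.
  by rewrite mulrA ler_wpM2r// lerDr.
have := goursat GL (fun x y x01 _ => gG x y x01).
move=> H e e0; have [M HM] := H (4 * e) ltac:(lra); exists M.+2 => -[//|[//|N]] MN.
have {HM}HM := HM N.+2 (leq_trans (leqW (leqW (leqnn M))) MN).
rewrite subr0 in HM; rewrite subr0; have K4 := circle_weight_ge N.
set K := _ / 2 in K4.
rewrite -normcN opprB.
have E : square_sum g G N.+2 0 0 1 = K *
   (rmean (fun w => g (c2 + r2%:C * w) * (r2%:C * w)) N.+2 -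
    rmean (fun w => g (c1 + r1%:C * w) * (r1%:C * w)) N.+2).
  rewrite mulrBr /K -!edge_circle /square_sum.
  have -> : G^~ (0 + 1) = G^~ 0 by apply/funext => x; rewrite /G add0r cis0 cis1.
  have -> : G (0 + 1) = fun y => c2 + r2%:C * cis y.
    by apply/funext => y; rewrite /G add0r subrr !mul0r mul1r mul1r !add0r.
  have -> : G 0 = fun y => c1 + r1%:C * cis y.
    by apply/funext => y; rewrite /G subr0 !mul0r !mul1r !addr0.
  by rewrite add0r; ring.
rewrite E normcM in HM.
set X := normc (_ - _) in HM *; have X0 : 0 <= X by exact: normc_ge0.
have : 4 * X <= normc K * X by rewrite ler_wpM2r.
by lra.
Qed.

(** Cauchy's formula, the circle being contracted to [u] where [f] is continuous. *)
Lemma cauchy_mean f c r u : normc (u - c) < r ->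
  (forall z, normc (z - c) <= r -> chol f z) ->
  clim (rmean (fun w => f (c + r%:C * w) * (r%:C * w) / (c + r%:C * w - u))) (f u).
Proof.
move=> ur fh; have r0 : 0 < r by exact: le_lt_trans (normc_ge0 _) ur.
apply: clim_near => e e0.
have [d d0 Hd] := chol_ccont (fh u (ltW ur)) e0.
pose s := Num.min (d / 2) ((r - normc (u - c)) / 2).
have s0 : 0 < s by rewrite lt_min !divr_gt0// subr_gt0.
have sd : s < d.
  have : s <= d / 2 by rewrite ge_min lexx.
  by lra.
have sr : s + normc (u - c) < r.
  have : s <= (r - normc (u - c)) / 2 by rewrite ge_min lexx orbT.
  lra.
have H := @circle_homotopy (fun z => f z / (z - u)) c u r s.
have {}H : clim (fun N => rmean (fun w => f (c + r%:C * w) * (r%:C * w) / (c + r%:C * w - u)) N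
   - rmean (fun w => f (u + s%:C * w)) N) 0.
  apply: eq_clim (H _) => [N|x y x01].
    congr (_ - _); apply: eq_rmean => x; first by rewrite mulrAC.
    rewrite [u + _ - u]addrC addKr mulfVK// mulf_neq0 ?cis_neq0//.
    by rewrite -normc_eq0 normcR normr_eq0 gt_eqF.
  set z := (X in chol _ X).
  have zu : normc (z - u) > 0.
    have -> : z - u = ((1 - x) * r + x * s)%:C * cis y - (1 - x)%:C * (u - c).
      by rewrite /z !(rmorphB, rmorphD, rmorphM, rmorph1) /=; ring.
    have := lB_normcB (((1 - x) * r + x * s)%:C * cis y) ((1 - x)%:C * (u - c)).
    apply: lt_le_trans; rewrite !normcM !normcR normc_cis mulr1.
    have x0 : 0 <= 1 - x by lra.
    have xrs : 0 <= (1 - x) * r + x * s by apply: addr_ge0; apply: mulr_ge0; lra.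
    rewrite (ger0_norm x0) (ger0_norm xrs).
    have : (1 - x) * normc (u - c) <= (1 - x) * (r - s) by apply: ler_wpM2l; lra.
    by lra.
  have zc : normc (z - c) <= r.
    have -> : z - c = x%:C * (u - c) + ((1 - x) * r + x * s)%:C * cis y.
      by rewrite /z !(rmorphB, rmorphD, rmorphM, rmorph1) /=; ring.
    rewrite (le_trans (le_normcD _ _))// !normcM !normcR normc_cis mulr1.
    have x0 : 0 <= x by lra.
    have xrs : 0 <= (1 - x) * r + x * s by apply: addr_ge0; apply: mulr_ge0; lra.
    rewrite (ger0_norm x0) (ger0_norm xrs).
    have : x * (normc (u - c) + s) <= x * r by apply: ler_wpM2l; lra.
    by lra.
  apply: cholM; first exact: fh.
  apply: cholV; first by rewrite -normc_gt0.
  by apply: cholB; [exact: chol_id|exact: chol_cst].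
exists (rmean (fun w => f (u + s%:C * w))).
  by have [N HN] := H _ e0; exists N => n /HN; rewrite subr0 => /ltW.
exists 0%N => n _; rewrite -[X in _ - X](rmean_cst _ n).
apply: rmean_dist => x; apply: ltW; apply: Hd.
by rewrite addrC addKr normcM normc_cis mulr1 normcR gtr0_norm.
Qed.

End Circle.

(** * Consequences of Cauchy's formula *)

Section Consequences.
Context {R : realType}.
Implicit Types (f g F : R[i] -> R[i]) (x y r : R) (c z u v : R[i]).

Lemma clim_cauchy (s : nat -> R[i]) :
  (forall e : R, 0 < e -> exists N, forall n m, (N <= n)%N -> (N <= m)%N ->
     normc (s n - s m) < e) -> exists l, clim s l.
Proof.
move=> H.
have cvg_part (p : R[i] -> R) : (forall z w, `|p z - p w| <= normc (z - w)) ->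
    exists l, forall e : R, 0 < e -> exists N, forall n, (N <= n)%N -> `|p (s n) - l| < e.
  move=> pl.
  have : cvg ((p \o s) @ \oo).
    apply/cauchy_cvgP; apply/cauchy_exP => e e0.
    have [N HN] := H _ e0; exists (p (s N)); exists N => // n /= Nn.
    by rewrite /ball /= (le_lt_trans (pl _ _))// HN.
  move=> /cvg_ex[l /cvgrPdist_lt Hl]; exists l => e /Hl[N _ HN].
  by exists N => n /HN; rewrite distrC.
have [a Ha] := cvg_part (@complex.Re R) (fun z w => ltac:(rewrite -raddfB; exact: Re_le_normc)).
have [b Hb] := cvg_part (@complex.Im R) (fun z w => ltac:(rewrite -raddfB; exact: Im_le_normc)).
exists (a +i* b) => e e0; have e2 : 0 < e / 2 by rewrite divr_gt0.
have [N HN] := Ha _ e2; have [M HM] := Hb _ e2.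
exists (maxn N M) => n; rewrite geq_max => /andP[/HN H1 /HM H2].
rewrite (le_lt_trans (normc_le_ReIm _))//.
by move: (s n) H1 H2 => [p q] /=; lra.
Qed.

(** A pointwise limit of functions with a uniform quadratic Taylor estimate at [u]
is differentiable at [u]: dividing the estimate by a small fixed [v - u] shows that
the slopes [B N] form a Cauchy sequence. *)
Lemma clim_cderiv (A : nat -> R[i] -> R[i]) (B : nat -> R[i]) F u (rho C : R) :
  0 < rho -> 0 <= C ->
  (forall v, normc (v - u) < rho -> clim (A^~ v) (F v)) ->
  (forall N v, normc (v - u) < rho ->
     normc (A N v - A N u - B N * (v - u)) <= C * normc (v - u) ^+ 2) ->
  exists L, [/\ clim B L, cderiv F u L &
    forall v, normc (v - u) < rho ->
      normc (F v - F u - L * (v - u)) <= C * normc (v - u) ^+ 2].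
Proof.
move=> rho0 C0 AF AB.
have Fu : clim (A^~ u) (F u) by apply: AF; rewrite subrr normc0.
have [L BL] : exists L, clim B L.
  apply: clim_cauchy => e e0.
  pose h := Num.min (rho / 2) (e / (4 * (C + 1))).
  have C1 : 0 < 4 * (C + 1) by lra.
  have h0 : 0 < h by rewrite lt_min !divr_gt0.
  have hr : h < rho by (have : h <= rho / 2 by rewrite ge_min lexx); lra.
  have hC : h * C < e / 4.
    have : h <= e / (4 * (C + 1)) by rewrite ge_min lexx orbT.
    by rewrite ler_pdivlMr// => H; lra.
  pose v := u + h%:C.
  have vu : v - u = h%:C by rewrite addrC addKr.
  have nvu : normc (v - u) = h by rewrite vu normcR gtr0_norm.
  have hC0 : h%:C != 0 :> R[i] by rewrite -vu -normc_gt0 nvu.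
  have vr : normc (v - u) < rho by rewrite nvu.
  have := climB (AF v vr) Fu; set s := fun n => _ => sl.
  have [N HN] := sl (h * e / 8) ltac:(by rewrite divr_gt0// mulr_gt0).
  exists N => n m /HN Hn /HN Hm.
  have K k : normc (B k * h%:C - s k) <= C * h ^+ 2.
    by rewrite -normcN opprB -vu; apply: le_trans (AB k v vr) _; rewrite nvu.
  have : normc (B n - B m) * h <= 2 * (C * h ^+ 2) + 2 * (h * e / 8).
    rewrite -nvu -normcM nvu vu.
    have -> : (B n - B m) * h%:C = (B n * h%:C - s n) - (B m * h%:C - s m)
       + ((s n - (F v - F u)) - (s m - (F v - F u))) by ring.
    have := le_normcD (B n * h%:C - s n - (B m * h%:C - s m))
      (s n - (F v - F u) - (s m - (F v - F u))).
    have := le_normcB (B n * h%:C - s n) (B m * h%:C - s m).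
    have := le_normcB (s n - (F v - F u)) (s m - (F v - F u)).
    have := K n; have := K m; lra.
  move=> H; rewrite -(ltr_pM2r h0); apply: le_lt_trans H _.
  have : C * h ^+ 2 < e / 4 * h by rewrite expr2 mulrA [C * h]mulrC ltr_pM2r.
  have : 0 < h * e by rewrite mulr_gt0.
  by lra.
have quad v : normc (v - u) < rho ->
    normc (F v - F u - L * (v - u)) <= C * normc (v - u) ^+ 2.
  move=> vr; apply: (@clim_le _ (fun N => A N v - A N u - B N * (v - u))).
    by exists 0%N => N _; exact: AB.
  apply: climB; first by apply: climB => //; exact: AF.
  by apply: climM => //; exact: clim_cst.
exists L; split=> //; apply/cderivP => e e0.
exists (Num.min rho (e / (C + 1))); first by rewrite lt_min rho0 divr_gt0//; lra.
move=> v; rewrite lt_min => /andP[vr ve]; apply: le_trans (quad _ vr) _.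
rewrite expr2 mulrA ler_wpM2r ?normc_ge0//.
move: ve; rewrite ltr_pdivlMr; last by lra.
by have := normc_ge0 (v - u); nra.
Qed.

(** The kernels that occur when Cauchy's formula is differentiated in [u]. *)
Definition ckernel c r u k (w : R[i]) : R[i] :=
  (r%:C * w) / (c + r%:C * w - u) ^+ k.

Lemma normc_circle_sub c r u x : 0 < r -> normc (u - c) <= r / 2 ->
  r / 2 <= normc (c + r%:C * cis x - u) <= 3 * r / 2.
Proof.
move=> r0 ur.
have -> : c + r%:C * cis x - u = r%:C * cis x - (u - c) by ring.
have := lB_normcB (r%:C * cis x) (u - c); have := le_normcB (r%:C * cis x) (u - c).
by rewrite normcM normc_cis normcR gtr0_norm//; lra.
Qed.

(** The remainders are explicit, and on the circle the denominators are at least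
[r / 2]; hence the constants [8] and [208]. *)
Lemma ckernel1_quad c r u v x : 0 < r -> normc (u - c) <= r / 2 ->
  normc (v - c) <= r / 2 ->
  normc (ckernel c r v 1 (cis x) - ckernel c r u 1 (cis x)
     - ckernel c r u 2 (cis x) * (v - u)) <= 8 / r ^+ 2 * normc (v - u) ^+ 2.
Proof.
move=> r0 ur vr; rewrite /ckernel !expr1.
have /andP[pu _] := normc_circle_sub x r0 ur.
have /andP[pv _] := normc_circle_sub x r0 vr.
set q := c + r%:C * cis x in pu pv *.
have qu : q - u != 0 by rewrite -normc_gt0; lra.
have qv : q - v != 0 by rewrite -normc_gt0; lra.
have -> : r%:C * cis x / (q - v) - r%:C * cis x / (q - u) -
    r%:C * cis x / (q - u) ^+ 2 * (v - u) =
    r%:C * cis x * ((q - v)^-1 * (q - u)^-1 ^+ 2) * (v - u) ^+ 2.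
  by field; rewrite qu qv.
have -> (p q0 h : R[i]) : normc (r%:C * cis x * (p * q0 ^+ 2) * h ^+ 2) =
    r * (normc p * normc q0 ^+ 2) * normc h ^+ 2.
  by rewrite -[r in RHS](gtr0_norm r0) -normcR -[in RHS](mulr1 (normc r%:C))
     -(normc_cis x) -!normcX -!normcM.
rewrite !normcV ler_wpM2r ?exprn_ge0 ?normc_ge0//.
have bnd z : r / 2 <= normc z -> 0 <= (normc z)^-1 <= 2 / r.
  move=> H; rewrite invr_ge0 normc_ge0 /= -[2 / r]invrK lef_pV2 ?posrE ?invf_div//.
    by apply: lt_le_trans H; rewrite divr_gt0.
  by rewrite divr_gt0.
have /andP[h1 h2] := bnd _ pu; have /andP[h3 h4] := bnd _ pv.
have -> : 8 / r ^+ 2 = r * (2 / r * (2 / r) ^+ 2) by field; rewrite gt_eqF.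
apply: ler_wpM2l; first exact: ltW.
have le2 a : 0 <= a <= 2 / r -> a ^+ 2 <= (2 / r) ^+ 2.
  by move=> /andP[a0 ar]; apply: lerXn2r; rewrite ?nnegrE ?(le_trans a0).
by apply: ler_pM; rewrite ?exprn_ge0// le2 ?h1.
Qed.

Lemma ckernel2_quad c r u v x : 0 < r -> normc (u - c) <= r / 2 ->
  normc (v - c) <= r / 2 ->
  normc (ckernel c r v 2 (cis x) - ckernel c r u 2 (cis x)
     - 2 * ckernel c r u 3 (cis x) * (v - u)) <= 208 / r ^+ 3 * normc (v - u) ^+ 2.
Proof.
move=> r0 ur vr; rewrite /ckernel.
have /andP[pu pu'] := normc_circle_sub x r0 ur.
have /andP[pv _] := normc_circle_sub x r0 vr.
set q := c + r%:C * cis x in pu pv pu' *.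
have qu : q - u != 0 by rewrite -normc_gt0; lra.
have qv : q - v != 0 by rewrite -normc_gt0; lra.
have -> : r%:C * cis x / (q - v) ^+ 2 - r%:C * cis x / (q - u) ^+ 2 -
    2 * (r%:C * cis x / (q - u) ^+ 3) * (v - u) =
    r%:C * cis x * ((q - v)^-1 ^+ 2 * (q - u)^-1 ^+ 3) *
      (3 * (q - u) - 2 * (v - u)) * (v - u) ^+ 2.
  by field; rewrite qu qv.
have -> (p q0 s h : R[i]) : normc (r%:C * cis x * (p ^+ 2 * q0 ^+ 3) * s * h ^+ 2) =
    r * (normc p ^+ 2 * normc q0 ^+ 3) * normc s * normc h ^+ 2.
  by rewrite -[r in RHS](gtr0_norm r0) -normcR -[in RHS](mulr1 (normc r%:C))
     -(normc_cis x) -!normcX -!normcM.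
rewrite !normcV ler_wpM2r ?exprn_ge0 ?normc_ge0//.
have bnd z : r / 2 <= normc z -> 0 <= (normc z)^-1 <= 2 / r.
  move=> H; rewrite invr_ge0 normc_ge0 /= -[2 / r]invrK lef_pV2 ?posrE ?invf_div//.
    by apply: lt_le_trans H; rewrite divr_gt0.
  by rewrite divr_gt0.
have /andP[h1 h2] := bnd _ pu; have /andP[h3 h4] := bnd _ pv.
have last_le : normc (3 * (q - u) - 2 * (v - u)) <= 13 / 2 * r.
  rewrite (le_trans (le_normcB _ _))// !normcM !normc_nat.
  have -> : v - u = (v - c) - (u - c) by ring.
  by have := le_normcB (v - c) (u - c); lra.
have -> : 208 / r ^+ 3 = r * ((2 / r) ^+ 2 * (2 / r) ^+ 3) * (13 / 2 * r).
  by field; rewrite gt_eqF.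
apply: ler_pM => //; [|exact: normc_ge0|].
  by apply: mulr_ge0; [exact: ltW|apply: mulr_ge0; exact: exprn_ge0].
apply: ler_wpM2l; first exact: ltW.
have leX a k : 0 <= a <= 2 / r -> a ^+ k <= (2 / r) ^+ k.
  by move=> /andP[a0 ar]; apply: lerXn2r; rewrite ?nnegrE ?(le_trans a0).
by apply: ler_pM; rewrite ?exprn_ge0// leX ?h1 ?h3.
Qed.

Section Disc.
Variables (f : R[i] -> R[i]) (c : R[i]) (r M : R).
Hypothesis r0 : 0 < r.
Hypothesis fh : forall z, normc (z - c) <= r -> chol f z.

Let r2 : r / 2 < r.
Proof. by rewrite ltr_pdivrMr// ltr_pMr// ltr1n. Qed.

Lemma cauchy_ckernel u : normc (u - c) < r ->
  clim (rmean (fun w => f (c + r%:C * w) * ckernel c r u 1 w)) (f u).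
Proof.
move=> ur; apply: eq_clim (cauchy_mean ur fh) => N; apply: eq_rmean => x.
by rewrite /ckernel expr1 -mulrA.
Qed.

Lemma mean_value : clim (rmean (fun w => f (c + r%:C * w))) (f c).
Proof.
have := @cauchy_ckernel c; rewrite subrr normc0 => /(_ r0).
apply: eq_clim => N; apply: eq_rmean => x; rewrite /ckernel expr1.
rewrite [c + _ - c]addrC addKr divff ?mulr1// mulf_neq0 ?cis_neq0//.
by rewrite -normc_eq0 normcR normr_eq0 gt_eqF.
Qed.

(** A function that is small at the centre of a disc and not small on the
circle has a zero: otherwise the mean value property of [1 / f] fails. *)
Lemma zero_in_disc (m : R) : normc (f c) < m ->
  (forall x, 0 <= x <= 1 -> m <= normc (f (c + r%:C * cis x))) ->
  exists2 z, normc (z - c) <= r & f z = 0.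
Proof.
move=> fc fm; apply: contrapT => nz.
have fN z : normc (z - c) <= r -> f z != 0.
  by move=> zr; apply/eqP => fz; apply: nz; exists z.
have fc0 : 0 < normc (f c) by rewrite normc_gt0 fN// subrr normc0 ltW.
have m0 : 0 < m by exact: lt_trans fc.
have g_h z : normc (z - c) <= r -> chol (fun z => (f z)^-1) z.
  by move=> zr; apply: cholV; [exact: fN|exact: fh].
have gmean : clim (rmean (fun w => (f (c + r%:C * w))^-1)) (f c)^-1.
  have H : normc (c - c) < r by rewrite subrr normc0.
  apply: eq_clim (cauchy_mean H g_h) => N; apply: eq_rmean => x.
  rewrite [c + _ - c]addrC addKr mulfK// mulf_neq0 ?cis_neq0//.
  by rewrite -normc_eq0 normcR normr_eq0 gt_eqF.
have : normc (f c)^-1 <= m^-1.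
  apply: clim_le gmean; exists 0%N => N _; apply: rmean_le01 => x x01.
  by rewrite normcV lef_pV2 ?fm// posrE// (lt_le_trans m0)// fm.
by rewrite normcV lef_pV2// leNgt fc.
Qed.

Lemma mean_value_Re_le (B : R) :
  (forall x, complex.Re (f (c + r%:C * cis x)) <= B) -> complex.Re (f c) <= B.
Proof.
move=> fB; rewrite leNgt; apply/negP => Bf.
have e0 : 0 < complex.Re (f c) - B by rewrite subr_gt0.
have [N HN] := mean_value e0.
have := HN N (leqnn N); apply/negP; rewrite -leNgt.
set m := rmean _ N; have mB : complex.Re m <= B by exact: Re_rmean_le.
apply: le_trans (Re_le_normc _); rewrite ReB.
have := ler_norm (complex.Re (f c) - complex.Re m); rewrite distrC; lra.
Qed.

Hypothesis fM : forall x, normc (f (c + r%:C * cis x)) <= M.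

Let M_ge0 : 0 <= M.
Proof. exact: le_trans (normc_ge0 _) (fM 0). Qed.

(** [clim_cderiv] applies twice, to the means that converge to [f] by Cauchy's
formula and then to those that converge to its derivative. *)
Lemma cauchy_deriv u : normc (u - c) < r / 2 ->
  [/\ clim (rmean (fun w => f (c + r%:C * w) * ckernel c r u 2 w)) (cderivative f u),
      chol (cderivative f) u &
      forall v, normc (v - c) < r / 2 ->
        normc (f v - f u - cderivative f u * (v - u))
          <= M * (8 / r ^+ 2) * normc (v - u) ^+ 2].
Proof.
have step1 u' : normc (u' - c) < r / 2 ->
    clim (rmean (fun w => f (c + r%:C * w) * ckernel c r u' 2 w)) (cderivative f u') /\
    forall v, normc (v - c) < r / 2 ->
        normc (f v - f u' - cderivative f u' * (v - u'))
          <= M * (8 / r ^+ 2) * normc (v - u') ^+ 2.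
  move=> ur.
  have K0 : 0 <= M * (8 / r ^+ 2).
    by apply: mulr_ge0; [exact: M_ge0|apply: divr_ge0; [exact: ler0n|exact/exprn_ge0/ltW]].
  have quad N v : normc (v - c) < r / 2 ->
     normc (rmean (fun w => f (c + r%:C * w) * ckernel c r v 1 w) N -
            rmean (fun w => f (c + r%:C * w) * ckernel c r u' 1 w) N -
            rmean (fun w => f (c + r%:C * w) * ckernel c r u' 2 w) N * (v - u'))
       <= M * (8 / r ^+ 2) * normc (v - u') ^+ 2.
    move=> vr; rewrite [X in _ - X]mulrC -rmeanZ -!rmeanB; apply: rmean_le => x.
    have -> (p a b e h : R[i]) : p * a - p * b - h * (p * e) = p * (a - b - e * h) by ring.
    rewrite normcM -[leRHS]mulrA ler_pM ?normc_ge0//.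
    by apply: ckernel1_quad => //; exact: ltW.
  have rho0 : 0 < r / 2 - normc (u' - c) by rewrite subr_gt0.
  have near v : normc (v - u') < r / 2 - normc (u' - c) -> normc (v - c) < r / 2.
    move=> vu; have -> : v - c = (v - u') + (u' - c) by ring.
    by rewrite (le_lt_trans (le_normcD _ _))//; lra.
  have [v vu|N v vu|L [BL fL _]] := @clim_cderiv
    (fun N v => rmean (fun w => f (c + r%:C * w) * ckernel c r v 1 w) N)
    (rmean (fun w => f (c + r%:C * w) * ckernel c r u' 2 w)) f u' _ _ rho0 K0.
  - by apply: cauchy_ckernel; apply: lt_trans (near _ vu) r2.
  - by apply: quad; exact: near.
  rewrite (cderivativeE fL); split=> // v vr.
  apply: (@clim_le _ (fun N => rmean (fun w => f (c + r%:C * w) * ckernel c r v 1 w) N -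
            rmean (fun w => f (c + r%:C * w) * ckernel c r u' 1 w) N -
            rmean (fun w => f (c + r%:C * w) * ckernel c r u' 2 w) N * (v - u'))).
    by exists 0%N => N _; exact: quad.
  have lt_r z : normc (z - c) < r / 2 -> normc (z - c) < r by move=> /lt_trans; apply; exact: r2.
  apply: climB; first by apply: climB; apply: cauchy_ckernel; exact: lt_r.
  by apply: climM => //; exact: clim_cst.
move=> ur; have [H1 H2] := step1 u ur; split=> //.
have rho0 : 0 < r / 2 - normc (u - c) by rewrite subr_gt0.
have K0 : 0 <= M * (208 / r ^+ 3).
  by apply: mulr_ge0; [exact: M_ge0|apply: divr_ge0; [exact: ler0n|exact/exprn_ge0/ltW]].
have near v : normc (v - u) < r / 2 - normc (u - c) -> normc (v - c) < r / 2.
  move=> vu; have -> : v - c = (v - u) + (u - c) by ring.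
  by rewrite (le_lt_trans (le_normcD _ _))//; lra.
have [v vu|N v vu|L [_ fL _]] := @clim_cderiv
    (fun N v => rmean (fun w => f (c + r%:C * w) * ckernel c r v 2 w) N)
    (rmean (fun w => f (c + r%:C * w) * (2 * ckernel c r u 3 w))) (cderivative f) u _ _ rho0 K0.
- exact: (step1 _ (near _ vu)).1.
- rewrite [X in _ - X]mulrC -rmeanZ -!rmeanB; apply: rmean_le => x.
  have -> (p a b e h : R[i]) : p * a - p * b - h * (p * e) = p * (a - b - e * h) by ring.
  rewrite normcM -[leRHS]mulrA ler_pM ?normc_ge0//.
  by apply: ckernel2_quad => //; apply: ltW => //; exact: near.
by exists L.
Qed.

Lemma cauchy_estimate : normc (cderivative f c) <= M / r.
Proof.
have cc : normc (c - c) < r / 2 by rewrite subrr normc0 divr_gt0.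
have [H _ _] := cauchy_deriv cc.
apply: clim_le H; exists 0%N => N _; apply: rmean_le => x.
rewrite normcM ler_pM ?normc_ge0// /ckernel [c + _ - c]addrC addKr normc_f normcX.
rewrite normcM normc_cis normcR mulr1 gtr0_norm// expr2 invfM mulrA divff ?gt_eqF//.
by rewrite mul1r.
Qed.

End Disc.

Lemma chol_cderivative f u r : 0 < r ->
  (forall z, normc (z - u) < r -> chol f z) -> chol (cderivative f) u.
Proof.
move=> r0 fh.
have fu : chol f u by apply: fh; rewrite subrr normc0.
have [d d0 Hd] := chol_ccont fu ltr01.
pose s := Num.min (r / 2) (d / 2).
have s0 : 0 < s by rewrite lt_min !divr_gt0.
have sr : s < r by (have : s <= r / 2 by rewrite ge_min lexx); lra.
have sd : s < d by (have : s <= d / 2 by rewrite ge_min lexx orbT); lra.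
have fs z : normc (z - u) <= s -> chol f z by move=> /le_lt_trans /(_ sr) /fh.
have fM x : normc (f (u + s%:C * cis x)) <= normc (f u) + 1.
  rewrite -lerBlDl (le_trans (lB_normcB _ _))// ltW// Hd//.
  by rewrite addrC addKr normcM normc_cis mulr1 normcR gtr0_norm.
have uu : normc (u - u) < s / 2 by rewrite subrr normc0 divr_gt0.
by have [_ H _] := cauchy_deriv s0 fs fM uu.
Qed.

End Consequences.

(** * Compactness and continuity in the complex plane *)

Section PlaneTopology.
Context {R : realType}.
Implicit Types (x y r : R) (z w : R[i]).

Definition rcont (u : R[i] -> R) z := forall e : R, 0 < e ->
  exists2 d : R, 0 < d & forall w, normc (w - z) < d -> `|u w - u z| < e.

Lemma rcont_normc (f : R[i] -> R[i]) z : ccont f z -> rcont (fun w => normc (f w)) z.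
Proof.
move=> fc e /fc[d d0 Hd]; exists d => // w /Hd; apply: le_lt_trans.
have := lB_normcB (f w) (f z); have := lB_normcB (f z) (f w).
by rewrite [normc (f z - f w)]normcB ler_norml; lra.
Qed.

Lemma rcontD u v z : rcont u z -> rcont v z -> rcont (fun w => u w + v w) z.
Proof.
move=> uc vc e e0; have e2 : 0 < e / 2 by rewrite divr_gt0.
have [d d0 Hd] := uc _ e2; have [d' d'0 Hd'] := vc _ e2.
exists (Num.min d d'); first by rewrite lt_min d0.
move=> w; rewrite lt_min => /andP[/Hd H1 /Hd' H2].
have -> : u w + v w - (u z + v z) = (u w - u z) + (v w - v z) by ring.
by rewrite (le_lt_trans (ler_normD _ _))//; lra.
Qed.

Lemma rcontZ a u z : rcont u z -> rcont (fun w => a * u w) z.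
Proof.
move=> uc e e0; have a0 : 0 < `|a| + 1 by rewrite ltr_wpDl.
have [d d0 Hd] := uc _ (divr_gt0 e0 a0); exists d => // w /Hd.
rewrite ltr_pdivlMr// -mulrBr normrM => H.
by apply: le_lt_trans H; rewrite mulrC ler_wpM2l// lerDl.
Qed.

Lemma circle_min (u : R[i] -> R) z r :
  (forall x, 0 <= x <= 1 -> rcont u (z + r%:C * cis x)) ->
  (forall x, 0 <= x <= 1 -> 0 < u (z + r%:C * cis x)) ->
  exists2 m : R, 0 < m & forall x, 0 <= x <= 1 -> m <= u (z + r%:C * cis x).
Proof.
move=> uc u0.
have cont : {within `[0%R, 1%R], continuous (fun x => u (z + r%:C * cis x))}.
  apply: continuous_in_subspaceT => x; rewrite inE /= in_itv /= => x01.
  apply/cvgrPdist_lt => e e0; have [d d0 Hd] := uc x x01 e e0.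
  have L1 : 0 < `|r| * (4 * pi) + 1.
    by rewrite ltr_wpDl// mulr_ge0// mulr_ge0// pi_ge0.
  near=> y; rewrite distrC; apply: Hd.
  have -> : z + r%:C * cis y - (z + r%:C * cis x) = r%:C * (cis y - cis x) by ring.
  rewrite normcM normcR.
  have : `|x - y| < d / (`|r| * (4 * pi) + 1).
    by near: y; apply: cvgr_dist_lt => //; rewrite divr_gt0.
  rewrite ltr_pdivlMr// mulrC => H; apply: le_lt_trans H.
  apply: le_trans (ler_wpM2l (normr_ge0 _) (cis_lip _ _)) _.
  by rewrite distrC mulrA ler_wpM2r// lerDl.
have [x x01 xmin] := EVT_min ler01 cont.
move: x01; rewrite in_itv /= => x01.
exists (u (z + r%:C * cis x)); first exact: u0.
by move=> y y01; apply: xmin; rewrite in_itv.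
Unshelve. all: by end_near. Qed.

Lemma EVT_annulus (u : R[i] -> R) (a b : R) : 0 <= a -> a <= b ->
  (forall w, a <= normc w <= b -> rcont u w) ->
  exists2 w0, a <= normc w0 <= b & forall w, a <= normc w <= b -> u w <= u w0.
Proof.
move=> a0 ab uc.
pose C (p : R * R) : R[i] := p.1 +i* p.2.
have CB p q : C p - C q = (p.1 - q.1) +i* (p.2 - q.2) by [].
have cont_of (v : R[i] -> R) p : rcont v (C p) -> {for p, continuous (v \o C)}.
  move=> vc; apply/cvgrPdist_lt => e e0; have [d d0 Hd] := vc e e0.
  have d2 : 0 < d / 2 by rewrite divr_gt0.
  exists (ball p.1 (d / 2), ball p.2 (d / 2)); first by split; exact: nbhsx_ballx.
  move=> q [/=]; rewrite /ball /= => H1 H2; rewrite distrC; apply: Hd.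
  rewrite (le_lt_trans (normc_le_ReIm _))// CB /= distrC [`|q.2 - _|]distrC; lra.
pose A := [set p : R * R | a <= normc (C p) <= b].
pose Q := `[- b, b]%classic `*` `[- b, b]%classic.
have Qc : compact Q by apply: compact_setX; exact: segment_compact.
have nc : continuous (fun p : R * R => normc (C p)).
  move=> p; apply: (cont_of (@normc R) p); apply: (@rcont_normc id); exact: ccont_id.
have Acl : closed A.
  have -> : A = (fun p : R * R => normc (C p)) @^-1` `[a, b]%classic.
    by apply/seteqP; split => p; rewrite /A /= in_itv.
  by apply: closed_comp; [move=> p _; exact: nc|exact: itv_closed].
have Ac : compact A.
  suff -> : A = Q `&` A by apply: compact_closedI.
  apply/seteqP; split => p; last by case.
  move=> pA; split=> //; move: pA => /andP[_ pb].
  have h1 : `|p.1| <= b := le_trans (Re_le_normc (C p)) pb.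
  have h2 : `|p.2| <= b := le_trans (Im_le_normc (C p)) pb.
  by split; rewrite /= in_itv /= -ler_norml.
have A0 : A !=set0.
  exists (b, 0); change (a <= normc b%:C <= b).
  by rewrite normcR ger0_norm ?(le_trans a0)// ab lexx.
have [|p pA pmax] := compact_EVT_max A0 Ac (_ : {within A, continuous (u \o C)}).
  by apply: continuous_in_subspaceT => p; rewrite inE => pA; apply: cont_of; exact: uc.
exists (C p); first by move: pA; rewrite inE.
by move=> [x y] Hw; have := pmax (x, y); rewrite inE; exact.
Qed.

Lemma derivable_chol (f : R[i] -> R[i]) z :
  derivable (f : R[i]^o -> R[i]^o) z 1 -> chol f z.
Proof.
move=> /cvg_ex[l /(@cvgrPdist_le _ _ _ _ _ _ _) Hl].
exists l; apply/cderivP => e e0.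
have e1 : 0 < e%:C by rewrite ltcR.
have /nbhs_ballP[d /= d0 Hd] := Hl _ e1.
have d1 : 0 < complex.Re d by move: d0; rewrite ltcE => /andP[].
exists (complex.Re d) => // w wz.
have [->|wNz] := eqVneq w z; first by rewrite !subrr mulr0 subr0 normc0 mulr0.
have h0 : w - z != 0 by rewrite subr_eq0.
have wd : (normc (w - z))%:C < d.
  rewrite ltcE /=; move: (d0); rewrite ltcE => /andP[/eqP -> _] /=.
  by rewrite eqxx.
have := Hd (w - z); rewrite /ball /= sub0r normrN => /(_ wd h0) H.
have {}H : normc (l - (w - z)^-1 * (f w - f z)) <= e.
  by move: H; rewrite [_ *: 1]mulr1 subrK -lecR.
have -> : f w - f z - l * (w - z) = - ((l - (w - z)^-1 * (f w - f z)) * (w - z)).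
  by field.
by rewrite normcN normcM ler_wpM2r ?normc_ge0.
Qed.

End PlaneTopology.

(** * Means of functions analytic outside the unit disc *)

Section OutsideDisc.
Context {R : realType}.
Implicit Types (x y r : R) (z w : R[i]).

(** The circle may be enlarged without changing the limit of the means, up to
where [g] is close to [L]. *)
Lemma annulus_mean (g : R[i] -> R[i]) (rho : R) (L : R[i]) : 1 < rho ->
  (forall w, 1 < normc w -> chol g w) ->
  (forall e : R, 0 < e -> exists M : R, forall w, M < normc w -> normc (g w - L) <= e) ->
  clim (rmean (fun w => g (rho%:C * w))) L.
Proof.
move=> rho1 gh gL; apply: clim_near => e e0; have [M HM] := gL _ e0.
pose r2 := Num.max 2 (M + 1).
have r22 : 2 <= r2 by rewrite le_max lexx.
have r2M : M + 1 <= r2 by rewrite le_max lexx orbT.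
have nz r x : 0 < r -> r%:C * cis x != 0.
  by move=> r0; rewrite -normc_gt0 normcM normc_cis mulr1 normcR normr_gt0 gt_eqF.
have H := @circle_homotopy R (fun w => g w / w) 0 0 rho r2.
have {}H : clim (fun N => rmean (fun w => g (rho%:C * w)) N
   - rmean (fun w => g (r2%:C * w)) N) 0.
  apply: eq_clim (H _) => [N|x y x01].
    by congr (_ - _); apply: eq_rmean => x; rewrite add0r mulfVK//; apply: nz; lra.
  rewrite !mulr0 !add0r; set s := (1 - x) * rho + _.
  have s1 : 1 < s.
    have : 0 <= (1 - x) * (rho - 1) by apply: mulr_ge0; lra.
    have : 0 <= x * (r2 - 2) by apply: mulr_ge0; lra.
    rewrite /s; have [->|x0] := eqVneq x 0; first by lra.
    have : 0 < x by rewrite lt_neqAle eq_sym x0; case/andP: x01.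
    by lra.
  have ns : normc (s%:C * cis y) = s.
    by rewrite normcM normc_cis mulr1 normcR gtr0_norm//; lra.
  apply: cholM; first by apply: gh; rewrite ns.
  by apply: cholV; [rewrite -normc_gt0 ns; lra|exact: chol_id].
exists (rmean (fun w => g (r2%:C * w))).
  by have [N HN] := H _ e0; exists N => n /HN; rewrite subr0 => /ltW.
exists 0%N => n _; rewrite -[X in _ - X](rmean_cst _ n); apply: rmean_dist => x.
by apply: HM; rewrite normcM normc_cis mulr1 normcR gtr0_norm; lra.
Qed.

(** The residue of a derivative vanishes: the increments of [G] between
consecutive sample points add up to zero. *)
Lemma mean_of_derivative (G : R[i] -> R[i]) (rho : R) : 1 < rho ->
  (forall w, 1 < normc w -> chol G w) ->
  clim (rmean (fun w => (rho%:C * w) * cderivative G (rho%:C * w))) 0.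
Proof.
move=> rho1 Gh.
pose r := (rho - 1) / 2; have r0 : 0 < r by rewrite divr_gt0// subr_gt0.
have [w0 _ Gmax] : exists2 w0, rho - r <= normc w0 <= rho + r &
    forall w, rho - r <= normc w <= rho + r -> normc (G w) <= normc (G w0).
  apply: EVT_annulus; rewrite /r; try lra.
  by move=> w win; apply/rcont_normc/chol_ccont/Gh; lra.
set M := normc (G w0) in Gmax; have M0 : 0 <= M by exact: normc_ge0.
pose K := M * (8 / r ^+ 2).
have K0 : 0 <= K by rewrite /K mulr_ge0// divr_ge0// exprn_ge0// ltW.
have nc x : normc (rho%:C * cis x) = rho.
  by rewrite normcM normc_cis mulr1 normcR gtr0_norm//; lra.
have quad z v : normc z = rho -> normc (v - z) < r / 2 ->
    normc (G v - G z - cderivative G z * (v - z)) <= K * normc (v - z) ^+ 2.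
  move=> zr vz.
  have ann u : normc (u - z) <= r -> rho - r <= normc u <= rho + r.
    have := lB_normcB z (z - u); have := le_normcD (u - z) z.
    by rewrite subrK (_ : z - (z - u) = u) 1?[normc (z - u)]normcB; [lra|ring].
  have fh u : normc (u - z) <= r -> chol G u.
    by move=> /ann H; apply: Gh; rewrite /r in H; lra.
  have fM x : normc (G (z + r%:C * cis x)) <= M.
    apply/Gmax/ann; rewrite addrC addKr normcM normc_cis mulr1 normcR gtr0_norm//.
  have zz : normc (z - z) < r / 2 by rewrite subrr normc0 divr_gt0.
  by have [_ _] := cauchy_deriv r0 fh fM zz; apply.
pose dl N := normc (root2 N - 1 : R[i]).
have dl_le N : dl N <= 4 * pi / (2 ^ N)%:R.
  rewrite /dl /root2 -cis0 (le_trans (cis_lip _ _))// subr0 ger0_norm//.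
have dl_gt0 N : 0 < dl N.+1.
  by apply: lt_le_trans (root2_dist N); rewrite divr_gt0// ltr0n expn_gt0.
have bound N : rho * dl N.+1 < r / 2 ->
    normc (rmean (fun w => (rho%:C * w) * cderivative G (rho%:C * w)) N.+1)
      <= K * rho ^+ 2 * dl N.+1.
  move=> small; rewrite -(ler_pM2r (dl_gt0 N)) -normcM mulrC -rmeanZ.
  have zero : rmean (fun w => G (rho%:C * (w * root2 N.+1)) - G (rho%:C * w)) N.+1 = 0.
    by rewrite rmeanB (rmean_rot (fun w => G (rho%:C * w))) subrr.
  rewrite -[rmean _ _]opprK normcN -[- _]add0r -{1}zero -rmeanB.
  apply: rmean_le => x.
  set z := rho%:C * cis x.
  have vz : rho%:C * (cis x * root2 N.+1) - z = z * (root2 N.+1 - 1) by rewrite /z; ring.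
  have nvz : normc (z * (root2 N.+1 - 1)) = rho * dl N.+1 by rewrite normcM nc.
  have := quad z (rho%:C * (cis x * root2 N.+1)) (nc x).
  rewrite vz nvz => /(_ small); rewrite exprMn.
  have -> : (root2 N.+1 - 1) * (z * cderivative G z) =
    cderivative G z * (z * (root2 N.+1 - 1)) by ring.
  by move/le_trans; apply; rewrite expr2 [dl N.+1 ^+ 2]expr2; lra.
move=> e e0.
pose A := (4 * pi) * (K * rho ^+ 2 + rho + 1).
have Kr0 : 0 <= K * rho ^+ 2 by rewrite mulr_ge0// sqr_ge0.
have K1 : 0 < K * rho ^+ 2 + rho + 1 by lra.
have A0 : 0 < A by apply: mulr_gt0 => //; apply: mulr_gt0 => //; exact: pi_gt0.
have e1 : 0 < Num.min e (r / 2) / A by rewrite divr_gt0// lt_min e0 divr_gt0.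
have [N0 HN0] := half_expn_lt e1.
exists N0.+1 => -[//|N] N0N.
have N2 : 2 ^- N.+1 <= 2 ^- N0 :> R.
  by rewrite lef_pV2 ?posrE ?exprn_gt0// ler_weXn2l ?ler1n// ltnW.
have dA : dl N.+1 * (K * rho ^+ 2 + rho + 1) < Num.min e (r / 2).
  apply: (@le_lt_trans _ _ (A * 2 ^- N.+1)).
    have -> : A * 2 ^- N.+1 = 4 * pi / (2 ^ N.+1)%:R * (K * rho ^+ 2 + rho + 1).
      by rewrite natrX /A; field; rewrite expf_neq0.
    by rewrite ler_pM2r.
  rewrite mulrC -ltr_pdivlMr//; exact: le_lt_trans N2 HN0.
move: dA; rewrite lt_min => /andP[dAe dAr].
have Kd : 0 <= dl N.+1 * (K * rho ^+ 2).
  by rewrite mulr_ge0 ?normc_ge0.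
have rd : 0 <= dl N.+1 * rho by apply: mulr_ge0; [exact: normc_ge0|lra].
have dd := dl_gt0 N.
rewrite subr0; apply: le_lt_trans (bound N _) _; lra.
Qed.

Lemma poly_antiderivative (s : {poly R[i]}) : exists S : {poly R[i]}, S^`() = s.
Proof.
exists (\sum_(i < size s) (s`_i / i.+1%:R) *: 'X^(i.+1)).
rewrite raddf_sum /= -[RHS]coefK poly_def; apply: eq_bigr => i _.
by rewrite derivZ derivXn /= -scalerMnr scalerMnl -mulr_natr mulfVK// pnatr_eq0.
Qed.

End OutsideDisc.

(** * The exterior map of a compact convex set *)

Section Exterior.
Context {R : realType}.
Implicit Types (x y r : R) (z w : R[i]).

Variables (W : set R[i]) (phi : R[i] -> R[i]).
Hypothesis W_convex : forall a b (s : R), W a -> W b -> 0 <= s <= 1 ->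
  W (a + s%:C * (b - a)).
Hypothesis W_closed : forall z, ~ W z ->
  exists2 r : R, 0 < r & forall w, normc (w - z) < r -> ~ W w.
Hypothesis W_bounded : exists B : R, forall z, W z -> normc z <= B.
Hypothesis phi_ext : exterior_map W phi.

Lemma phi_chol z : ~ W z -> chol phi z.
Proof. by move=> zW; apply: derivable_chol; case: phi_ext => H _ _; exact: H. Qed.

Lemma phi_gt1 z : ~ W z -> 1 < normc (phi z).
Proof. by move=> zW; case: phi_ext => _ [H _ _] _; exact: H. Qed.

Lemma phi_neq0 z : ~ W z -> phi z != 0.
Proof. by move=> /phi_gt1 H; rewrite -normc_gt0 (lt_trans _ H). Qed.

Lemma phi_inj z z' : ~ W z -> ~ W z' -> phi z = phi z' -> z = z'.
Proof. by move=> zW zW'; case: phi_ext => _ [_ H _] _; apply: H; rewrite inE. Qed.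

Definition psi w : R[i] := xget 0 [set z | ~ W z /\ phi z = w].

Lemma psiP w : 1 < normc w -> ~ W (psi w) /\ phi (psi w) = w.
Proof.
move=> w1; rewrite /psi; case: xgetP => [z _ //|H].
by case: phi_ext => _ [_ _ /(_ w w1)[z zW zw]] _; case: (H z).
Qed.

Lemma psi_notin w : 1 < normc w -> ~ W (psi w).
Proof. by move=> /psiP[]. Qed.

Lemma psiK w : 1 < normc w -> phi (psi w) = w.
Proof. by move=> /psiP[]. Qed.

Lemma phiK z : ~ W z -> psi (phi z) = z.
Proof. by move=> zW; have [h1 h2] := psiP (phi_gt1 zW); exact: phi_inj. Qed.

Lemma cinfty_filter : Filter (@cinfty R).
Proof.
apply: filter_from_filter; first by exists 0.
move=> i j _ _; exists (Num.max i j) => // z /=.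
by rewrite gt_max => /andP[].
Qed.

(** [phi] has a simple pole at infinity, [c] being the limit of [phi z / z]. *)
Definition simple_pole (c : R) := forall e : R, 0 < e ->
  exists2 M : R, 0 < M & forall z, M < normc z ->
    ~ W z /\ normc (phi z - c%:C * z) <= e * normc z.

Lemma phi_infty : exists2 c : R, 0 < c & simple_pole c.
Proof.
case: phi_ext => _ _ [c c0 /(@cvgrPdist_lt _ R[i]^o R[i] (@cinfty R) _ _ _) H].
exists c => // e e0; have e1 : 0 < e%:C by rewrite ltcR.
have [M _ HM] := H cinfty_filter _ e1; have [B HB] := W_bounded.
exists (Num.max (Num.max M B) 1); first by rewrite lt_max ltr01 orbT.
move=> z; rewrite !gt_max => /andP[/andP[Mz Bz] z1]; split.
  by move=> /HB; rewrite leNgt Bz.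
have z0 : z != 0 by rewrite -normc_gt0 (lt_trans _ z1).
have {}HM : normc (c%:C - phi z / z) < e by have := HM z Mz; rewrite -ltcR.
have -> : phi z - c%:C * z = - ((c%:C - phi z / z) * z) by field.
by rewrite normcN normcM ler_wpM2r ?normc_ge0// ltW.
Qed.

(** Near infinity [phi] is a small perturbation of [c z], so by [zero_in_disc] the
solution of [phi z = w] lies close to [w / c]. *)
Lemma psi_infty (c : R) : 0 < c -> simple_pole c -> forall e : R, 0 < e ->
  exists2 M : R, 1 < M & forall w, M < normc w ->
    normc (c%:C * psi w - w) <= e * normc w.
Proof.
move=> c0 Hc e e0.
pose d := Num.min e (2^-1); have d0 : 0 < d by rewrite lt_min e0 /= invr_gt0 ltr0n.
have d2 : d <= 2^-1 by rewrite ge_min lexx orbT.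
have de : d <= e by rewrite ge_min lexx.
pose eta := c * d / 8; have eta0 : 0 < eta by rewrite !divr_gt0// mulr_gt0.
have [M M0 HM] := Hc _ eta0.
exists (1 + 2 * c * M); first by rewrite ltrDl !mulr_gt0.
move=> w wM; have cM : 0 < 2 * c * M by rewrite !mulr_gt0.
have w1 : 1 < normc w by lra.
have w0 : 0 < normc w by lra.
pose r := d * normc w / c; have r0 : 0 < r by rewrite divr_gt0// mulr_gt0.
have dw0 : 0 < d * normc w by rewrite mulr_gt0.
have cC0 : c%:C != 0 :> R[i] by rewrite -normc_gt0 normcR gtr0_norm.
pose z0 := w / c%:C.
have near z : normc (z - z0) <= r -> M < normc z /\ normc z <= 2 * normc w / c.
  move=> zr; have nz0 : normc z0 = normc w / c by rewrite normc_f normcR gtr0_norm.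
  have rz : r <= normc w / c / 2.
    have -> : r = normc w / c * d by rewrite /r; field; rewrite gt_eqF.
    by apply: ler_wpM2l => //; rewrite divr_ge0 ?ltW.
  have wc : 2 * M < normc w / c by rewrite ltr_pdivlMr//; lra.
  have := lB_normcB z0 (z0 - z); rewrite (_ : z0 - (z0 - z) = z); last by ring.
  have := le_normcD (z - z0) z0; rewrite subrK.
  rewrite [normc (z0 - z)]normcB nz0.
  have -> : 2 * normc w / c = 2 * (normc w / c) by ring.
  by split; lra.
have chol_near z : normc (z - z0) <= r -> chol (fun z => phi z - w) z.
  move=> /near[/HM[zW _] _].
  by apply: cholB; [exact: phi_chol|exact: chol_cst].
have dev z : normc (z - z0) <= r -> normc (phi z - c%:C * z) <= d * normc w / 4.
  move=> /near[/HM[_ H1] H2]; apply: le_trans H1 _.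
  have -> : d * normc w / 4 = eta * (2 * normc w / c).
    by rewrite /eta; field; rewrite gt_eqF.
  by rewrite ler_wpM2l// ltW.
have [z zr zw] : exists2 z, normc (z - z0) <= r & phi z - w = 0.
  apply: (zero_in_disc r0 chol_near (m := d * normc w / 2)).
    have {1}-> : w = c%:C * z0 by rewrite /z0 mulrC mulfVK.
    apply: le_lt_trans (dev z0 _) _; first by rewrite subrr normc0 ltW.
    lra.
  move=> x _; set z := z0 + _.
  have zr : z - z0 = r%:C * cis x by rewrite /z addrC addKr.
  have nzr : normc (z - z0) = r by rewrite zr normcM normc_cis mulr1 normcR gtr0_norm.
  have := dev z; rewrite nzr => /(_ (lexx _)) H.
  have -> : phi z - w = c%:C * (z - z0) + (phi z - c%:C * z).
    by rewrite /z0; field.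
  have := lB_normcD (c%:C * (z - z0)) (phi z - c%:C * z).
  rewrite normcM nzr normcR gtr0_norm//.
  have -> : c * r = d * normc w by rewrite /r; field; rewrite gt_eqF.
  lra.
have zW : ~ W z by have [/HM[]] := near z zr.
have -> : psi w = z by move/eqP: zw; rewrite subr_eq0 => /eqP <-; rewrite phiK.
have -> : c%:C * z - w = c%:C * (z - z0) by rewrite /z0; field.
rewrite normcM normcR gtr0_norm//.
apply: (le_trans (ler_wpM2l (ltW c0) zr)).
have -> : c * r = d * normc w by rewrite /r; field; rewrite gt_eqF.
by rewrite ler_wpM2r// ltW.
Qed.

(** Continuity of the inverse is the open mapping property of [phi], which for
an injective map follows from [zero_in_disc]. *)
Lemma psi_ccont w : 1 < normc w -> ccont psi w.
Proof.
move=> w1 e e0; have [zW zw] := psiP w1; set z0 := psi w in zW zw *.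
have [d d0 Hd] := W_closed zW.
pose r := Num.min (d / 2) (e / 2); have r0 : 0 < r by rewrite lt_min !divr_gt0.
have rd : r < d.
  have : r <= d / 2 by rewrite ge_min lexx.
  lra.
have re : r < e.
  have : r <= e / 2 by rewrite ge_min lexx orbT.
  lra.
have rW z : normc (z - z0) <= r -> ~ W z by move=> /le_lt_trans /(_ rd) /Hd.
have onc x : normc (z0 + r%:C * cis x - z0) = r.
  by rewrite addrC addKr normcM normc_cis mulr1 normcR gtr0_norm.
have [x x01|x x01|m m0 Hm] := @circle_min R (fun z => normc (phi z - w)) z0 r.
- apply: rcont_normc; apply: chol_ccont; apply: cholB; last exact: chol_cst.
  by apply: phi_chol; apply: rW; rewrite onc.
- rewrite normc_gt0 subr_eq0; apply/eqP => E.
  have : z0 + r%:C * cis x = z0.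
    by apply: phi_inj => //; [apply: rW; rewrite onc|rewrite E zw].
  by move=> E'; have := onc x; rewrite E' subrr normc0; move: r0; lra.
exists (Num.min (m / 2) (normc w - 1)); first by rewrite lt_min divr_gt0//= subr_gt0.
move=> w'; rewrite lt_min => /andP[ww' ww1].
have w'1 : 1 < normc w'.
  by have := lB_normcB w (w - w'); rewrite (_ : w - (w - w') = w') 1?normcB; [lra|ring].
have [z zr| |x x01|z zr zw'] := @zero_in_disc R (fun z => phi z - w') z0 r r0 _ (m / 2).
- apply: cholB; last exact: chol_cst.
  by apply: phi_chol; exact: rW.
- by rewrite zw normcB.
- have := Hm x x01.
  have := lB_normcB (phi (z0 + r%:C * cis x) - w) (w' - w).
  have -> (a : R[i]) : a - w - (w' - w) = a - w' by ring.
  lra.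
have -> : psi w' = z.
  by move/eqP: zw'; rewrite subr_eq0 => /eqP <-; rewrite phiK//; exact: rW.
exact: le_lt_trans zr re.
Qed.

(** In the coordinate [phi z] the region is a compact annulus, so a maximum
exists.  Adding a small multiple of [|z|^2] to the modulus makes it strictly
subharmonic, so that the maximum is not in the interior. *)
Lemma max_principle (F : R[i] -> R[i]) (rho R1 B : R) : 1 < rho -> rho <= R1 ->
  (forall z, ~ W z -> chol F z) ->
  (forall z, ~ W z -> normc (phi z) = rho -> normc (F z) <= B) ->
  (forall z, ~ W z -> normc (phi z) = R1 -> normc (F z) <= B) ->
  forall z, ~ W z -> rho <= normc (phi z) <= R1 -> normc (F z) <= B.
Proof.
move=> rho1 rhoR Fh Fin Fout.
have rho0 : 0 <= rho by lra.
have on1 w : rho <= normc w <= R1 -> 1 < normc w by move=> /andP[] ? ?; lra.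
have sqcont w : rho <= normc w <= R1 -> rcont (fun w => normc (psi w ^+ 2)) w.
  move=> /on1 w1; apply: rcont_normc; rewrite /GRing.exp /=.
  by apply: ccontM; exact: psi_ccont.
have [w0 w0in w0max] := EVT_annulus rho0 rhoR sqcont.
set S := normc _ in w0max; have S0 : 0 <= S by exact: normc_ge0.
suff main (e : R) : 0 < e -> forall z, ~ W z -> rho <= normc (phi z) <= R1 ->
    normc (F z) <= B + e * S.
  move=> z zW zin; rewrite leNgt; apply/negP => BF.
  have S1 : 0 < S + 1 by lra.
  have e0 : 0 < (normc (F z) - B) / (S + 1) by rewrite divr_gt0// subr_gt0.
  have := main _ e0 z zW zin; apply/negP; rewrite -ltNge -ltrBrDl.
  by rewrite mulrAC ltr_pdivrMr// ltr_pM2l ?subr_gt0// ltrDl.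
move=> e0.
pose u w := normc (F (psi w)) + e * normc (psi w ^+ 2).
have ucont w : rho <= normc w <= R1 -> rcont u w.
  move=> win; apply: rcontD; last by apply: rcontZ; exact: sqcont.
  apply: rcont_normc; apply: (@ccont_comp _ F psi); first exact: psi_ccont (on1 _ win).
  by apply/chol_ccont/Fh/psi_notin/on1.
have [w1 w1in w1max] := EVT_annulus rho0 rhoR ucont.
have [zW zw] := psiP (on1 _ w1in); set z1 := psi w1 in zW zw.
suff FB : normc (F z1) <= B.
  move=> z zW' zin; have := w1max _ zin; rewrite /u phiK// -/z1.
  have := w0max _ w1in; rewrite -/z1 => H1 H2.
  have H3 : e * normc (z1 ^+ 2) <= e * S by rewrite ler_wpM2l// ltW.
  have H4 : 0 <= e * normc (z ^+ 2) by rewrite mulr_ge0 ?normc_ge0// ltW.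
  lra.
have [E|N1] := eqVneq (normc w1) rho; first by apply: Fin; rewrite ?zw.
have [E|N2] := eqVneq (normc w1) R1; first by apply: Fout; rewrite ?zw.
exfalso.
have in1 : rho < normc w1 by rewrite lt_neqAle eq_sym N1; case/andP: w1in.
have in2 : normc w1 < R1 by rewrite lt_neqAle N2; case/andP: w1in.
pose gap := Num.min (normc w1 - rho) (R1 - normc w1).
have gap0 : 0 < gap by rewrite lt_min !subr_gt0 in1 in2.
have [d d0 Hd] := chol_ccont (phi_chol zW) gap0.
have [d' d'0 Hd'] := W_closed zW.
pose r := Num.min d d' / 2; have r0 : 0 < r by rewrite divr_gt0// lt_min d0.
have rlt : r < Num.min d d'.
  by rewrite /r ltr_pdivrMr// ltr_pMr ?ltr1n// lt_min d0.
move: rlt; rewrite lt_min => /andP[rd rd'].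
have rW z : normc (z - z1) <= r -> ~ W z by move=> /le_lt_trans /(_ rd') /Hd'.
have rin z : normc (z - z1) <= r -> rho <= normc (phi z) <= R1.
  move=> /le_lt_trans /(_ rd) /Hd; rewrite zw lt_min => /andP[g1 g2].
  have := lB_normcB w1 (w1 - phi z); have -> : w1 - (w1 - phi z) = phi z by ring.
  have := le_normcD (phi z - w1) w1; rewrite subrK [normc (w1 - _)]normcB.
  lra.
(* the direction in which [F z1] is real and nonnegative *)
have [th nth thF] := phase (F z1).
pose hh z := th * F z + (2 * e)%:C * conjc z1 * (z - z1).
have hh_h z : normc (z - z1) <= r -> chol hh z.
  move=> /rW zW'; apply: cholD; first by apply: cholM; [exact: chol_cst|exact: Fh].
  apply: cholM; first exact: chol_cst.
  by apply: cholB; [exact: chol_id|exact: chol_cst].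
have hb x : complex.Re (hh (z1 + r%:C * cis x)) <= normc (F z1) - e * r ^+ 2.
  set z := z1 + r%:C * cis x.
  have zr : normc (z - z1) = r.
    by rewrite addrC addKr normcM normc_cis mulr1 normcR gtr0_norm.
  have zin : normc (z - z1) <= r by rewrite zr.
  have := w1max _ (rin z zin); rewrite /u phiK; last exact: rW.
  rewrite -/z1 => um.
  have H1 : complex.Re (th * F z) <= normc (F z).
    by rewrite (le_trans (ler_norm _))// (le_trans (Re_le_normc _))// normcM nth mul1r.
  have sq (a b : R[i]) : normc (a ^+ 2) = normc (b ^+ 2) +
      2 * complex.Re (conjc b * (a - b)) + normc (a - b) ^+ 2.
    by rewrite !normcX -normc_sqrD addrC subrK.
  rewrite /hh ReD -mulrA Re_mulR.
  move: um; rewrite (sq z z1) zr; lra.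
have := mean_value_Re_le r0 hh_h hb.
rewrite {1}/hh subrr mulr0 addr0 thF /=.
have : 0 < e * r ^+ 2 by rewrite mulr_gt0// exprn_gt0.
lra.
Qed.

Lemma phi_large (M : R) :
  exists2 R0 : R, 1 < R0 & forall z, ~ W z -> R0 < normc (phi z) -> M < normc z.
Proof.
have [c c0 Hc] := phi_infty; have [M1 M11 HM1] := psi_infty c0 Hc ltr01.
have h2 : 0 < 2^-1 :> R by rewrite invr_gt0.
have [M2 M21 HM2] := psi_infty c0 Hc h2.
exists (Num.max M2 (2 * c * M)); first by rewrite lt_max M21.
move=> z zW; rewrite gt_max => /andP[/HM2]; rewrite phiK// => H1 H2.
have := lB_normcB (phi z) (phi z - c%:C * z).
have -> : phi z - (phi z - c%:C * z) = c%:C * z by ring.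
rewrite normcM normcR gtr0_norm// [normc (phi z - _)]normcB => H3.
by rewrite -(ltr_pM2l c0); lra.
Qed.

Lemma dilation_notin z zeta (s : R) : W z -> 1 <= s -> ~ W zeta ->
  ~ W (z + s%:C * (zeta - z)).
Proof.
move=> zW s1 zetaW H; apply: zetaW.
have s0 : s != 0 by rewrite gt_eqF// (lt_le_trans ltr01).
have -> : zeta = z + (s^-1)%:C * ((z + s%:C * (zeta - z)) - z).
  by rewrite addrAC subrr add0r mulrA -rmorphM mulVf// mul1r addrC subrK.
apply: W_convex => //; rewrite invr_ge0 invf_le1 ?s1 ?(lt_le_trans ltr01)//.
by rewrite (le_trans ler01).
Qed.

(** Schwarz's lemma for the dilation with centre [z], which by convexity maps the
complement of [W] into itself. *)
Lemma phi_dilation_ge z zeta (s : R) : W z -> 1 < s -> ~ W zeta ->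
  normc (phi zeta) <= normc (phi (z + s%:C * (zeta - z))).
Proof.
move=> zW s1 zetaW; have s1' := ltW s1.
pose xi v := z + s%:C * (v - z).
have xiW v : ~ W v -> ~ W (xi v) by exact: dilation_notin.
pose F v := phi v / phi (xi v).
have Fh v : ~ W v -> chol F v.
  move=> vW; apply: cholM; first exact: phi_chol.
  apply: cholV; first exact/phi_neq0/xiW.
  apply: (@chol_comp _ phi xi); last exact/phi_chol/xiW.
  apply: cholD; first exact: chol_cst.
  by apply: cholM; [exact: chol_cst|apply: cholB; [exact: chol_id|exact: chol_cst]].
have [c c0 Hc] := phi_infty.
pose eta := c * (s - 1) / (4 * s).
have s0 : 0 < s by lra.
have eta0 : 0 < eta by rewrite !divr_gt0// ?mulr_gt0// subr_gt0.
have [M M0 HM] := Hc _ eta0.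
have far v : Num.max M (2 * normc z) < normc v -> normc (phi v) <= normc (phi (xi v)).
  rewrite gt_max => /andP[Mv zv]; have z0 := normc_ge0 z.
  have xv : s * normc v - (s - 1) * normc z <= normc (xi v).
    have -> : xi v = s%:C * v - (s - 1)%:C * z.
      by rewrite /xi rmorphB rmorph1; ring.
    have := lB_normcB (s%:C * v) ((s - 1)%:C * z).
    by rewrite !normcM !normcR !gtr0_norm// subr_gt0.
  have zs : (s - 1) * normc z <= (s - 1) * (normc v / 2).
    by apply: ler_wpM2l; lra.
  have v0 : 0 <= (s - 1) * normc v by rewrite mulr_ge0 ?normc_ge0//; lra.
  have Mx : M < normc (xi v) by lra.
  have [_ H1] := HM _ Mv; have [_ H2] := HM _ Mx.
  have := le_normcD (phi v - c%:C * v) (c%:C * v).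
  have := lB_normcD (c%:C * xi v) (phi (xi v) - c%:C * xi v).
  rewrite (addrC (c%:C * xi v)) !subrK !normcM !normcR !gtr0_norm// => H3 H4.
  have etas : eta * s = c * (s - 1) / 4 by rewrite /eta; field; rewrite gt_eqF.
  have etac : eta <= c / 4.
    by rewrite -(ler_pM2r s0) etas; nra.
  have H5 : (c - eta) * (s * normc v - (s - 1) * (normc v / 2)) <= (c - eta) * normc (xi v).
    by apply: ler_wpM2l; lra.
  have cv : 0 <= c * ((s - 1) * normc v) by rewrite mulr_ge0// ltW.
  have ev : eta * normc v * s = c * ((s - 1) * normc v) / 4.
    by rewrite mulrAC etas; ring.
  have ev2 : eta * normc v <= eta * normc v * s.
    by rewrite ler_peMr// mulr_ge0 ?normc_ge0// ltW.
  lra.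
have [R0 R01 HR0] := phi_large (Num.max M (2 * normc z)).
suff main (rho : R) : 1 < rho -> rho <= normc (phi zeta) -> normc (F zeta) <= rho.
  have xi0 : 0 < normc (phi (xi zeta)) by rewrite normc_gt0; exact/phi_neq0/xiW.
  rewrite -[leRHS]mul1r -ler_pdivrMr// -normc_f -/(F zeta) leNgt; apply/negP => F1.
  have p1 := phi_gt1 zetaW.
  pose m := Num.min (normc (F zeta)) (normc (phi zeta)).
  have m1 : 1 < m by rewrite lt_min F1.
  have mF : m <= normc (F zeta) by rewrite ge_min lexx.
  have mp : m <= normc (phi zeta) by rewrite ge_min lexx orbT.
  have := main ((1 + m) / 2); lra.
move=> rho1 rhoz.
pose R1 := Num.max (normc (phi zeta)) (R0 + 1).
have R1z : normc (phi zeta) <= R1 by rewrite le_max lexx.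
apply: (max_principle rho1 (le_trans rhoz R1z) Fh) => //; last by rewrite rhoz.
- move=> v vW vr; rewrite normc_f vr ler_pdivrMr; last first.
    by rewrite normc_gt0; exact/phi_neq0/xiW.
  by rewrite ler_peMr ?ltW//; [exact: lt_trans rho1|exact/phi_gt1/xiW].
- move=> v vW vr; have x0 : 0 < normc (phi (xi v)).
    by rewrite normc_gt0; exact/phi_neq0/xiW.
  apply: le_trans (ltW rho1); rewrite normc_f ler_pdivrMr// mul1r; apply: far.
  apply: HR0 => //; rewrite vr.
  have : R0 + 1 <= R1 by rewrite le_max lexx orbT.
  lra.
Qed.

(** The derivative of [phi_dilation_ge] at [s = 1]: the exterior domain is
starlike with respect to every point of [W].  This is where the convexity of the
numerical range enters the bound for Faber polynomials. *)
Lemma phi_starlike z zeta : W z -> ~ W zeta ->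
  0 <= complex.Re (conjc (phi zeta) * (cderivative phi zeta * (zeta - z))).
Proof.
move=> zW zetaW; set d := cderivative phi zeta * _.
rewrite leNgt; apply/negP => neg.
set a := - complex.Re (conjc (phi zeta) * d); have a0 : 0 < a by rewrite oppr_gt0.
set p := normc (phi zeta); have p0 : 0 < p by rewrite normc_gt0; exact: phi_neq0.
set n := normc (zeta - z); have n0 : 0 <= n by exact: normc_ge0.
have [q qd] := phi_chol zetaW; move: qd (cderivativeE qd) => /cderivP qd qE.
pose e := a / (2 * p * (n + 1)).
have e0 : 0 < e by rewrite divr_gt0// !mulr_gt0//; lra.
have [del del0 Hdel] := qd _ e0.
pose D2 := normc d ^+ 2; have D20 : 0 <= D2 by rewrite exprn_ge0// normc_ge0.
pose sg := Num.min (del / (n + 1)) (a / (D2 + 1)) / 2.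
have n1 : 0 < n + 1 by lra.
have D21 : 0 < D2 + 1 by lra.
have mn0 : 0 < Num.min (del / (n + 1)) (a / (D2 + 1)) by rewrite lt_min !divr_gt0.
have sg0 : 0 < sg by rewrite divr_gt0.
have sgm : sg < Num.min (del / (n + 1)) (a / (D2 + 1)).
  by rewrite /sg ltr_pdivrMr// ltr_pMr ?ltr1n.
move: sgm; rewrite lt_min !ltr_pdivlMr// => /andP[sg1 sg2].
set v := z + (1 + sg)%:C * (zeta - z).
have vz : v - zeta = sg%:C * (zeta - z) by rewrite /v rmorphD rmorph1; ring.
have nvz : normc (v - zeta) = sg * n by rewrite vz normcM normcR gtr0_norm.
have vdel : normc (v - zeta) < del by rewrite nvz; lra.
have s1 : 1 < 1 + sg by lra.
have := phi_dilation_ge zW s1 zetaW; rewrite -/v -/p => pv.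
have := Hdel _ vdel; rewrite vz -qE => Hd.
have E : cderivative phi zeta * (sg%:C * (zeta - z)) = sg%:C * d by rewrite /d; ring.
rewrite E -vz nvz in Hd.
set X := normc (phi zeta + sg%:C * d).
have HX : p - e * (sg * n) <= X.
  have := le_normcD (phi v - phi zeta - sg%:C * d) (phi zeta + sg%:C * d).
  have -> : phi v - phi zeta - sg%:C * d + (phi zeta + sg%:C * d) = phi v by ring.
  rewrite -/X; lra.
have X2 : X ^+ 2 = p ^+ 2 - 2 * sg * a + sg ^+ 2 * D2.
  rewrite /X normc_sqrD normcM exprMn normcR real_normK ?num_real//.
  by rewrite mulrCA Re_mulR /a /p /D2; ring.
have H1 : 2 * p * X <= X ^+ 2 + p ^+ 2.
  rewrite -subr_ge0; have -> : X ^+ 2 + p ^+ 2 - 2 * p * X = (X - p) ^+ 2 by ring.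
  exact: sqr_ge0.
have H2 : 2 * p * (p - e * (sg * n)) <= 2 * p * X by apply: ler_wpM2l => //; lra.
have H3 : sg * (2 * a) <= sg * (2 * p * (e * n) + sg * D2) by rewrite X2 in H1; lra.
move: H3; rewrite ler_pM2l// => H3.
have H4 : 2 * p * (e * n) <= a.
  have -> : 2 * p * (e * n) = a * (n / (n + 1)) by rewrite /e; field; rewrite !gt_eqF.
  have n11 : n / (n + 1) <= 1 by rewrite ler_pdivrMr//; lra.
  by apply: ler_piMr n11; exact: ltW.
lra.
Qed.

(** Cauchy's estimate for [phi z - c z] on the disc of radius [|z| / 2]. *)
Lemma cderivative_phi_infty (c : R) : 0 < c -> simple_pole c ->
  forall e : R, 0 < e -> exists2 M : R, 0 < M & forall z, M < normc z ->
    ~ W z /\ normc (cderivative phi z - c%:C) <= e.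
Proof.
move=> c0 Hc e e0; have e3 : 0 < e / 3 by rewrite divr_gt0.
have [M M0 HM] := Hc _ e3; exists (2 * M); first by rewrite mulr_gt0.
move=> z zM; have zW : ~ W z by apply: (HM z _).1; lra.
split=> //.
have r0 : 0 < normc z / 2 by lra.
have far v : normc (v - z) <= normc z / 2 -> M < normc v <= 3 * (normc z / 2).
  move=> vz; have := lB_normcB z (z - v); have := le_normcD (v - z) z.
  by rewrite subrK (_ : z - (z - v) = v) 1?[normc (z - v)]normcB; [lra|ring].
have fh v : normc (v - z) <= normc z / 2 -> chol (fun v => phi v - c%:C * v) v.
  move=> /far/andP[/HM[vW _] _]; apply: cholB; first exact: phi_chol.
  by apply: cholM; [exact: chol_cst|exact: chol_id].
have fM x : normc (phi (z + (normc z / 2)%:C * cis x) -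
      c%:C * (z + (normc z / 2)%:C * cis x)) <= e * (normc z / 2).
  set v := z + _; have vz : normc (v - z) <= normc z / 2.
    by rewrite addrC addKr normcM normc_cis mulr1 normcR gtr0_norm.
  have /andP[/HM[_ H1] H2] := far _ vz; apply: le_trans H1 _.
  have -> : e * (normc z / 2) = e / 3 * (3 * (normc z / 2)) by field.
  by apply: ler_wpM2l => //; exact: ltW.
have := cauchy_estimate r0 fh fM; rewrite mulfK ?gt_eqF//.
rewrite (@cderivativeE _ _ _ (cderivative phi z - c%:C * 1))//; first by rewrite mulr1.
by apply: cderivB; [exact/cderivativeP/phi_chol|exact/cderivZ/cderiv_id].
Qed.

(** The logarithmic derivative of [phi], multiplied by [z - lam], tends to [1]. *)
Lemma logderiv_infty lam (e : R) : 0 < e -> exists2 M : R, 0 < M &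
  forall z, M < normc z -> ~ W z /\
    normc (cderivative phi z * (z - lam) - phi z) <= e * normc (phi z).
Proof.
move=> e0; have [c c0 Hc] := phi_infty.
pose d := Num.min (c / 2) (e * c / 8).
have d0 : 0 < d by rewrite lt_min !divr_gt0// mulr_gt0.
have d1 : d <= c / 2 by rewrite ge_min lexx.
have d2 : d <= e * c / 8 by rewrite ge_min lexx orbT.
have [M1 M10 H1] := cderivative_phi_infty c0 Hc d0.
have [M2 M20 H2] := Hc _ d0.
pose L := normc lam + c * normc lam / d.
exists (Num.max (Num.max M1 M2) L); first by rewrite !lt_max M10.
move=> z; rewrite !gt_max => /andP[/andP[/H1[zW K1] /H2[_ K2]] zL].
split=> //; have l0 := normc_ge0 lam; have z0 := normc_ge0 z.
have ld : 0 <= c * normc lam / d by rewrite divr_ge0 ?mulr_ge0// ltW.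
have zl : normc lam <= normc z by rewrite /L in zL; lra.
have cl : c * normc lam <= d * normc z.
  by rewrite [leRHS]mulrC -ler_pdivrMr//; rewrite /L in zL; lra.
have -> : cderivative phi z * (z - lam) - phi z =
    (cderivative phi z - c%:C) * (z - lam) - ((phi z - c%:C * z) + c%:C * lam) by ring.
have T1 := le_normcB ((cderivative phi z - c%:C) * (z - lam)) (phi z - c%:C * z + c%:C * lam).
have T2 := le_normcD (phi z - c%:C * z) (c%:C * lam).
have T3 : normc ((cderivative phi z - c%:C) * (z - lam)) <= d * (2 * normc z).
  rewrite normcM ler_pM ?normc_ge0// (le_trans (le_normcB _ _))//; lra.
have T4 : normc (c%:C * lam) = c * normc lam by rewrite normcM normcR gtr0_norm.
have T5 := lB_normcD (c%:C * z) (phi z - c%:C * z).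
rewrite (addrC (c%:C * z)) subrK normcM normcR gtr0_norm// in T5.
have T6 : d * normc z <= c / 2 * normc z by rewrite ler_wpM2r.
have T7 : d * normc z <= e * c / 8 * normc z by rewrite ler_wpM2r.
have T8 : e * (c / 2 * normc z) <= e * normc (phi z) by apply: ler_wpM2l; [exact: ltW|lra].
lra.
Qed.

(** The Cayley transform [C] of the logarithmic derivative is bounded by [1] and
vanishes at infinity; the maximum principle for [C ^+ n * phi] makes its bound
strict. *)
Lemma cderivative_phi_neq0 z0 : W !=set0 -> ~ W z0 -> cderivative phi z0 != 0.
Proof.
move=> [lam lamW] z0W; apply/eqP => d0.
pose q z := cderivative phi z * (z - lam) / phi z.
have qRe z : ~ W z -> 0 <= complex.Re (q z).
  move=> zW; have pz := phi_neq0 zW.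
  have -> : q z = ((normc (phi z) ^+ 2)^-1)%:C *
      (conjc (phi z) * (cderivative phi z * (z - lam))).
    rewrite /q fmorphV /= -mulcJ; field.
    by rewrite pz conjc_eq0 pz.
  rewrite Re_mulR mulr_ge0 ?phi_starlike//.
  by rewrite invr_ge0 exprn_ge0// normc_ge0.
have q1 z : ~ W z -> 1 + q z != 0.
  move=> /qRe H; apply/eqP => E; have : complex.Re (1 + q z) = 0 by rewrite E.
  by rewrite ReD /=; lra.
pose C z := (1 - q z) / (1 + q z).
have C1 z : ~ W z -> normc (C z) <= 1.
  move=> zW; rewrite normc_f ler_pdivrMr ?normc_gt0 ?q1// mul1r.
  have := qRe z zW; case: (q z) => x y /= x0.
  by apply: ler_wsqrtr; nra.
have qh z : ~ W z -> chol q z.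
  move=> zW; apply: cholM; last by apply: cholV; [exact: phi_neq0|exact: phi_chol].
  apply: cholM; last by apply: cholB; [exact: chol_id|exact: chol_cst].
  have [r r0 Hr] := W_closed zW; apply: (chol_cderivative r0) => v /Hr.
  exact: phi_chol.
have Ch z : ~ W z -> chol C z.
  move=> zW; apply: cholM; first by apply: cholB; [exact: chol_cst|exact: qh].
  by apply: cholV; [exact: q1|apply: cholD; [exact: chol_cst|exact: qh]].
have e3 : 0 < 3^-1 :> R by rewrite invr_gt0.
have [M M0 HM] := logderiv_infty lam e3.
have [R0 R01 HR0] := phi_large M.
have Csmall z : ~ W z -> R0 < normc (phi z) -> normc (C z) <= 2^-1.
  move=> zW /(HR0 _ zW)/HM[_ H].
  have qs : normc (q z - 1) <= 3^-1.
    have -> : q z - 1 = (cderivative phi z * (z - lam) - phi z) / phi z.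
      by rewrite /q; field; exact: phi_neq0.
    by rewrite normc_f ler_pdivrMr// normc_gt0; exact: phi_neq0.
  rewrite normc_f ler_pdivrMr ?normc_gt0 ?q1// [normc (1 - q z)]normcB.
  have := lB_normcD 2 (q z - 1); have -> : 2 + (q z - 1) = 1 + q z by ring.
  by rewrite normc_nat; lra.
have Cz0 : C z0 = 1 by rewrite /C /q d0 !mul0r subr0 addr0 divr1.
have p1 := phi_gt1 z0W.
have pR0 : normc (phi z0) <= R0.
  rewrite leNgt; apply/negP => /(Csmall _ z0W); rewrite Cz0 normc1.
  by lra.
have R10 : 0 < (R0 + 1)^-1 by rewrite invr_gt0; lra.
have [n Hn] := half_expn_lt R10.
pose rho := (1 + normc (phi z0)) / 2.
have rho1 : 1 < rho by rewrite /rho; lra.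
have := @max_principle (fun z => C z ^+ n * phi z) rho (R0 + 1) rho rho1.
have rR : rho <= R0 + 1 by rewrite /rho; lra.
move=> /(_ rR) H; have : normc (C z0 ^+ n * phi z0) <= rho.
  apply: H => //; last by rewrite /rho; lra.
  - by move=> z zW; apply: cholM; [apply: cholX; exact: Ch|exact: phi_chol].
  - move=> z zW zr; rewrite normcM normcX zr ler_piMl//; first by lra.
    by rewrite exprn_ile1 ?normc_ge0// C1.
  - move=> z zW zr; rewrite normcM normcX zr.
    have Cs : normc (C z) <= 2^-1 by apply: Csmall => //; lra.
    have : normc (C z) ^+ n <= 2^-1 ^+ n by rewrite lerXn2r// nnegrE ?normc_ge0.
    rewrite exprVn => Hn1.
    apply: (@le_trans _ _ 1); last exact: ltW.
    by rewrite -ler_pdivlMr ?div1r; lra.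
rewrite Cz0 expr1n mul1r /rho; lra.
Qed.

(** The difference quotient of [psi] is the inverse of the continuous difference
quotient of [phi], evaluated at [psi]. *)
Lemma psi_cderiv w : W !=set0 -> 1 < normc w ->
  cderiv psi w (cderivative phi (psi w))^-1.
Proof.
move=> W0 w1; have [zW zw] := psiP w1; set z0 := psi w in zW zw *.
have a0 := cderivative_phi_neq0 W0 zW; set a := cderivative phi z0 in a0 *.
have [q [qc qa Hq]] := cderivativeP (phi_chol zW).
rewrite -/a in qa.
have pc := psi_ccont w1.
have qpc : ccont (fun v => (q (psi v))^-1) w.
  by apply: ccontV; [rewrite -/z0 qa|apply: ccont_comp].
have r0 : 0 < normc w - 1 by rewrite subr_gt0.
have near1 v : normc (v - w) < normc w - 1 -> 1 < normc v.
  by have := lB_normcB w (w - v); rewrite (_ : w - (w - v) = v) 1?normcB; [lra|ring].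
have key v : normc (v - w) < normc w - 1 -> v - w = q (psi v) * (psi v - z0).
  by move=> /near1 v1; rewrite -Hq zw psiK.
exists (fun v => if v == w then a^-1 else (psi v - z0) / (v - w)); split.
- have H0 := qc; apply: ccont_near r0 _ qpc => v vw.
  case: eqVneq => [->|vNw]; first by rewrite -/z0 qa.
  have vw0 : v - w != 0 by rewrite subr_eq0.
  have E := key v vw; have : q (psi v) * (psi v - z0) != 0 by rewrite -E.
  by rewrite mulf_eq0 negb_or => /andP[q0 p0]; rewrite E; field; rewrite q0 p0.
- by rewrite eqxx.
- move=> v; case: eqVneq => [->|vNw]; first by rewrite !subrr mulr0.
  by rewrite mulfVK// subr_eq0.
Qed.

(** For [M] a matrix, [faber_kernel M w] would be [w psi'(w) (psi w - M)^-1], the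
generating function of the Faber polynomials of [M]; this is its scalar form. *)
Definition faber_kernel lam w := w / cderivative phi (psi w) / (psi w - lam).

Section Kernel.
Variable lam : R[i].
Hypothesis lamW : W lam.

Let W0 : W !=set0.
Proof. by exists lam. Qed.

Lemma psi_chol w : 1 < normc w -> chol psi w.
Proof. by move=> w1; eexists; exact: psi_cderiv. Qed.

Lemma psi_sub_neq0 w : 1 < normc w -> psi w - lam != 0.
Proof.
by move=> /psi_notin H; rewrite subr_eq0; apply/eqP => E; apply: H; rewrite E.
Qed.

Lemma faber_kernel_chol w : 1 < normc w -> chol (faber_kernel lam) w.
Proof.
move=> w1; have zW := psi_notin w1.
apply: cholM; last first.
  by apply: cholV; [exact: psi_sub_neq0|apply: cholB; [exact: psi_chol|exact: chol_cst]].
apply: cholM; first exact: chol_id.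
apply: cholV; first exact: cderivative_phi_neq0.
apply: (@chol_comp _ (cderivative phi) psi); first exact: psi_chol.
have [r r0 Hr] := W_closed zW; apply: (chol_cderivative r0) => v /Hr.
exact: phi_chol.
Qed.

Lemma psi_large (M : R) : exists2 M' : R, 1 < M' & forall w, M' < normc w -> M < normc (psi w).
Proof.
have [R0 R01 H] := phi_large M; exists R0 => // w w0.
have w1 : 1 < normc w by exact: lt_trans R01 w0.
by apply: H; [exact: psi_notin|rewrite psiK].
Qed.

Lemma faber_kernel_infty (e : R) : 0 < e ->
  exists2 M : R, 1 < M & forall w, M < normc w -> normc (faber_kernel lam w - 1) <= e.
Proof.
move=> e0; pose d := Num.min (e / 2) (2^-1).
have d0 : 0 < d by rewrite lt_min divr_gt0//= invr_gt0.
have d1 : d <= e / 2 by rewrite ge_min lexx.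
have d2 : d <= 2^-1 by rewrite ge_min lexx orbT.
have [M M0 HM] := logderiv_infty lam d0.
have [M' M'1 HM'] := psi_large M.
exists M' => // w wM; have w1 : 1 < normc w by exact: lt_trans M'1 wM.
have [zW] := HM _ (HM' _ wM); rewrite psiK// => H.
set D := cderivative phi (psi w) * (psi w - lam) in H.
have D0 : D != 0 by rewrite mulf_neq0 ?cderivative_phi_neq0 ?psi_sub_neq0.
have -> : faber_kernel lam w - 1 = - ((D - w) / D).
  by rewrite /faber_kernel /D; field; rewrite psi_sub_neq0// cderivative_phi_neq0.
rewrite normcN normc_f ler_pdivrMr ?normc_gt0//.
have := lB_normcD w (D - w); rewrite [w + _]addrC subrK => H2.
have dw : d * normc w <= normc w / 2.
  by rewrite [leRHS]mulrC ler_wpM2r// ltW// (lt_trans _ w1).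
have dw2 : d * normc w <= e / 2 * normc w by rewrite ler_wpM2r// ltW// (lt_trans _ w1).
have eD : e * (normc w / 2) <= e * normc D by apply: ler_wpM2l; [exact: ltW|lra].
lra.
Qed.

Lemma mean_faber_kernel (rho : R) : 1 < rho ->
  clim (rmean (fun w => faber_kernel lam (rho%:C * w))) 1.
Proof.
move=> rho1; apply: annulus_mean => // [w w1|e e0].
  exact: faber_kernel_chol.
by have [M _ HM] := faber_kernel_infty e0; exists M.
Qed.

Lemma mean_faber_kernel_neg (rho : R) j : 1 < rho ->
  clim (rmean (fun w => faber_kernel lam (rho%:C * w) * (rho%:C * w) ^- j.+1)) 0.
Proof.
move=> rho1.
apply: (@annulus_mean _ (fun w => faber_kernel lam w * w ^- j.+1)) => // [w w1|e e0].
  apply: cholM; first exact: faber_kernel_chol.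
  apply: cholV; last by apply: cholX; exact: chol_id.
  by rewrite expf_neq0// -normc_gt0 (lt_trans _ w1).
have [M M1 HM] := faber_kernel_infty ltr01.
exists (Num.max M (2 / e)) => w; rewrite gt_max => /andP[Mw ew].
have w1 : 1 < normc w by exact: lt_trans M1 Mw.
have w0 : 0 < normc w by exact: lt_trans w1.
rewrite subr0 normc_f normcX ler_pdivrMr ?exprn_gt0//.
have := HM _ Mw; have := lB_normcB (faber_kernel lam w) 1.
rewrite normc1 => H1 H2.
have e2 : 2 <= e * normc w by move: ew; rewrite ltr_pdivrMr// mulrC => /ltW.
apply: (@le_trans _ _ (e * normc w)); first by lra.
apply: ler_wpM2l; first exact: ltW.
rewrite exprS; apply: ler_peMr; first exact: ltW.
by apply: exprn_ege1; exact: ltW.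
Qed.

(** The Faber polynomial [p] is a coefficient of its generating function: modulo
terms that vanish at infinity, [w ^ j] is [p (psi w)], and
[(p (psi w) - p lam) / (psi w - lam) * psi' w] is a derivative. *)
Lemma mean_faber_kernel_pos (rho : R) j (p : {poly R[i]}) : 1 < rho ->
  (forall e : R, 0 < e -> exists M : R, forall z, M < normc z ->
     normc (phi z ^+ j - p.[z]) <= e) ->
  clim (rmean (fun w => faber_kernel lam (rho%:C * w) * (rho%:C * w) ^+ j)) p.[lam].
Proof.
move=> rho1 pj.
have /factor_theorem[s ps] : root (p - p.[lam]%:P) lam.
  by rewrite /root hornerD hornerN hornerC subrr.
have [S Ss] := poly_antiderivative s.
pose G w := S.[psi w].
have Gd w : 1 < normc w -> cderiv G w (s.[psi w] * (cderivative phi (psi w))^-1).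
  move=> w1; rewrite -Ss; apply: (@cderiv_comp _ (fun z => S.[z]) psi).
    exact: psi_cderiv.
  exact: cderiv_poly.
have Gh w : 1 < normc w -> chol G w by move=> /Gd ?; eexists; eassumption.
have G'h w : 1 < normc w -> chol (cderivative G) w.
  move=> w1; have r0 : 0 < normc w - 1 by rewrite subr_gt0.
  apply: (chol_cderivative r0) => v vw; apply: Gh.
  by have := lB_normcB w (w - v); rewrite (_ : w - (w - v) = v) 1?normcB; [lra|ring].
pose F w := faber_kernel lam w * w ^+ j - w * cderivative G w.
have FE w : 1 < normc w ->
    F w = faber_kernel lam w * (p.[lam] + (phi (psi w) ^+ j - p.[psi w])).
  move=> w1; have Pw : p.[psi w] = p.[lam] + s.[psi w] * (psi w - lam).
    have := congr1 (horner^~ (psi w)) ps.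
    by rewrite hornerM !hornerD !hornerN !hornerC hornerX => <-; rewrite addrC subrK.
  rewrite /F (cderivativeE (Gd w w1)) Pw psiK// /faber_kernel; field.
  by rewrite psi_sub_neq0// cderivative_phi_neq0//; exact: psi_notin.
have H1 : clim (rmean (fun w => F (rho%:C * w))) p.[lam].
  apply: annulus_mean => // [w w1|e e0].
    apply: cholB; first by apply: cholM; [exact: faber_kernel_chol|apply: cholX; exact: chol_id].
    by apply: cholM; [exact: chol_id|exact: G'h].
  pose l := normc p.[lam]; have l0 : 0 <= l by exact: normc_ge0.
  have e4 : 0 < e / 4 by rewrite divr_gt0.
  have [M1 HM1] := pj _ e4.
  have [M2 M21 HM2] := psi_large M1.
  have d0 : 0 < Num.min 1 (e / (2 * (l + 1))).
    by rewrite lt_min ltr01 divr_gt0// mulr_gt0//; lra.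
  have [M3 M31 HM3] := faber_kernel_infty d0.
  exists (Num.max M2 M3) => w; rewrite gt_max => /andP[w2 w3].
  have w1 : 1 < normc w by exact: lt_trans M31 w3.
  rewrite FE//; set E := _ ^+ j - _; set Q := faber_kernel lam w.
  have HE : normc E <= e / 4 by apply: HM1; exact: HM2.
  have := HM3 _ w3; rewrite -/Q le_min => /andP[Q1 Q2].
  have -> : Q * (p.[lam] + E) - p.[lam] = (Q - 1) * p.[lam] + (Q - 1) * E + E by ring.
  have h1 : normc ((Q - 1) * p.[lam]) <= e / 2.
    rewrite normcM -/l; move: Q2; rewrite ler_pdivlMr; last by lra.
    by have := normc_ge0 (Q - 1); nra.
  have h2 : normc ((Q - 1) * E) <= 1 * (e / 4).
    by rewrite normcM ler_pM ?normc_ge0.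
  have := le_normcD ((Q - 1) * p.[lam] + (Q - 1) * E) E.
  have := le_normcD ((Q - 1) * p.[lam]) ((Q - 1) * E).
  lra.
have H2 := mean_of_derivative rho1 Gh.
have := climD H1 H2; rewrite addr0; apply: eq_clim => N.
by rewrite -rmeanD; apply: eq_rmean => x; rewrite /F subrK.
Qed.

End Kernel.

End Exterior.

(** * Numerical ranges *)

Section NumericalRange.
Context {R : realType}.
Local Open Scope sesquilinear_scope.
Local Notation C := R[i].

Definition dotc n (x y : 'cV[C]_n) : C := (x ^t* *m y) 0 0.
Definition nsq n (x : 'cV[C]_n) : R := \sum_i normc (x i 0) ^+ 2.
Definition quad n (M : 'M[C]_n) (x : 'cV[C]_n) : C := dotc x (M *m x).

Section Dot.
Variable n : nat.
Implicit Types (x y z : 'cV[C]_n) (M : 'M[C]_n).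

Lemma dotcE x y : dotc x y = \sum_i conjc (x i 0) * y i 0.
Proof. by rewrite /dotc mxE; apply: eq_bigr => i _; rewrite !mxE. Qed.

Lemma dotcDr x y z : dotc x (y + z) = dotc x y + dotc x z.
Proof. by rewrite /dotc mulmxDr mxE. Qed.

Lemma dotcZr a x y : dotc x (a *: y) = a * dotc x y.
Proof. by rewrite /dotc -scalemxAr mxE. Qed.

Lemma dotcJ x y : conjc (dotc x y) = dotc y x.
Proof.
rewrite !dotcE rmorph_sum /=; apply: eq_bigr => i _.
by rewrite rmorphM /= conjcK mulrC.
Qed.

Lemma dotcDl x y z : dotc (x + y) z = dotc x z + dotc y z.
Proof. by rewrite -[LHS]conjcK dotcJ dotcDr rmorphD /= !dotcJ. Qed.

Lemma dotcZl a x y : dotc (a *: x) y = conjc a * dotc x y.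
Proof. by rewrite -[LHS]conjcK dotcJ dotcZr rmorphM /= dotcJ. Qed.

Lemma dotcc x : dotc x x = (nsq x)%:C.
Proof.
rewrite dotcE /nsq rmorph_sum; apply: eq_bigr => i _.
by rewrite mulrC mulcJ.
Qed.

Lemma nsq_ge0 x : 0 <= nsq x.
Proof. by apply: sumr_ge0 => i _; rewrite exprn_ge0// normc_ge0. Qed.

Lemma nsq_eq0 x : (nsq x == 0) = (x == 0).
Proof.
apply/idP/eqP => [|->]; last first.
  by apply/eqP; apply: big1 => i _; rewrite mxE normc0 expr0n.
rewrite psumr_eq0 => [/allP H|i _]; last by rewrite exprn_ge0// normc_ge0.
apply/matrixP => i j; rewrite ord1 mxE; apply/eqP; rewrite -normc_eq0.
by have := H i (mem_index_enum i); rewrite sqrf_eq0.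
Qed.

Lemma nsq_gt0 x : (0 < nsq x) = (x != 0).
Proof. by rewrite lt_def nsq_ge0 andbT nsq_eq0. Qed.

Lemma nsqZ a x : nsq (a *: x) = normc a ^+ 2 * nsq x.
Proof.
by rewrite /nsq mulr_sumr; apply: eq_bigr => i _; rewrite mxE normcM exprMn.
Qed.

Lemma nsqD x y : nsq (x + y) = nsq x + 2 * complex.Re (dotc x y) + nsq y.
Proof.
apply: complexI; rewrite -dotcc dotcDl !dotcDr !dotcc.
have -> : dotc y x = conjc (dotc x y) by rewrite dotcJ.
rewrite !rmorphD rmorphM rmorph_nat /= -addcJ; ring.
Qed.

Lemma normc_dotc_le x y : normc (dotc x y) <= (nsq x + nsq y) / 2.
Proof.
have [u u1 uxy] := phase (dotc x y).
have := nsq_ge0 (x + (- u) *: y).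
by rewrite nsqD nsqZ normcN u1 dotcZr mulNr uxy /=; lra.
Qed.

Lemma quadZ M a x : quad M (a *: x) = (normc a ^+ 2)%:C * quad M x.
Proof.
by rewrite /quad -scalemxAr dotcZl dotcZr mulrA [(conjc _) * _]mulrC mulcJ.
Qed.

Lemma quadD M x y :
  quad M (x + y) = quad M x + dotc x (M *m y) + dotc y (M *m x) + quad M y.
Proof. by rewrite /quad mulmxDr dotcDl !dotcDr addrA. Qed.

Lemma quad_mxD M N x : quad (M + N) x = quad M x + quad N x.
Proof. by rewrite /quad mulmxDl dotcDr. Qed.

Lemma quad_mxZ a M x : quad (a *: M) x = a * quad M x.
Proof. by rewrite /quad -scalemxAl dotcZr. Qed.

Lemma quad_scalar a x : quad a%:M x = a * (nsq x)%:C.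
Proof. by rewrite /quad mul_scalar_mx dotcZr dotcc. Qed.

Lemma unit_vecP x : (x ^t* *m x = 1%:M) <-> nsq x = 1.
Proof.
split=> [/(congr1 (fun M : 'M[C]_1 => M 0 0))|x1].
  by rewrite -/(dotc x x) dotcc mxE eqxx => H; apply: complexI; rewrite H.
apply/matrixP => i j; rewrite !ord1 -/(dotc x x) dotcc x1 mxE eqxx.
by [].
Qed.

Lemma normalize x : x != 0 -> exists2 a : C, nsq (a *: x) = 1 &
  forall M, quad M (a *: x) = quad M x / (nsq x)%:C.
Proof.
rewrite -nsq_gt0 => x0; have sx : 0 < Num.sqrt (nsq x) by rewrite sqrtr_gt0.
have E : normc ((Num.sqrt (nsq x))^-1)%:C ^+ 2 = (nsq x)^-1.
  by rewrite normcR gtr0_norm ?invr_gt0// exprVn sqr_sqrtr// ltW.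
exists ((Num.sqrt (nsq x))^-1)%:C; first by rewrite nsqZ E mulVf// gt_eqF.
by move=> M; rewrite quadZ E mulrC fmorphV.
Qed.

(** The numerical range of a complex matrix: the Schur form and the perturbations
of a real matrix leave the real field. *)
Definition NR M : set C := [set quad M x | x in [set x | nsq x = 1]].

Lemma NR_quad M x : x != 0 -> NR M (quad M x / (nsq x)%:C).
Proof. by move=> /normalize[a a1 aM]; exists (a *: x). Qed.

Lemma turn_real (c d : C) : exists2 u : C, normc u = 1 &
  complex.Im (u * c + conjc u * d) = 0.
Proof.
case: c d => [c1 c2] [d1 d2].
have [/eqP E|E] := eqVneq ((c1 - d1) ^+ 2 + (c2 + d2) ^+ 2) 0.
  exists 1; first exact: normc1.
  move: E; rewrite paddr_eq0 ?sqr_ge0// !sqrf_eq0 => /andP[_ /eqP E].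
  by rewrite mul1r /= oppr0 mul0r mul1r addr0 E.
have E0 : 0 < (c1 - d1) ^+ 2 + (c2 + d2) ^+ 2.
  by rewrite lt_def E addr_ge0 ?sqr_ge0.
pose r := Num.sqrt ((c1 - d1) ^+ 2 + (c2 + d2) ^+ 2).
have r0 : 0 < r by rewrite sqrtr_gt0.
exists (r^-1%:C * ((c1 - d1) -i* (c2 + d2))).
  rewrite normcM normcR gtr0_norm ?invr_gt0//= sqrrN -/r mulVf// gt_eqF//.
by rewrite /=; ring.
Qed.

(** The Toeplitz--Hausdorff theorem: in the plane spanned by two unit vectors, the
form is normalized to take the values [0] and [1] there; after turning one of the
vectors it is real on the segment that joins them. *)
Lemma NR_convex M a b (s : R) : NR M a -> NR M b -> 0 <= s <= 1 ->
  NR M (a + s%:C * (b - a)).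
Proof.
move=> [x /= x1 xa] [y /= y1 yb] s01.
have [ab|ab] := eqVneq a b.
  by rewrite ab subrr mulr0 addr0; exists y.
have ba0 : b - a != 0 by rewrite subr_eq0 eq_sym.
pose N := (b - a)^-1 *: (M + (- a)%:M).
have NM z : quad M z = a * (nsq z)%:C + (b - a) * quad N z.
  by rewrite /N quad_mxZ quad_mxD quad_scalar mulVKf//; ring.
have Nx : quad N x = 0.
  by have := NM x; rewrite xa x1 mulr1 => /eqP; rewrite addrC -subr_eq subrr
    eq_sym mulf_eq0 (negbTE ba0) => /eqP.
have Ny : quad N y = 1.
  apply: (mulfI ba0); rewrite mulr1; apply: (@addrI _ a).
  by have := NM y; rewrite yb y1 mulr1 => <-; rewrite addrC subrK.
have [u u1 uI] := turn_real (dotc x (N *m y)) (dotc y (N *m x)).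
pose m := complex.Re (u * dotc x (N *m y) + conjc u * dotc y (N *m x)).
have mE : u * dotc x (N *m y) + conjc u * dotc y (N *m x) = m%:C.
  by rewrite [LHS]complexE uI mulr0 addr0.
pose e := 2 * complex.Re (u * dotc x y).
pose v (t : R) := ((1 - t)%:C * (conjc u)) *: x + t%:C *: y.
have ucE (t : R) : conjc ((1 - t)%:C * (conjc u)) = (1 - t)%:C * u.
  by rewrite conjcM conjc_real conjcK.
have vN t : quad N (v t) = (t ^+ 2 + (1 - t) * t * m)%:C.
  rewrite quadD !quadZ Nx Ny mulr0 mulr1 add0r -!scalemxAr !dotcZl !dotcZr.
  rewrite ucE conjc_real normcR real_normK ?num_real//.
  rewrite [RHS]rmorphD [X in _ = _ + X]rmorphM [in RHS]rmorphM /= -mE; ring.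
have vsq t : nsq (v t) = (1 - t) ^+ 2 + t ^+ 2 + (1 - t) * t * e.
  rewrite nsqD !nsqZ x1 y1 dotcZl dotcZr normcM normcJ u1 !normcR !mulr1.
  rewrite !real_normK ?num_real// ucE.
  have -> : (1 - t)%:C * u * (t%:C * dotc x y) = ((1 - t) * t)%:C * (u * dotc x y).
    by rewrite rmorphM; ring.
  by rewrite Re_mulR /e; ring.
have v0 t : v t != 0.
  apply/eqP => E; have E2 : ((1 - t)%:C * (conjc u)) *: x = (- t%:C) *: y.
    by rewrite scaleNr; apply/eqP; rewrite -addr_eq0; apply/eqP.
  have := congr1 (@nsq n) E2; have := congr1 (quad N) E2.
  rewrite !quadZ Nx Ny mulr0 mulr1 !nsqZ x1 y1 !mulr1 normcM normcN !normcR normcJ u1 mulr1.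
  rewrite !real_normK ?num_real// => H1 H2.
  have t0 : t ^+ 2 = 0 by apply: complexI; rewrite -H1.
  by move: H2; rewrite t0 => /eqP; rewrite sqrf_eq0; move/eqP: t0;
    rewrite sqrf_eq0 => /eqP ->; rewrite subr0 oner_eq0.
(* a root of [p] is a [t] for which the normalized value at [v t] is [s] *)
pose p : {poly R} := 'X^2 + (1 - 'X) * 'X * m%:P
  - s%:P * ((1 - 'X) ^+ 2 + 'X^2 + (1 - 'X) * 'X * e%:P).
have pE t : p.[t] = t ^+ 2 + (1 - t) * t * m - s * ((1 - t) ^+ 2 + t ^+ 2 + (1 - t) * t * e).
  by rewrite /p !hornerE.
have [|t _ /rootP pt] := @poly_ivt R p 0 1 ler01.
  have -> : p.[0] = - s by rewrite pE; ring.
  have -> : p.[1] = 1 - s by rewrite pE; ring.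
  by rewrite oppr_le0 subr_ge0.
have H : quad N (v t) = s%:C * (nsq (v t))%:C.
  rewrite vN vsq -rmorphM; congr (_%:C); apply/eqP; rewrite -subr_eq0 -pE pt //.
have := NR_quad M (v0 t); rewrite NM H mulrDl mulfK; last first.
  by rewrite -normc_gt0 normcR normr_gt0 nsq_eq0.
rewrite mulrA mulfK; last by rewrite -normc_gt0 normcR normr_gt0 nsq_eq0.
by rewrite [(b - a) * _]mulrC.
Qed.

End Dot.

Lemma numerical_rangeE n (A : 'M[R]_n) : numerical_range A = NR (cmx A).
Proof.
apply/seteqP; split => z [x /= x1 <-]; exists x => //=.
- exact/unit_vecP.
- by rewrite /quad /dotc /qform mulmxA.
- exact/unit_vecP.
- by rewrite /quad /dotc /qform mulmxA.
Qed.

Section Compactness.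
Variables (n : nat) (A : 'M[R]_n).

Let vec (u : 'rV[R]_(n + n)) : 'cV[C]_n :=
  \col_i (u 0 (lshift n i) +i* u 0 (rshift n i)).

Let unvec (x : 'cV[C]_n) : 'rV[R]_(n + n) :=
  row_mx (\row_i complex.Re (x i 0)) (\row_i complex.Im (x i 0)).

Let unvecK x : vec (unvec x) = x.
Proof.
apply/matrixP => i j; rewrite ord1 mxE row_mxEl row_mxEr !mxE.
by case: (x i 0).
Qed.

Let nsq_vec u : nsq (vec u) = \sum_i u 0 i ^+ 2.
Proof.
rewrite big_split_ord /= -big_split /=; apply: eq_bigr => i _.
by rewrite mxE normc_sqr.
Qed.

Let sphere := [set u : 'rV[R]_(n + n) | \sum_i u 0 i ^+ 2 = 1].

Let coordX i : continuous (fun u : 'rV[R]_(n + n) => u 0 i).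
Proof. exact: coord_continuous. Qed.

Let cD (F G : 'rV[R]_(n + n) -> R) :
  continuous F -> continuous G -> continuous (fun u => F u + G u).
Proof. by move=> Fc Gc u; exact: (continuousD (Fc u) (Gc u)). Qed.

Let cB (F G : 'rV[R]_(n + n) -> R) :
  continuous F -> continuous G -> continuous (fun u => F u - G u).
Proof. by move=> Fc Gc u; exact: (continuousB (Fc u) (Gc u)). Qed.

Let cM (F G : 'rV[R]_(n + n) -> R) :
  continuous F -> continuous G -> continuous (fun u => F u * G u).
Proof. by move=> Fc Gc u; exact: (continuousM (Fc u) (Gc u)). Qed.

Let cC (a : R) : continuous (fun _ : 'rV[R]_(n + n) => a).
Proof. exact: cst_continuous. Qed.

Let sum_continuous I (r : seq I) (F : I -> 'rV[R]_(n + n) -> R) :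
  (forall i, continuous (F i)) -> continuous (fun u => \sum_(i <- r) F i u).
Proof.
move=> Fc; elim: r => [|i r IH].
  have -> : (fun u => \sum_(i <- [::]) F i u) = cst 0.
    by apply/funext => u; rewrite big_nil.
  exact: cst_continuous.
have -> : (fun u => \sum_(j <- i :: r) F j u) = (fun u => F i u + \sum_(j <- r) F j u).
  by apply/funext => u; rewrite big_cons.
exact: cD.
Qed.

Let sphere_compact : compact sphere.
Proof.
pose cube := [set u : 'rV[R]_(n + n) | forall i, `[(-1 : R), 1]%classic (u ord0 i)].
have cube_compact : compact cube.
  by apply: (@rV_compact R _ (fun=> `[(-1 : R), 1]%classic)) => i; exact: segment_compact.
have -> : sphere = cube `&` sphere.
  apply/seteqP; split => u; last by case.
  move=> u1; split=> // i; rewrite /= in_itv /= -ler_norml.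
  rewrite -(@ler_pXn2r _ 2) ?nnegrE// expr1n real_normK ?num_real// -[leRHS]u1.
  by rewrite (bigD1 i)//= lerDl sumr_ge0// => j _; exact: sqr_ge0.
apply: compact_closedI => //.
have -> : sphere = (fun u : 'rV[R]_(n + n) => \sum_i u 0 i ^+ 2) @^-1` [set 1 : R].
  by [].
apply: closed_comp => [u _|]; last exact: closed_eq.
by apply: sum_continuous => i; apply: cM; exact: coordX.
Qed.

Let Re_quad u : complex.Re (quad (cmx A) (vec u)) =
  \sum_i \sum_j A i j * (u 0 (lshift n i) * u 0 (lshift n j)
                        + u 0 (rshift n i) * u 0 (rshift n j)).
Proof.
rewrite /quad dotcE (raddf_sum (@complex.Re R)); apply: eq_bigr => i _.
rewrite !mxE mulr_sumr raddf_sum; apply: eq_bigr => j _.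
by rewrite !mxE /=; ring.
Qed.

Let Im_quad u : complex.Im (quad (cmx A) (vec u)) =
  \sum_i \sum_j A i j * (u 0 (lshift n i) * u 0 (rshift n j)
                        - u 0 (rshift n i) * u 0 (lshift n j)).
Proof.
rewrite /quad dotcE raddf_sum; apply: eq_bigr => i _.
rewrite !mxE mulr_sumr raddf_sum; apply: eq_bigr => j _.
by rewrite !mxE /=; ring.
Qed.

Let dist z u := (complex.Re (quad (cmx A) (vec u)) - complex.Re z) ^+ 2
              + (complex.Im (quad (cmx A) (vec u)) - complex.Im z) ^+ 2.

Let distE z u : dist z u = normc (quad (cmx A) (vec u) - z) ^+ 2.
Proof. by rewrite normc_sqr ReB /dist; case: (quad _ _) z => a b []. Qed.

Let dist_continuous z : continuous (dist z).
Proof.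
apply: cD; (apply: cM; (apply: cB; [|exact: cC])).
1, 2: under eq_fun do rewrite Re_quad.
3, 4: under eq_fun do rewrite Im_quad.
all: apply: sum_continuous => i; apply: sum_continuous => j.
all: apply: cM; first exact: cC.
1, 2: by apply: cD; apply: cM; exact: coordX.
all: by apply: cB; apply: cM; exact: coordX.
Qed.

Let sphere0 : (0 < n)%N -> sphere !=set0.
Proof.
move=> n0; exists (\row_i (i == lshift n (Ordinal n0))%:R).
rewrite /sphere /= (bigD1 (lshift n (Ordinal n0)))//= mxE eqxx expr1n big1 ?addr0//.
by move=> i /negPf iN; rewrite mxE iN expr0n.
Qed.

(** In real coordinates the distance from [z] to the values of the form is
continuous on a compact sphere, hence attained. *)
Lemma NR_closed z : (0 < n)%N -> ~ NR (cmx A) z ->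
  exists2 r : R, 0 < r & forall w, normc (w - z) < r -> ~ NR (cmx A) w.
Proof.
move=> n0 zW.
have cont : {within sphere, continuous (dist z)}.
  by apply: continuous_subspaceT; exact: dist_continuous.
have [u us umin] := EVT_min_rV (sphere0 n0) sphere_compact cont.
have du : 0 < dist z u.
  rewrite distE exprn_gt0// normc_gt0 subr_eq0; apply/eqP => E; apply: zW.
  by exists (vec u) => //=; rewrite nsq_vec; move: us; rewrite inE.
exists (Num.sqrt (dist z u)); first by rewrite sqrtr_gt0.
move=> w wz [x /= x1 xw].
have := umin (unvec x); rewrite inE /sphere /= -nsq_vec unvecK => /(_ x1).
rewrite [leRHS]distE unvecK xw => H; move: wz; rewrite ltNge => /negP; apply.
by rewrite -(ger0_norm (normc_ge0 (w - z))) -sqrtr_sqr ler_wsqrtr.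
Qed.

Lemma NR_bounded : (0 < n)%N -> exists B : R, forall z, NR (cmx A) z -> normc z <= B.
Proof.
move=> n0.
have cont : {within sphere, continuous (dist 0)}.
  by apply: continuous_subspaceT; exact: dist_continuous.
have [u _ umax] := EVT_max_rV (sphere0 n0) sphere_compact cont.
exists (Num.sqrt (dist 0 u)) => z [x /= x1 <-].
have := umax (unvec x); rewrite inE /sphere /= -nsq_vec unvecK => /(_ x1).
rewrite [leLHS]distE unvecK subr0 => H.
by rewrite -(ger0_norm (normc_ge0 (quad _ _))) -sqrtr_sqr ler_wsqrtr.
Qed.

End Compactness.
End NumericalRange.

(** * The bound for Faber polynomials of matrices *)

Lemma conj_mulmx (K : pzRingType) n (P Q D1 D2 : 'M[K]_n) : Q *m P = 1%:M ->
  (P *m D1 *m Q) *m (P *m D2 *m Q) = P *m (D1 *m D2) *m Q.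
Proof. by move=> QP; rewrite !mulmxA -[_ *m Q *m P]mulmxA QP mulmx1. Qed.

Section DiagonalCalculus.
Context {R : realType}.
Local Notation C := R[i].
Variables (m : nat) (X : 'M[C]_m.+1) (d : 'rV[C]_m.+1).
Hypothesis Xu : X \in unitmx.
Implicit Types (f g : C -> C) (x y : 'cV[C]_m.+1).

(** The value at [f] of the functional calculus of the matrix with eigenvalues
[d] that is diagonal in the basis formed by the rows of [X]. *)
Definition diag_fun f : 'M[C]_m.+1 :=
  invmx X *m diag_mx (\row_i f (d 0 i)) *m X.

Definition diag_weight x y i : C := \sum_l conjc (x l 0) * invmx X l i * (X *m y) i 0.

Lemma dotc_diag_fun f x y :
  dotc x (diag_fun f *m y) = \sum_i f (d 0 i) * diag_weight x y i.
Proof.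
rewrite dotcE /diag_fun -!mulmxA.
under eq_bigr => l _.
  rewrite mxE mulr_sumr; under eq_bigr => i _.
    rewrite mul_diag_mx mxE mxE.
    have -> : conjc (x l 0) * (invmx X l i * (f (d 0 i) * (X *m y) i 0)) =
      f (d 0 i) * (conjc (x l 0) * invmx X l i * (X *m y) i 0) by ring.
    over.
  over.
by rewrite exchange_big /=; apply: eq_bigr => i _; rewrite -mulr_sumr.
Qed.

Lemma diag_funD f g : diag_fun f + diag_fun g = diag_fun (fun z => f z + g z).
Proof.
rewrite /diag_fun; have -> : diag_mx (\row_i (f (d 0 i) + g (d 0 i))) =
    diag_mx (\row_i f (d 0 i)) + diag_mx (\row_i g (d 0 i)).
  by apply/matrixP => i j; rewrite !mxE; case: eqP => _; rewrite ?mulr1n ?mulr0n ?addr0.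
by rewrite mulmxDr mulmxDl.
Qed.

Lemma diag_funM f g : diag_fun f *m diag_fun g = diag_fun (fun z => f z * g z).
Proof.
apply: etrans; first exact: conj_mulmx (mulmxV Xu).
rewrite mulmx_diag; have -> // : \row_j ((\row_i f (d 0 i)) 0 j * (\row_i g (d 0 i)) 0 j) =
   \row_i (f (d 0 i) * g (d 0 i)).
by apply/rowP => i; rewrite !mxE.
Qed.

Lemma diag_fun_cst a : diag_fun (fun=> a) = a%:M.
Proof.
rewrite /diag_fun; have -> : diag_mx (\row_(i < m.+1) a) = a%:M.
  by apply/matrixP => i j; rewrite !mxE.
by rewrite mul_mx_scalar -scalemxAl mulVmx// scalemx1.
Qed.

Lemma eq_diag_fun f g : (forall i, f (d 0 i) = g (d 0 i)) -> diag_fun f = diag_fun g.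
Proof.
move=> fg; rewrite /diag_fun; have -> // : \row_i f (d 0 i) = \row_i g (d 0 i).
by apply/rowP => i; rewrite !mxE.
Qed.

Lemma diag_fun_poly (p : {poly C}) :
  horner_mx (diag_fun id) p = diag_fun (horner p).
Proof.
elim/poly_ind: p => [|p c IH].
  rewrite rmorph0 (@eq_diag_fun (horner 0) (fun=> 0)) => [|i]; last exact: horner0.
  by rewrite diag_fun_cst raddf0.
rewrite rmorphD rmorphM /= horner_mx_X horner_mx_C IH.
have -> : diag_fun (horner p) * diag_fun id = diag_fun (fun z => p.[z] * z).
  exact: diag_funM.
rewrite -(diag_fun_cst c) diag_funD; apply: eq_diag_fun => i.
by rewrite hornerMXaddC.
Qed.

Lemma NR_eigenvalue i : NR (diag_fun id) (d 0 i).
Proof.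
pose x := invmx X *m (delta_mx i 0 : 'cV[C]_m.+1).
have Mx : diag_fun id *m x = d 0 i *: x.
  rewrite /diag_fun /x !mulmxA mulmxK// -mulmxA mul_diag_mx.
  rewrite scalemxAr; congr (_ *m _); apply/matrixP => a b; rewrite !mxE ord1 eqxx andbT.
  by case: eqP => [->|_]; rewrite ?mulr1 ?mulr0.
have x0 : x != 0.
  apply/eqP => x0; have := congr1 (mulmx X) x0; rewrite /x mulmxA mulmxV// mul1mx mulmx0.
  by move=> /matrixP /(_ i 0) /eqP; rewrite !mxE !eqxx oner_eq0.
have := NR_quad (diag_fun id) x0; rewrite /quad Mx dotcZr dotcc mulfK//.
by rewrite -normc_gt0 normcR normr_gt0 nsq_eq0.
Qed.

End DiagonalCalculus.

Section FaberBound.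
Context {R : realType}.
Local Notation C := R[i].
Variables (W : set C) (phi : C -> C).
Hypothesis W_convex : forall a b (s : R), W a -> W b -> 0 <= s <= 1 ->
  W (a + s%:C * (b - a)).
Hypothesis W_closed : forall z, ~ W z ->
  exists2 r : R, 0 < r & forall w, normc (w - z) < r -> ~ W w.
Hypothesis W_bounded : exists B : R, forall z, W z -> normc z <= B.
Hypothesis phi_ext : exterior_map W phi.

Variables (m : nat) (X : 'M[C]_m.+1) (d : 'rV[C]_m.+1).
Hypothesis Xu : X \in unitmx.
Let M := diag_fun X d id.
Hypothesis NRW : forall z, NR M z -> W z.

Let dW i : W (d 0 i).
Proof. exact/NRW/NR_eigenvalue. Qed.

Let W0 : W !=set0.
Proof. by exists (d 0 0). Qed.

Let K w := diag_fun X d (fun l => faber_kernel W phi l w).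

Let resolvent w : 1 < normc w ->
  ((psi W phi w)%:M - M) *m K w = (w / cderivative phi (psi W phi w))%:M.
Proof.
move=> w1; have -> : (psi W phi w)%:M - M = diag_fun X d (fun l => psi W phi w - l).
  apply: (@addIr _ M); rewrite subrK /M diag_funD -(diag_fun_cst d Xu).
  by congr diag_fun; apply/funext => z; rewrite subrK.
rewrite diag_funM// -(diag_fun_cst d Xu); apply: eq_diag_fun => i.
rewrite /faber_kernel mulrC mulfVK//.
exact: (psi_sub_neq0 phi_ext (dW i)).
Qed.

(** Positivity of the Hermitian part of the generating function; it is the
starlikeness of the exterior map, applied to the points
[quad M y / nsq y] of the numerical range. *)
Lemma Re_kernel_ge0 w x : 1 < normc w -> 0 <= complex.Re (dotc x (K w *m x)).
Proof.
move=> w1; set z := psi W phi w.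
have zW : ~ W z := psi_notin phi_ext w1.
have phiz : phi z = w := psiK phi_ext w1.
have d0 : cderivative phi z != 0.
  exact: (cderivative_phi_neq0 W_convex W_closed W_bounded phi_ext W0 zW).
have w0 : w != 0 by rewrite -normc_gt0 (lt_trans _ w1).
pose k := w / cderivative phi z; have k0 : k != 0 by rewrite mulf_neq0 ?invr_neq0.
pose y := k^-1 *: (K w *m x).
have Kx : K w *m x = k *: y by rewrite /y scalerA divff// scale1r.
have xy : x = (z%:M - M) *m y.
  by rewrite /y -scalemxAr mulmxA resolvent// -/k mul_scalar_mx scalerA mulVf// scale1r.
have [y0|y0] := eqVneq y 0; first by rewrite Kx y0 scaler0 /dotc mulmx0 mxE.
have ny0 : 0 < nsq y by rewrite nsq_gt0.
have nyC : (nsq y)%:C != 0 :> C by rewrite -normc_gt0 normcR normr_gt0 gt_eqF.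
pose v := quad M y / (nsq y)%:C; have vW : W v by exact/NRW/NR_quad.
have -> : dotc x (K w *m x) =
    (nsq y / normc (cderivative phi z) ^+ 2)%:C *
    conjc (conjc (phi z) * (cderivative phi z * (z - v))).
  rewrite Kx dotcZr -dotcJ {1}xy mulmxBl dotcDr mul_scalar_mx dotcZr dotcc.
  have -> : dotc y (- (M *m y)) = - quad M y by rewrite -scaleN1r dotcZr mulN1r.
  have -> : quad M y = v * (nsq y)%:C by rewrite /v mulfVK.
  rewrite -mulrBl !conjcM conjcK conjc_real phiz.
  rewrite rmorphM fmorphV /= -mulcJ /k; field.
  by rewrite d0 conjc_eq0 d0.
rewrite Re_mulR ReJ mulr_ge0 ?divr_ge0 ?nsq_ge0 ?exprn_ge0 ?normc_ge0//.
exact: phi_starlike W_convex W_closed W_bounded phi_ext _ _ vW zW.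
Qed.

Let herm w x y := dotc x (K w *m y) + conjc (dotc y (K w *m x)).

(** Positivity on [x - u y], where [u] turns [herm w x y] to the positive real
axis. *)
Lemma herm_le w x y : 1 < normc w -> normc (herm w x y) <=
  complex.Re (dotc x (K w *m x)) + complex.Re (dotc y (K w *m y)).
Proof.
move=> w1; set h := herm w x y.
have [u u1 uh] := phase h.
pose c := - u.
have := Re_kernel_ge0 (x + c *: y) w1; rewrite -/(quad (K w) _) quadD quadZ.
rewrite normcN u1 expr1n mul1r -!scalemxAr dotcZr dotcZl !ReD.
rewrite /quad; have -> : normc h = complex.Re (u * h) by rewrite uh.
rewrite /h /herm; set p := dotc x (_ *m y); set q := dotc y (_ *m x).
rewrite mulrDr ReD -(ReJ (u * conjc q)) conjcM conjcK.
have -> : c * p = -1 * (u * p) by rewrite /c; ring.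
have -> : conjc c * q = -1 * (conjc u * q) by rewrite /c rmorphN !mulNr mul1r.
have ReN1 (v : C) : complex.Re (-1 * v) = - complex.Re v by case: v => a b /=; ring.
rewrite !ReN1; move: (complex.Re (u * p)) (complex.Re (conjc u * q)) => r1 r2.
move: (complex.Re (dotc x _)) (complex.Re (dotc y _)) => r3 r4.
lra.
Qed.

Lemma mean_dotc_kernel (rho : R) (F : C -> C) (L : C -> C) x y :
  (forall i, clim (rmean (fun w => faber_kernel W phi (d 0 i) (rho%:C * w) * F w)) (L (d 0 i))) ->
  clim (rmean (fun w => dotc x (K (rho%:C * w) *m y) * F w)) (dotc x (diag_fun X d L *m y)).
Proof.
move=> FL; rewrite [X in clim _ X](dotc_diag_fun X d L x y).
have := clim_sum (fun i => climM (FL i) (clim_cst (diag_weight X x y i))).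
apply: eq_clim => N; rewrite /rmean.
under eq_bigr do rewrite -mulrA mulr_suml mulr_sumr.
rewrite exchange_big /= mulr_sumr; apply: eq_bigr => l _.
rewrite [dotc x _](dotc_diag_fun X d _ x y) mulr_suml mulr_sumr; apply: eq_bigr => i _; ring.
Qed.

(** Makes the factor [rho ^+ j] disappear as [rho] tends to [1]. *)
Lemma expr1D_le (e : R) j : 0 <= e <= 1 -> (1 + e) ^+ j <= 1 + e * 3 ^+ j.
Proof.
move=> e01; have e0 : 0 <= e by case/andP: e01.
elim: j => [|j IH]; first by rewrite !expr0 mulr1 lerDl.
have p1 : 1 <= 3 ^+ j :> R by rewrite exprn_ege1// ler1n.
have : (1 + e) ^+ j * (1 + e) <= (1 + e * 3 ^+ j) * (1 + e).
  by rewrite ler_wpM2r// addr_ge0.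
rewrite !exprSr => /le_trans; apply.
have : e * 3 ^+ j * e <= e * 3 ^+ j.
  by apply: ler_piMr; [rewrite mulr_ge0// exprn_ge0|case/andP: e01].
have : e * 1 <= e * 3 ^+ j by rewrite ler_wpM2l.
by lra.
Qed.

(** Beckermann's bound.  By Caratheodory's argument the coefficients of an analytic
function with positive Hermitian part are at most twice its value at the
centre, here the identity. *)
Theorem faber_bound j (p : {poly C}) x y : nsq x = 1 -> nsq y = 1 ->
  (forall e : R, 0 < e -> exists M0 : R, forall z, M0 < normc z ->
     normc (phi z ^+ j - p.[z]) <= e) ->
  normc (dotc x (horner_mx M p *m y)) <= 2.
Proof.
move=> x1 y1 pj.
have main (rho : R) : 1 < rho -> normc (dotc x (horner_mx M p *m y)) <= 2 * rho ^+ j.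
  move=> rho1; have rho0 : 0 < rho by lra.
  have n1 x' : 1 < normc (rho%:C * cis x').
    by rewrite normcM normc_cis mulr1 normcR gtr0_norm.
  have pos u v : clim (rmean (fun w => dotc u (K (rho%:C * w) *m v) * (rho%:C * w) ^+ j))
      (dotc u (horner_mx M p *m v)).
    rewrite diag_fun_poly//; apply: mean_dotc_kernel => i.
    exact: (mean_faber_kernel_pos W_convex W_closed W_bounded phi_ext (dW i) rho1 pj).
  have cst u v : clim (rmean (fun w => dotc u (K (rho%:C * w) *m v))) (dotc u v).
    have := @mean_dotc_kernel rho (fun=> 1) (fun=> 1) u v.
    rewrite diag_fun_cst// mul1mx => H; apply: eq_clim (H _) => [N|i].
      by apply: eq_rmean => x'; rewrite mulr1.
    apply: eq_clim (mean_faber_kernel W_convex W_closed W_bounded phi_ext (dW i) rho1) => N.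
    by apply: eq_rmean => x'; rewrite mulr1.
  case: j pj pos => [|j] pj pos.
    (* for [j = 0] the generating function already has mean the identity *)
    have E : dotc x (horner_mx M p *m y) = dotc x y.
      apply: clim_unique (pos x y) _; apply: eq_clim (cst x y) => N.
      by apply: eq_rmean => x'; rewrite mulr1.
    by have := normc_dotc_le x y; rewrite E expr0 x1 y1; lra.
  have neg u v : clim (rmean (fun w => dotc u (K (rho%:C * w) *m v) * (rho%:C * w) ^- j.+1)) 0.
    have := @mean_dotc_kernel rho (fun w => (rho%:C * w) ^- j.+1) (fun=> 0) u v.
    rewrite diag_fun_cst// raddf0 mul0mx /dotc mulmx0 mxE; apply=> i.
    exact: (mean_faber_kernel_neg W_convex W_closed W_bounded phi_ext (dW i) j rho1).
  (* on the circle, [conjc w] is [rho ^+ 2 / w] *)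
  have conjE x' : conjc (rho%:C * cis x') ^+ j.+1 =
      (rho ^+ (2 * j.+1))%:C * (rho%:C * cis x') ^- j.+1.
    rewrite conjcM conjc_real -cisV -exprVn exprM rmorphXn /= -exprMn; congr (_ ^+ _).
    by rewrite rmorphXn /= invfM mulrA expr2 mulfK// -normc_gt0 normcR gtr0_norm.
  have conj_clim (s : nat -> C) l : clim s l -> clim (fun N => conjc (s N)) (conjc l).
    move=> sl e e0; have [N HN] := sl e e0; exists N => k /HN.
    by rewrite -rmorphB normcJ.
  have S_lim : clim (rmean (fun w => herm (rho%:C * w) x y * (rho%:C * w) ^+ j.+1))
      (dotc x (horner_mx M p *m y)).
    have h1 := pos x y.
    have h2 := climM (clim_cst (rho ^+ (2 * j.+1))%:C) (neg y x).
    have := climD h1 (conj_clim _ _ h2); rewrite mulr0 conjc0 addr0.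
    apply: eq_clim => N; rewrite -rmeanZ -rmeanJ -rmeanD; apply: eq_rmean => x'.
    by rewrite mulrCA -conjE [conjc (dotc _ _ * _)]conjcM conjcX conjcK /herm mulrDl.
  have T_lim : clim (rmean (fun w =>
      dotc x (K (rho%:C * w) *m x) + dotc y (K (rho%:C * w) *m y))) 2.
    have := climD (cst x x) (cst y y); rewrite !dotcc x1 y1.
    have -> : (1%:C + 1%:C : C) = 2 by rewrite rmorph1.
    by apply: eq_clim => N; rewrite -rmeanD.
  rewrite leNgt; apply/negP => big.
  have r0 : 0 < rho ^+ j.+1 by rewrite exprn_gt0.
  pose gap := normc (dotc x (horner_mx M p *m y)) - 2 * rho ^+ j.+1.
  have g0 : 0 < gap by rewrite subr_gt0.
  have e1 : 0 < gap / 2 by rewrite divr_gt0.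
  have e2 : 0 < gap / 2 / rho ^+ j.+1 by rewrite divr_gt0.
  have [N1 H1] := S_lim _ e1; have [N2 H2] := T_lim _ e2.
  pose N := maxn N1 N2.
  have {}H1 := H1 N (leq_maxl _ _); have {}H2 := H2 N (leq_maxr _ _).
  move: H1 H2; set S := rmean _ N; set T := rmean _ N => H1 H2.
  have ST : normc S <= rho ^+ j.+1 * complex.Re T.
    rewrite /S /T Re_rmean /rmean normcM normcV normc_nat mulrCA.
    rewrite ler_wpM2l ?invr_ge0// mulr_sumr (le_trans (normc_sum _ _ _))//.
    apply: ler_sum => i _; rewrite normcM normcX normcM normc_cis mulr1 normcR gtr0_norm//.
    rewrite mulrC; apply: ler_wpM2l; first exact: ltW.
    by rewrite ReD; exact: herm_le.
  have RT : complex.Re T < 2 + gap / 2 / rho ^+ j.+1.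
    have := le_lt_trans (Re_le_normc (T - 2)) H2; rewrite ReB /= => /(le_lt_trans (ler_norm _)).
    by rewrite ltrBlDl.
  have : rho ^+ j.+1 * complex.Re T < 2 * rho ^+ j.+1 + gap / 2.
    have -> : 2 * rho ^+ j.+1 + gap / 2 = rho ^+ j.+1 * (2 + gap / 2 / rho ^+ j.+1).
      by field; rewrite gt_eqF.
    by rewrite ltr_pM2l.
  have := lB_normcB (dotc x (horner_mx M p *m y)) (dotc x (horner_mx M p *m y) - S).
  have -> (a b : C) : a - (a - b) = b by ring.
  rewrite [normc (_ - S)]normcB /gap in H1 *; lra.
rewrite leNgt; apply/negP => big.
set D := normc _ in main big.
have t0 : 0 < 3 ^+ j :> R by rewrite exprn_gt0.
pose e := Num.min 1 ((D - 2) / 4 / 3 ^+ j).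
have e0 : 0 < e by rewrite lt_min ltr01 !divr_gt0// subr_gt0.
have e1 : e <= 1 by rewrite ge_min lexx.
have e2 : e * 3 ^+ j <= (D - 2) / 4 by rewrite -ler_pdivlMr// ge_min lexx orbT.
have := main (1 + e); rewrite ltrDl => /(_ e0).
have := @expr1D_le e j; rewrite (ltW e0) e1 => /(_ isT).
by lra.
Qed.

End FaberBound.

(** * Exponential generating functions *)

Section Egf.
Context {R : realType}.
Implicit Types (c : nat -> R) (x y t : R).

Definition egf_coef c j : R := c j / j`!%:R.

Definition egf c x : R := limn (pseries (egf_coef c) x).

Definition geo_bounded c := exists2 C : R, 0 <= C & exists2 B : R, 0 <= B &
  forall j, `|c j| <= C * B ^+ j.

Lemma geo_boundedS c : geo_bounded c -> geo_bounded (fun j => c j.+1).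
Proof.
move=> [C C0 [B B0 H]]; exists (C * B); first exact: mulr_ge0.
by exists B => // j; rewrite -mulrA -exprS.
Qed.

Lemma egf_cvg c x : geo_bounded c -> pseries (egf_coef c) x @ \oo --> egf c x.
Proof.
move=> [C C0 [B B0 H]]; apply: normed_cvg.
apply: (@series_le_cvg _ _ (fun j => C * exp_coeff (B * `|x|) j)).
- by move=> j /=.
- move=> j; rewrite mulr_ge0// /exp_coeff /= divr_ge0// exprn_ge0// mulr_ge0//.
- move=> j; rewrite /egf_coef /exp_coeff /= !normrM normrX normfV normr_nat exprMn.
  rewrite !mulrA [leRHS]mulrAC; apply: ler_wpM2r; first exact: exprn_ge0.
  by rewrite ler_wpM2r// invr_ge0.
have -> : (fun j => C * exp_coeff (B * `|x|) j) = C \*: exp_coeff (B * `|x|) by [].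
by apply: is_cvg_seriesZ; exact: is_cvg_series_exp_coeff.
Qed.

(** Differentiation shifts the coefficients, so that linear recurrences become
linear differential equations. *)
Lemma egf_is_derive c x : geo_bounded c ->
  is_derive x 1 (egf c) (egf (fun j => c j.+1) x).
Proof.
move=> cb; have diffsE c' : pseries_diffs (egf_coef c') = egf_coef (fun j => c' j.+1).
  apply/funext => j; rewrite /pseries_diffs /egf_coef factS natrM invfM.
  by rewrite mulrCA mulrA mulrA mulfK// mulrC.
rewrite /egf -diffsE; apply: (@pseries_snd_diffs _ _ (`|x| + 1)).
- by apply: cvgP; exact: egf_cvg.
- by rewrite diffsE; apply: cvgP; apply: egf_cvg; exact: geo_boundedS.
- rewrite !diffsE; apply: cvgP; apply: egf_cvg.
  exact: (geo_boundedS (geo_boundedS cb)).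
- by rewrite [ltRHS]ger0_norm// ltrDl.
Qed.

Lemma egfE c x l : pseries (egf_coef c) x @ \oo --> l -> egf c x = l.
Proof. by move=> /cvg_lim; exact. Qed.

Lemma egf_lin2 c1 c2 x (a b : R) : geo_bounded c1 -> geo_bounded c2 ->
  egf (fun j => a * c1 j + b * c2 j) x = a * egf c1 x + b * egf c2 x.
Proof.
move=> h1 h2; apply: egfE.
have -> : pseries (egf_coef (fun j => a * c1 j + b * c2 j)) x =
    (fun N => a * pseries (egf_coef c1) x N + b * pseries (egf_coef c2) x N).
  apply/funext => N; rewrite /pseries /series /= !mulr_sumr -big_split /=.
  by apply: eq_bigr => j _; rewrite /egf_coef; ring.
by apply: cvgD; apply: cvgMr; exact: egf_cvg.
Qed.

Lemma egf0 c : egf c 0 = c 0%N.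
Proof.
apply: egfE; apply: cvg_near_cst; near=> N.
have -> : N = N.-1.+1 by rewrite prednK//; near: N; exact: nbhs_infty_gt.
rewrite /pseries /series /= big_nat_recl// big1 ?addr0.
  by rewrite /egf_coef fact0 divr1 expr0 mulr1.
by move=> j _; rewrite expr0n /= mulr0.
Unshelve. all: by end_near. Qed.

Lemma geo_bounded_ReX (z : R[i]) : geo_bounded (fun j => complex.Re (z ^+ j)).
Proof.
exists 1 => //; exists (normc z); first exact: normc_ge0.
by move=> j; rewrite mul1r -normcX Re_le_normc.
Qed.

Lemma geo_bounded_ImX (z : R[i]) : geo_bounded (fun j => complex.Im (z ^+ j)).
Proof.
exists 1 => //; exists (normc z); first exact: normc_ge0.
by move=> j; rewrite mul1r -normcX Im_le_normc.
Qed.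

(** Along a ray, [cexp] and the exponential series satisfy the same linear
differential equation. *)
Lemma egf_ReX_ImX (x y : R) :
  egf (fun j => complex.Re ((x +i* y) ^+ j)) 1 = expR x * cos y /\
  egf (fun j => complex.Im ((x +i* y) ^+ j)) 1 = expR x * sin y.
Proof.
set z := x +i* y; pose a := egf (fun j => complex.Re (z ^+ j)).
pose b := egf (fun j => complex.Im (z ^+ j)).
have aD (s : R) : is_derive s 1 a (x * a s - y * b s).
  have := egf_is_derive s (geo_bounded_ReX z).
  rewrite /a /b -mulNr -egf_lin2; [|exact: geo_bounded_ReX|exact: geo_bounded_ImX].
  congr (is_derive _ _ _ (egf _ _)); apply/funext => j.
  by rewrite exprS; case: (z ^+ j) => p q; rewrite /z /=; ring.
have bD (s : R) : is_derive s 1 b (y * a s + x * b s).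
  have := egf_is_derive s (geo_bounded_ImX z).
  rewrite /a /b -egf_lin2; [|exact: geo_bounded_ReX|exact: geo_bounded_ImX].
  congr (is_derive _ _ _ (egf _ _)); apply/funext => j.
  by rewrite exprS; case: (z ^+ j) => p q; rewrite /z /=; ring.
have eD (s : R) : is_derive s 1 (fun s => expR (- x * s)) (expR (- x * s) * (- x)).
  by apply: is_derive_eq; rewrite /GRing.scale /=; ring.
have cD (s : R) : is_derive s 1 (fun s => cos (y * s)) (- y * sin (y * s)).
  by apply: is_derive_eq; rewrite /GRing.scale /=; ring.
have sD (s : R) : is_derive s 1 (fun s => sin (y * s)) (y * cos (y * s)).
  by apply: is_derive_eq; rewrite /GRing.scale /=; ring.
(* the real and imaginary parts of [exp (- z s) (a s + i b s)] are constant *)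
have uD (s : R) : is_derive s 1
    (fun s => expR (- x * s) * (a s * cos (y * s) + b s * sin (y * s))) 0.
  by apply: is_derive_eq; rewrite /GRing.scale /=; ring.
have vD (s : R) : is_derive s 1
    (fun s => expR (- x * s) * (b s * cos (y * s) - a s * sin (y * s))) 0.
  by apply: is_derive_eq; rewrite /GRing.scale /=; ring.
have a0 : a 0 = 1 by rewrite /a egf0 expr0.
have b0 : b 0 = 0 by rewrite /b egf0 expr0.
have := is_derive_0_is_cst 1 0 uD; have := is_derive_0_is_cst 1 0 vD.
rewrite a0 b0 !mulr0 cos0 sin0 expR0 !mulr1 !mulr0 !mul1r subrr addr0 expRN => vE uE.
have e0 : expR x != 0 by rewrite gt_eqF// expR_gt0.
have cs := cos2Dsin2 y.
have uE' : a 1 * cos y + b 1 * sin y = expR x.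
  by apply: (mulfI (invr_neq0 e0)); rewrite uE mulVf.
have vE' : b 1 * cos y - a 1 * sin y = 0.
  by apply: (mulfI (invr_neq0 e0)); rewrite vE mulr0.
split.
  transitivity ((a 1 * cos y + b 1 * sin y) * cos y - (b 1 * cos y - a 1 * sin y) * sin y).
    by rewrite -[LHS]mulr1 -cs /a; ring.
  by rewrite uE' vE'; ring.
transitivity ((a 1 * cos y + b 1 * sin y) * sin y + (b 1 * cos y - a 1 * sin y) * cos y).
  by rewrite -[LHS]mulr1 -cs /b; ring.
by rewrite uE' vE'; ring.
Qed.

Lemma clim_ReIm (u : nat -> R[i]) (l : R[i]) :
  (fun n => complex.Re (u n)) @ \oo --> complex.Re l ->
  (fun n => complex.Im (u n)) @ \oo --> complex.Im l -> clim u l.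
Proof.
move=> /cvgrPdist_lt H1 /cvgrPdist_lt H2 e e0.
have e2 : 0 < e / 2 by rewrite divr_gt0.
have [N _ HN] := H1 _ e2; have [M _ HM] := H2 _ e2.
exists (maxn N M) => n; rewrite geq_max => /andP[/HN h1 /HM h2].
rewrite (le_lt_trans (normc_le_ReIm _))//.
have -> : complex.Im (u n - l) = complex.Im (u n) - complex.Im l.
  by case: (u n) (l) => p q [].
rewrite ReB distrC [`|complex.Im _ - _|]distrC.
by move: h1 h2 => /=; lra.
Qed.

Lemma cexp_series (z : R[i]) : clim (fun N => \sum_(j < N) z ^+ j / j`!%:R) (cexp z).
Proof.
have Re_f (w : R[i]) j : complex.Re (w / j`!%:R) = complex.Re w / j`!%:R.
  by rewrite -(rmorph_nat (real_complex R)) -fmorphV mulrC Re_mulR mulrC.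
have Im_f (w : R[i]) j : complex.Im (w / j`!%:R) = complex.Im w / j`!%:R.
  rewrite -(rmorph_nat (real_complex R)) -fmorphV mulrC.
  by case: w => p q /=; rewrite mul0r addr0 mulrC.
case: z => x y; have [EX EY] := egf_ReX_ImX x y.
have HX := @egf_cvg _ 1 (geo_bounded_ReX (x +i* y)).
have HY := @egf_cvg _ 1 (geo_bounded_ImX (x +i* y)).
have psE (p : R[i] -> R) N : (forall w j, p (w / j`!%:R) = p w / j`!%:R) ->
    (forall w w', p (w + w') = p w + p w') -> p 0 = 0 ->
    p (\sum_(j < N) (x +i* y) ^+ j / j`!%:R) =
    pseries (egf_coef (fun j => p ((x +i* y) ^+ j))) 1 N.
  move=> pf pD p0; rewrite /pseries /series /= big_mkord.
  rewrite (big_morph p pD p0); apply: eq_bigr => j _.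
  by rewrite pf expr1n mulr1.
apply: clim_ReIm.
  have -> : complex.Re (cexp (x +i* y)) = expR x * cos y.
    by rewrite /cexp Re_mulR.
  rewrite -EX; apply: cvg_trans HX; apply: near_eq_cvg; apply: nearW => N.
  by rewrite -(psE (@complex.Re R))//; exact: ReD.
have -> : complex.Im (cexp (x +i* y)) = expR x * sin y.
  by rewrite /cexp /= mul0r addr0.
rewrite -EY; apply: cvg_trans HY; apply: near_eq_cvg; apply: nearW => N.
by rewrite -(psE (@complex.Im R))//; case=> p q [].
Qed.

Lemma phi1_series (z : R[i]) : clim (fun N => \sum_(j < N) z ^+ j / (j.+1)`!%:R) (phi1 z).
Proof.
rewrite /phi1; case: eqVneq => [->|z0].
  move=> e e0; exists 1%N => -[//|N] _; rewrite big_ord_recl big1 => [|j _].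
    by rewrite expr0 factS fact0 divr1 addr0 subrr normc0.
  by rewrite expr0n /= mul0r.
have H : clim (fun N => \sum_(j < N.+1) z ^+ j / j`!%:R) (cexp z).
  move=> e e0; have [N HN] := cexp_series z e0; exists N => n Nn.
  by apply: HN; exact: leqW.
have := climM (climB H (clim_cst 1)) (clim_cst z^-1).
apply: eq_clim => N; rewrite big_ord_recl expr0 fact0 divr1 addrC addKr mulr_suml.
by apply: eq_bigr => j _; rewrite /bump /= exprSr mulrAC mulfK.
Qed.

Lemma tphi1_series (t : R) (lam : R[i]) :
  clim (fun N => \sum_(i < N) (t * (- t) ^+ i / (i.+1)`!%:R)%:C * lam ^+ i)
       (t%:C * phi1 (- t%:C * lam)).
Proof.
have := climZ t%:C (phi1_series (- t%:C * lam)); apply: eq_clim => N.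
rewrite mulr_sumr; apply: eq_bigr => i _.
rewrite exprMn !rmorphM fmorphV rmorph_nat rmorphXn rmorphN /=; ring.
Qed.

End Egf.

(** * Exponentials of matrices *)

Section MatrixExponential.
Context {R : realType}.

Lemma geo_bounded_mx k (H : 'M[R]_k) r c : geo_bounded (fun j => (H ^+ j) r c).
Proof.
pose B := \sum_i \sum_j `|H i j|.
have HB i j : `|H i j| <= B.
  rewrite /B (bigD1 i)//= (bigD1 j)//= -addrA lerDl addr_ge0// sumr_ge0// => l _.
  exact: sumr_ge0.
have B0 : 0 <= B by apply: sumr_ge0 => i _; exact: sumr_ge0.
exists 1 => //; exists (k%:R * B); first by rewrite mulr_ge0.
move=> j; elim: j r c => [|j IH] r c; rewrite mul1r.
  by rewrite expr0 expr0 mxE; case: eqP => _; rewrite ?normr1 ?normr0.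
rewrite exprS mxE (le_trans (ler_norm_sum _ _ _))//.
apply: (@le_trans _ _ (\sum_(l < k) B * (k%:R * B) ^+ j)).
  apply: ler_sum => l _; rewrite normrM ler_pM//.
  by have := IH l c; rewrite mul1r.
by rewrite sumr_const card_ord -[(B * _) *+ _]mulr_natl mulrA exprS.
Qed.

(** [tphi_mx H t] is [t phi1 (- t H)] and [exp_mx H t] is [exp (- t H)], entry by
entry as power series in [t]: the coefficients of the former are those of the
latter, shifted. *)
Definition phi_coef k (H : 'M[R]_k) r c j : R := if j is j'.+1 then ((- H) ^+ j') r c else 0.

Definition tphi_mx k (H : 'M[R]_k) (t : R) : 'M[R]_k :=
  \matrix_(r, c) egf (phi_coef H r c) t.

Definition exp_mx k (H : 'M[R]_k) (t : R) : 'M[R]_k :=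
  \matrix_(r, c) egf (fun j => ((- H) ^+ j) r c) t.

Variables (k : nat) (H : 'M[R]_k).

Lemma phi_coef_bounded r c : geo_bounded (phi_coef H r c).
Proof.
have [C C0 [B B0 CB]] := geo_bounded_mx (- H) r c.
exists C => //; exists (1 + B); first exact: addr_ge0.
case=> [|j] /=; first by rewrite normr0 mulr_ge0// exprn_ge0// addr_ge0.
rewrite (le_trans (CB j))// ler_wpM2l// exprS.
have h1 : B ^+ j <= (1 + B) ^+ j by rewrite lerXn2r// ?nnegrE ?addr_ge0// lerDr.
have h2 : 0 <= (1 + B) ^+ j by rewrite exprn_ge0// addr_ge0.
by rewrite (le_trans h1)// ler_peMl// lerDl.
Qed.

Lemma tphi_mx_is_derive (t : R) (r c : 'I_k) :
  is_derive t 1 (fun t : R => tphi_mx H t r c) (exp_mx H t r c).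
Proof.
rewrite mxE; under eq_fun do rewrite mxE.
exact: egf_is_derive (phi_coef_bounded r c).
Qed.

(** Both sides have the same coefficients as power series in [t]. *)
Lemma exp_mxE (t : R) : exp_mx H t = 1%:M - H *m tphi_mx H t.
Proof.
apply/matrixP => r c; rewrite !mxE.
under [X in _ - X]eq_bigr do rewrite mxE.
apply: egfE.
have -> : pseries (egf_coef (fun j => ((- H) ^+ j) r c)) t =
    (fun N => pseries (egf_coef (fun j => if j is 0 then (r == c)%:R else 0 : R)) t N
      - \sum_j H r j * pseries (egf_coef (phi_coef H j c)) t N).
  apply/funext => N; rewrite /pseries /series /=.
  under [X in _ - X]eq_bigr do rewrite mulr_sumr.
  rewrite exchange_big /= -sumrB; apply: eq_bigr => -[|j] _; rewrite /egf_coef.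
    rewrite expr0 mxE big1 ?subr0// => i _; by rewrite /= mul0r mul0r mulr0.
  rewrite mul0r mul0r sub0r exprS mxE mulr_suml mulr_suml -sumrN.
  by apply: eq_bigr => i _; rewrite !mxE /=; ring.
apply: cvgB.
  have gb : geo_bounded (fun j => if j is 0 then (r == c)%:R else 0 : R).
    exists 1 => //; exists 1 => // -[|j]; rewrite expr1n mulr1 ?normr0//.
    by rewrite normr_nat; case: eqP.
  have E : egf (fun j => if j is 0 then (r == c)%:R else 0 : R) t = (r == c)%:R.
    apply: egfE; apply: cvg_near_cst; near=> N.
    have -> : N = N.-1.+1 by rewrite prednK//; near: N; exact: nbhs_infty_gt.
    rewrite /pseries /series /= big_nat_recl// big1 ?addr0.
      by rewrite /egf_coef fact0 divr1 expr0 mulr1.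
    by move=> j _; rewrite /egf_coef !mul0r.
  by rewrite -[X in _ --> X]E; exact: egf_cvg.
have sum_cvg (I : Type) (s : seq I) (F : I -> nat -> R) (L : I -> R) :
    (forall i, F i @ \oo --> L i) ->
    (fun N => \sum_(i <- s) F i N) @ \oo --> \sum_(i <- s) L i.
  move=> FL; elim: s => [|i s IH].
    by under eq_fun do rewrite big_nil; rewrite big_nil; exact: cvg_cst.
  by under eq_fun do rewrite big_cons; rewrite big_cons; exact: cvgD.
apply: sum_cvg => j; apply: cvgMr.
exact: egf_cvg (phi_coef_bounded j c).
Unshelve. all: by end_near. Qed.

End MatrixExponential.

(** * The residual of the Krylov approximation *)

Section Residual.
Context {R : realType}.

Lemma mx_cvg m n (M : nat -> 'M[R]_(m, n)) (L : 'M[R]_(m, n)) :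
  (forall r c, (fun N => M N r c) @ \oo --> L r c) -> M @ \oo --> L.
Proof.
move=> ML; apply/cvg_ballP => e e0; near=> N; split => //.
near: N; apply: filter_forall => r; apply: filter_forall => c.
by move/cvg_ballP : (ML r c); apply.
Unshelve. all: by end_near. Qed.

Lemma exp_scalemx k (t : R) (M : 'M[R]_k) j : (t *: M) ^+ j = t ^+ j *: M ^+ j.
Proof.
elim: j => [|j IH]; first by rewrite !expr0 scale1r.
by rewrite !exprS IH -[LHS]scalemxAl -scalemxAr scalerA.
Qed.

Lemma phi1_mxE k (H : 'M[R]_k) (t : R) :
  t *: phi1_mx (- t *: H) = tphi_mx H t.
Proof.
have [->|t0] := eqVneq t 0.
  by rewrite scale0r; apply/matrixP => r c; rewrite !mxE egf0.
have -> : phi1_mx (- t *: H) = t^-1 *: tphi_mx H t.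
  apply: cvg_lim => //; apply: mx_cvg => r c; rewrite !mxE.
  have H1 := @egf_cvg _ _ t (phi_coef_bounded H r c).
  have -> : (fun N => series (fun j => (j.+1)`!%:R^-1 *: (- t *: H) ^+ j) N r c) =
      (fun N => t^-1 * pseries (egf_coef (phi_coef H r c)) t N.+1).
    apply/funext => N; rewrite /pseries /series /= big_nat_recl// summxE mulrDr.
    rewrite {1}/egf_coef !mul0r mulr0 add0r mulr_sumr; apply: eq_bigr => j _.
    rewrite scaleNr -scalerN exp_scalemx !mxE /egf_coef /= exprSr.
    by field; rewrite pnatr_eq0 -lt0n fact_gt0 t0.
  by apply: cvgMr; rewrite (cvg_shiftS (pseries (egf_coef (phi_coef H r c)) t)).
by rewrite scalerA divff// scale1r.
Qed.

Lemma is_derive_krylov n k (V : 'M[R]_(n, k)) (H : 'M[R]_k) (e : 'cV[R]_k) (t : R) :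
  derive1 (fun s => V *m (tphi_mx H s *m e)) t = V *m (exp_mx H t *m e).
Proof.
have D i j : is_derive t 1 (fun s : R => (V *m (tphi_mx H s *m e)) i j)
    ((V *m (exp_mx H t *m e)) i j).
  have -> : (fun s : R => (V *m (tphi_mx H s *m e)) i j) =
      \sum_(p < k) \sum_(q < k) (fun s => (V i p * e q j) * tphi_mx H s p q).
    apply/funext => s; rewrite mxE fct_sumE; apply: eq_bigr => p _.
    by rewrite mxE mulr_sumr fct_sumE; apply: eq_bigr => q _; ring.
  have -> : (V *m (exp_mx H t *m e)) i j =
      \sum_(p < k) \sum_(q < k) (V i p * e q j) * exp_mx H t p q.
    rewrite mxE; apply: eq_bigr => p _.
    by rewrite mxE mulr_sumr; apply: eq_bigr => q _; ring.
  apply: is_derive_sum => p; apply: is_derive_sum => q.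
  have T := tphi_mx_is_derive H t p q.
  by apply: (is_deriveZ (V i p * e q j)).
have dv : derivable (fun s => V *m (tphi_mx H s *m e)) t 1.
  by apply/derivable_mxP => i j; case: (D i j).
rewrite derive1E derive_mx//; apply/matrixP => i j; rewrite mxE.
by case: (D i j).
Qed.

(** All of the Krylov approximation cancels in the residual except for the
component that the Arnoldi relation leaves outside the Krylov space. *)
Lemma residualE n k (A : 'M[R]_n) (g : 'cV[R]_n) (V : 'M[R]_(n, k)) (v : 'cV[R]_n)
    (H : 'M[R]_k) (h t : R) : arnoldi A g V v H h -> vnorm2 g = 1 ->
  residual A g (krylov_approx V H) t =
  - (h * ((e_last R k)^T *m (tphi_mx H t *m e_first R k)) 0 0) *: v.
Proof.
move=> harn g1.
have yE : krylov_approx V H = fun s => V *m (tphi_mx H s *m e_first R k).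
  by apply/funext => s; rewrite /krylov_approx scalemxAl phi1_mxE.
rewrite /residual yE is_derive_krylov exp_mxE !mulmxBl !mul1mx.
set e := e_first R k; pose F := tphi_mx H t *m e.
have -> : H *m tphi_mx H t *m e = H *m F by rewrite -mulmxA.
rewrite -/F mulmxBr (arnoldi_start harn) g1 invr1 scale1r mulmxA.
rewrite (arnoldi_relation harn) mul_row_col mulmxDl -mulmxA.
have -> : v *m (h *: (e_last R k)^T) *m F = (h * ((e_last R k)^T *m F) 0 0) *: v.
  rewrite -mulmxA -scalemxAl -scalemxAr -scalerA; congr (_ *: _).
  by rewrite {1}[_ *m F]mx11_scalar mul_mx_scalar.
set a := V *m (H *m F); rewrite scaleNr; set b := _ *: v.
by rewrite opprD opprB -addrA [g + _]addrC subrK addrAC addNr add0r.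
Qed.

End Residual.

(** * Norms *)

Section Norms.
Context {R : realType}.

Lemma vnorm2_ge0 n (x : 'cV[R]_n) : 0 <= vnorm2 x.
Proof. exact: sqrtr_ge0. Qed.

Lemma sum_sqr_ge0 n (x : 'cV[R]_n) : 0 <= \sum_i x i 0 ^+ 2.
Proof. by apply: sumr_ge0 => i _; exact: sqr_ge0. Qed.

Lemma vnorm2_sqr n (x : 'cV[R]_n) : vnorm2 x ^+ 2 = (x^T *m x) 0 0.
Proof.
rewrite sqr_sqrtr ?sum_sqr_ge0// mxE.
by apply: eq_bigr => i _; rewrite mxE expr2.
Qed.

Lemma vnorm2Z n (a : R) (x : 'cV[R]_n) : vnorm2 (a *: x) = `|a| * vnorm2 x.
Proof.
rewrite /vnorm2; have -> : \sum_i (a *: x) i 0 ^+ 2 = a ^+ 2 * \sum_i x i 0 ^+ 2.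
  by rewrite mulr_sumr; apply: eq_bigr => i _; rewrite mxE exprMn.
by rewrite sqrtrM ?sqr_ge0// sqrtr_sqr.
Qed.

Lemma vnorm2_0 n : vnorm2 (0 : 'cV[R]_n) = 0.
Proof. by rewrite -(scale0r 0) vnorm2Z normr0 mul0r. Qed.

Lemma le_coord_vnorm2 n (x : 'cV[R]_n) i : `|x i 0| <= vnorm2 x.
Proof.
rewrite -sqrtr_sqr ler_sqrt ?sum_sqr_ge0// (bigD1 i)//= lerDl.
by apply: sumr_ge0 => j _; exact: sqr_ge0.
Qed.

Lemma le_mxnorm2 m n (A : 'M[R]_(m, n)) x : vnorm2 x <= 1 ->
  vnorm2 (A *m x) <= mxnorm2 A.
Proof.
move=> x1; apply: ub_le_sup; last by exists x.
exists (Num.sqrt (\sum_i (\sum_j `|A i j|) ^+ 2)) => _ [y /= y1 <-].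
rewrite ler_sqrt; last by apply: sumr_ge0 => i _; exact: sqr_ge0.
apply: ler_sum => i _; rewrite -real_normK ?num_real// lerXn2r ?nnegrE//.
  exact: sumr_ge0.
rewrite mxE (le_trans (ler_norm_sum _ _ _))//; apply: ler_sum => j _.
by rewrite normrM ler_piMr// (le_trans (le_coord_vnorm2 y j)).
Qed.

Lemma mxnorm2_ge0 m n (A : 'M[R]_(m, n)) : 0 <= mxnorm2 A.
Proof.
rewrite -(vnorm2_0 m) -(mulmx0 1 A); apply: le_mxnorm2.
by rewrite vnorm2_0.
Qed.

Section ArnoldiNorms.
Variables (n m : nat) (A : 'M[R]_n) (g : 'cV[R]_n) (V : 'M[R]_(n, m.+1)).
Variables (v : 'cV[R]_n) (H : 'M[R]_m.+1) (h : R).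
Hypothesis harn : arnoldi A g V v H h.

Let e := e_last R m.+1.

Lemma e_lastE : e = delta_mx ord_max 0.
Proof.
by apply/matrixP => i j; rewrite !mxE ord1 eqxx andbT.
Qed.

Lemma e_firstE : e_first R m.+1 = delta_mx ord0 0.
Proof. by apply/matrixP => i j; rewrite !mxE ord1 eqxx andbT. Qed.

Lemma next_orthonormal : h != 0 -> v^T *m v = 1%:M /\ v^T *m V = 0.
Proof.
move=> /(arnoldi_orthonormal_next harn).
rewrite tr_row_mx mul_col_row scalar_mx_block => E.
have [_ _ E3 E4] := eq_block_mx E.
by split; rewrite ?E4 ?E3.
Qed.

Lemma vnorm2_residual t : vnorm2 g = 1 ->
  vnorm2 (residual A g (krylov_approx V H) t) = h * `|tphi_mx H t ord_max ord0|.
Proof.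
move=> g1; rewrite (residualE t harn g1) vnorm2Z normrN normrM.
rewrite (ger0_norm (arnoldi_subdiag harn)).
have -> : ((e_last R m.+1)^T *m (tphi_mx H t *m e_first R m.+1)) 0 0 =
    tphi_mx H t ord_max ord0.
  by rewrite -/e e_lastE e_firstE trmx_delta -colE -rowE !mxE.
have [->|h0] := eqVneq h 0; first by rewrite !mul0r.
have [vv _] := next_orthonormal h0.
have v1 : vnorm2 v ^+ 2 = 1 by rewrite vnorm2_sqr vv mxE.
have /eqP := v1; rewrite sqrf_eq1 => /orP[/eqP->|/eqP vN]; first by rewrite mulr1.
by have := vnorm2_ge0 v; rewrite vN; lra.
Qed.

(** [h] is the component of [A V e_k] along the unit vector [v]. *)
Lemma subdiag_le : h <= mxnorm2 A.
Proof.
have [->|h0] := eqVneq h 0; first exact: mxnorm2_ge0.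
have [vv vV] := next_orthonormal h0.
pose w := A *m (V *m e).
have ev : vnorm2 (V *m e) ^+ 2 = 1.
  rewrite vnorm2_sqr trmx_mul mulmxA -[_ *m V^T *m V]mulmxA.
  by rewrite (arnoldi_orthonormal harn) mulmx1 e_lastE trmx_delta mul_delta_mx mxE !eqxx.
have vw : (v^T *m w) = h%:M.
  have -> : w = V *m (H *m e) + h *: v.
    rewrite /w mulmxA (arnoldi_relation harn) mul_row_col mulmxDl -mulmxA; congr (_ + _).
    rewrite -mulmxA -scalemxAl -scalemxAr; congr (_ *: _).
    by rewrite -/e e_lastE trmx_delta mul_delta_mx [delta_mx _ _]mx11_scalar mxE mulmx1.
  by rewrite mulmxDr mulmxA vV mul0mx add0r -scalemxAr vv scalemx1.
have e1 : vnorm2 (V *m e) <= 1.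
  by rewrite -(@ler_pXn2r _ 2)// ?nnegrE ?vnorm2_ge0// ev expr1n.
apply: le_trans (le_mxnorm2 A e1); rewrite -/w.
rewrite -(@ler_pXn2r _ 2)// ?nnegrE ?vnorm2_ge0// ?(arnoldi_subdiag harn)//.
have := sqr_ge0 (vnorm2 (w - h *: v)); rewrite !vnorm2_sqr.
have wv : w^T *m v = h%:M by rewrite -[LHS]trmxK trmx_mul trmxK vw tr_scalar_mx.
have -> : (w - h *: v)^T = w^T - h *: v^T by apply/matrixP => i j; rewrite !mxE.
rewrite mulmxBl !mulmxBr -!scalemxAl -!scalemxAr vw wv vv.
rewrite !mxE !eqxx !mulr1n; lra.
Qed.

End ArnoldiNorms.
End Norms.

(** * Growth of the Faber polynomials *)

Section Growth.
Context {R : realType}.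
Local Notation C := R[i].

Lemma geometric_tail_le (x : R) N : 0 <= x <= 1 / 2 ->
  \sum_(m < N) x ^+ m.+1 <= 2 * x.
Proof.
move=> /andP[x0 x2].
suff : \sum_(m < N) x ^+ m.+1 + 2 * x ^+ N.+1 <= 2 * x.
  by have := exprn_ge0 N.+1 x0; lra.
elim: N => [|N IH]; first by rewrite big_ord0 add0r expr1.
rewrite big_ord_recr /=; apply: le_trans IH.
have : x ^+ N.+1 * x <= x ^+ N.+1 * (1 / 2) by rewrite ler_wpM2l// exprn_ge0.
by rewrite [x ^+ N.+2]exprSr; lra.
Qed.

Lemma series_terms_bounded (u : nat -> C) (l : C) :
  series (u : nat -> C^o) @ \oo --> (l : C^o) -> exists B : R, forall m, normc (u m) <= B.
Proof.
move=> /climP ul; have [N HN] := ul 1 ltr01.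
exists (2 + \sum_(i < N) normc (u i)) => m.
have S0 : 0 <= \sum_(i < N) normc (u i) by apply: sumr_ge0 => i _; exact: normc_ge0.
have [mN|Nm] := ltnP m N.
  rewrite (bigD1 (Ordinal mN))//= addrCA lerDl addr_ge0//.
  by apply: sumr_ge0 => i _; exact: normc_ge0.
have := HN m.+1 (leqW Nm); have := HN m Nm.
rewrite -[u m](seriesSB u) => h1 h2.
have -> : series u m.+1 - series u m = (series u m.+1 - l) - (series u m - l) by ring.
have := le_normcB (series u m.+1 - l) (series u m - l).
move: S0 h1 h2; lra.
Qed.

(** Convergence of the expansion at a single point bounds its coefficients
geometrically, and then the expansion is of order [1 / z]. *)
Lemma polynomial_part_infty (F : C -> C) p : polynomial_part F p ->
  forall e : R, 0 < e -> exists M0 : R, forall z, M0 < normc z -> normc (F z - p.[z]) <= e.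
Proof.
move=> [b [M _ HM]] e e0.
pose r := Num.max M 0 + 1.
have r0 : 0 < r by rewrite ltr_pwDr// le_max lexx orbT.
have rM : M < r by rewrite ltr_pwDr// le_max lexx.
have nr : normc (r%:C : C) = r by rewrite normcR gtr0_norm.
have [B HB] : exists B : R, forall m, normc (b m * r%:C ^- m.+1) <= B.
  have hr : M < normc (r%:C : C) by rewrite nr.
  exact: series_terms_bounded (HM r%:C hr).
have B0 : 0 <= B by apply: le_trans (HB 0%N); exact: normc_ge0.
exists (2 * r + M + `|M| + 2 * B * r / e) => z hz.
have Be : 0 <= 2 * B * r / e by apply: divr_ge0; [apply: mulr_ge0; [lra|exact: ltW]|exact: ltW].
have MM : 0 <= M + `|M| by have := ler_norm (- M); rewrite normrN; lra.
have z2 : 2 * r < normc z by lra.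
have zM : M < normc z by rewrite (lt_trans rM)//; lra.
have zB : 2 * B * r / e < normc z by lra.
have z0 : 0 < normc z by lra.
have {}HM : series (fun m => b m * z ^- m.+1 : C^o) @ \oo --> (F z - p.[z] : C^o) by exact: HM.
move/climP : HM => /clim_le; apply; exists 0%N => N _.
pose x := r / normc z.
have x01 : 0 <= x <= 1 / 2.
  rewrite /x divr_ge0 ?normc_ge0 ?(ltW r0)//= ler_pdivrMr//; lra.
apply: (@le_trans _ _ (B * \sum_(m < N) x ^+ m.+1)).
  rewrite /series /= big_mkord (le_trans (normc_sum _ _ _))// mulr_sumr.
  apply: ler_sum => m _.
  have -> : b m * z ^- m.+1 = b m * r%:C ^- m.+1 * (r%:C / z) ^+ m.+1.
    rewrite exprMn exprVn mulrA mulfVK// expf_neq0//.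
    by rewrite -normc_gt0 nr.
  by rewrite normcM normcX [normc (r%:C / z)]normc_f nr ler_wpM2r// exprn_ge0//; case/andP: x01.
apply: (@le_trans _ _ (B * (2 * x))); first by rewrite ler_wpM2l// geometric_tail_le.
have -> : B * (2 * x) = 2 * B * r / normc z by rewrite /x; ring.
by rewrite ler_pdivrMr// ltW// [e * _]mulrC -ltr_pdivrMr.
Qed.

Lemma size_poly_growth (p : {poly C}) j (K M : R) :
  (forall z, M < normc z -> normc p.[z] <= K * normc z ^+ j) -> (size p <= j.+1)%N.
Proof.
move=> pK; rewrite leqNgt; apply/negP => js.
have [d sd] : exists d, size p = d.+2 by exists (size p).-2; case: (size p) js => [|[]].
have jd : (j <= d)%N by move: js; rewrite sd.
have a0 : 0 < normc p`_d.+1.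
  by rewrite normc_gt0; have := lead_coef_eq0 p; rewrite lead_coefE sd /= -size_poly_eq0 sd => ->.
pose S := \sum_(i < d.+1) normc p`_i.
have S0 : 0 <= S by apply: sumr_ge0 => i _; exact: normc_ge0.
pose x := 1 + `|M| + (S + `|K|) / normc p`_d.+1.
have q0 : 0 <= (S + `|K|) / normc p`_d.+1 by rewrite divr_ge0 ?normc_ge0 ?addr_ge0.
have x1 : 1 <= x by rewrite /x -addrA lerDl addr_ge0.
have x0 : 0 < x by lra.
have xM : M < x by rewrite /x; move: (ler_norm M) q0; lra.
have xS : S + `|K| < normc p`_d.+1 * x.
  rewrite mulrC -ltr_pdivrMr// /x; move: (normr_ge0 M); lra.
have nx : normc (x%:C : C) = x by rewrite normcR gtr0_norm.
have := pK x%:C; rewrite nx => /(_ xM).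
rewrite horner_coef sd big_ord_recr /= => H1.
have := lB_normcD (p`_d.+1 * x%:C ^+ d.+1) (\sum_(i < d.+1) p`_i * x%:C ^+ i).
rewrite [_ + \sum_(i < d.+1) _]addrC normcM normcX nx => H2.
have H3 : normc (\sum_(i < d.+1) p`_i * x%:C ^+ i) <= S * x ^+ d.
  rewrite mulr_suml (le_trans (normc_sum _ _ _))//; apply: ler_sum => i _.
  rewrite normcM normcX nx ler_wpM2l ?normc_ge0// ler_weXn2l//.
  by rewrite -ltnS.
have H4 : K * x ^+ j <= `|K| * x ^+ d.
  apply: (@le_trans _ _ (`|K| * x ^+ j)).
    by rewrite ler_wpM2r ?ler_norm// exprn_ge0// ltW.
  by rewrite ler_wpM2l// ler_weXn2l.
have H5 : (S + `|K|) * x ^+ d < normc p`_d.+1 * x * x ^+ d.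
  by rewrite ltr_pM2r// exprn_gt0.
have E : normc p`_d.+1 * x ^+ d.+1 = normc p`_d.+1 * x * x ^+ d by rewrite exprS mulrA.
rewrite E in H2; rewrite mulrDl in H5.
by move: H1 H2 H3 H4 H5; lra.
Qed.

Variables (W : set C) (phi : C -> C).
Hypothesis W_bounded : exists B : R, forall z, W z -> normc z <= B.
Hypothesis phi_ext : exterior_map W phi.

Lemma faber_size (Phi : nat -> {poly C}) j : faber_polynomials phi Phi ->
  (size (Phi j) <= j.+1)%N.
Proof.
move=> /(_ j) /polynomial_part_infty /(_ 1 ltr01)[M1 HM1].
have [c c0 cpole] := phi_infty W_bounded phi_ext; have [M2 M20 HM2] := cpole 1 ltr01.
apply: (@size_poly_growth _ _ (1 + (c + 1) ^+ j) (`|M1| + M2 + 1)) => z hz.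
have z1 : 1 <= normc z by move: (normr_ge0 M1); lra.
have zM1 : M1 < normc z by move: (ler_norm M1); lra.
have zM2 : M2 < normc z by move: (normr_ge0 M1); lra.
have := HM1 z zM1; have [_ H2] := HM2 z zM2.
have H3 : normc (phi z) <= (c + 1) * normc z.
  have := lB_normcB (phi z) (c%:C * z); rewrite normcM normcR gtr0_norm//.
  by move: H2; lra.
have H4 : normc (phi z ^+ j) <= (c + 1) ^+ j * normc z ^+ j.
  by rewrite normcX -exprMn lerXn2r// nnegrE ?normc_ge0// mulr_ge0 ?normc_ge0//; lra.
have H5 : 1 <= normc z ^+ j by rewrite exprn_ege1.
have := lB_normcB (Phi j).[z] (phi z ^+ j); rewrite normcB mulrDl mul1r.
by move: H4 H5; lra.
Qed.

End Growth.

(** * Polynomials of Hessenberg matrices *)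

Section Hessenberg.
Variables (F : comNzRingType) (m : nat) (H : 'M[F]_m.+1).
Hypothesis H_hess : forall i j : 'I_m.+1, (j.+1 < i)%N -> H i j = 0.

(** Each factor [H] reaches at most one row further down. *)
Lemma hessenberg_horner (p : {poly F}) s (r c : 'I_m.+1) : (size p <= s)%N ->
  (c + s <= r)%N -> horner_mx H p r c = 0.
Proof.
elim/poly_ind: p s r c => [|p a IH] s r c; first by rewrite rmorph0 mxE.
case: s => [|s].
  by rewrite leqn0 size_poly_eq0 => /eqP->; rewrite rmorph0 mxE.
rewrite size_MXaddC => ps csr.
rewrite rmorphD rmorphM /= horner_mx_X horner_mx_C mxE [X in _ + X]mxE.
have rc : (c < r)%N by rewrite (leq_trans _ csr)// addnS ltnS leq_addr.
rewrite -val_eqE /= gtn_eqF// mulr0n addr0 mxE big1// => l _.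
have [lc|lc] := ltnP c.+1 l; first by rewrite H_hess// mulr0.
rewrite (IH s)// ?mul0r//; last by rewrite (leq_trans _ csr)// addnS -addSn leq_add2r.
by case: eqP ps => //= ->; case: ifP => // _; rewrite size_poly0.
Qed.

End Hessenberg.

(** * Perturbation to a diagonalizable matrix *)

Section Perturbation.
Context {R : realType}.
Local Open Scope sesquilinear_scope.
Local Notation C := R[i].
Variable m : nat.
Implicit Types (M T U X : 'M[C]_m.+1).

(** The characteristic polynomial has simple roots. *)
Lemma trig_diag_fun T : is_trig_mx T -> injective (fun i => T i i) ->
  exists2 X, X \in unitmx & exists d, T = diag_fun X d id.
Proof.
move=> Ttrig Tinj.
have /diagonalizableP[X Xu /(diagonalizable_forLR Xu)[d Td]] :
    exists2 rs, uniq rs & (mxminpoly T %| \prod_(x <- rs) ('X - x%:P))%R.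
  exists [seq T i i | i <- enum 'I_m.+1]; first by rewrite map_inj_uniq ?enum_uniq.
  by rewrite big_map big_enum -char_poly_trig// mxminpoly_dvd_char.
exists X => //; exists d; apply: etrans Td _; apply: etrans (conjVmx _ Xu) _; rewrite /diag_fun.
by have -> : \row_i id (d 0 i) = d by apply/rowP => i; rewrite mxE.
Qed.

Lemma unitary_mulJ U : U \is unitarymx -> U ^t* *m U = 1%:M.
Proof. by move=> Uu; rewrite -invmx_unitary// mulVmx// unitarymx_unit. Qed.

Lemma diag_fun_unitary U X d f : U \is unitarymx -> X \in unitmx ->
  U ^t* *m diag_fun X d f *m U = diag_fun (X *m U) d f.
Proof.
move=> Uu Xu; rewrite /diag_fun -invmx_unitary//.
have -> : invmx (X *m U) = invmx U *m invmx X.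
  have Uu' := unitarymx_unit Uu; have XU : X *m U \in unitmx by rewrite unitmx_mul Xu.
  by apply: (can_inj (mulmxK XU)); rewrite mulVmx// mulmxA mulmxKV// mulVmx.
by rewrite !mulmxA.
Qed.

Lemma dotc_isometry n p (P : 'M[C]_(n, p)) x y : dotc (P *m x) y = dotc x (P ^t* *m y).
Proof. by rewrite /dotc trmx_mul map_mxM mulmxA. Qed.

Lemma nsq_isometry n p (P : 'M[C]_(n, p)) x : P ^t* *m P = 1%:M -> nsq (P *m x) = nsq x.
Proof.
by move=> PP; apply: complexI; rewrite -!dotcc dotc_isometry mulmxA PP mul1mx.
Qed.

Lemma quad_compression n p (P : 'M[C]_(n, p)) (N : 'M[C]_n) x :
  quad (P ^t* *m N *m P) x = quad N (P *m x).
Proof. by rewrite /quad dotc_isometry !mulmxA. Qed.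

Lemma quad_diag_mx (d : 'rV[C]_m.+1) x :
  quad (diag_mx d) x = \sum_i d 0 i * (normc (x i 0) ^+ 2)%:C.
Proof.
rewrite /quad dotcE; apply: eq_bigr => i _.
by rewrite mul_diag_mx mxE mulrCA [conjc _ * _]mulrC mulcJ.
Qed.

Variable W : set C.
Hypothesis W_convex : forall a b (s : R), W a -> W b -> 0 <= s <= 1 ->
  W (a + s%:C * (b - a)).
Variables a b : C.
Hypotheses (Wa : W a) (Wb : W b) (ab : a != b).

(** Nodes of the segment from [a] to [b]: distinct eigenvalues of a normal
matrix whose field of values lies in [W]. *)
Let s_ (i : 'I_m.+1) : R := i%:R / m.+1%:R.
Let d_ := \row_(i < m.+1) (a + (s_ i)%:C * (b - a)).

Let d_inj : injective (fun i => d_ 0 i).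
Proof.
move=> i j; rewrite !mxE => /addrI /mulIf; rewrite subr_eq0 eq_sym => /(_ ab) /complexI.
by move=> /mulIf; rewrite invr_eq0 pnatr_eq0 => /(_ isT) /eqP; rewrite eqr_nat => /eqP/val_inj.
Qed.

Let d_W x : nsq x = 1 -> W (quad (diag_mx d_) x).
Proof.
move=> x1; rewrite quad_diag_mx.
have -> : \sum_i d_ 0 i * (normc (x i 0) ^+ 2)%:C =
    a + (\sum_i s_ i * normc (x i 0) ^+ 2)%:C * (b - a).
  rewrite rmorph_sum /= mulr_suml.
  have aE : \sum_i a * (normc (x i 0) ^+ 2)%:C = a.
    by rewrite -mulr_sumr -rmorph_sum /= -/(nsq x) x1 mulr1.
  rewrite -[X in _ = X + _]aE -big_split /=; apply: eq_bigr => i _.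
  rewrite mxE; move: (normc _ ^+ 2) (s_ i) => p q.
  have -> : (q * p)%:C = q%:C * p%:C := rmorphM (real_complex R) q p; ring.
apply: W_convex => //; apply/andP; split.
  by apply: sumr_ge0 => i _; rewrite mulr_ge0 ?exprn_ge0 ?normc_ge0// divr_ge0.
rewrite -x1; apply: ler_sum => i _; rewrite ler_piMl ?exprn_ge0 ?normc_ge0//.
by rewrite ler_pdivrMr ?ltr0n// mul1r ler_nat ltnW.
Qed.

(** Move the Schur form of [M] slightly towards [diag_mx d_].  Convexity keeps the
numerical range in [W], and two diagonal entries, whose difference is affine and
nonzero in [e], agree for at most one [e]. *)
Lemma diagonalizable_approx M : (forall z, NR M z -> W z) -> forall eta : R, 0 < eta ->
  exists2 X, X \in unitmx & exists d, (forall z, NR (diag_fun X d id) z -> W z) /\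
    forall r c, normc (diag_fun X d id r c - M r c) <= eta.
Proof.
move=> MW eta eta0; have [U Uu Utrig] := Schur M (ltn0Sn m).
have UU := unitary_mulJ Uu; have Uun := unitarymx_unit Uu.
have [T MT Ttrig] : exists2 T, M = U ^t* *m T *m U & is_trig_mx T.
  exists (U *m M *m U ^t*); first by rewrite !mulmxA UU mul1mx -mulmxA UU mulmx1.
  by rewrite -conjymx.
pose E := U ^t* *m diag_mx d_ *m U - M.
have small (c : R) : 0 <= c -> \forall e \near (0 : R)^'+, e * c <= eta.
  move=> c0; near=> e; have e1 : e <= eta / (c + 1).
    by near: e; apply: nbhs_right_ltW; rewrite divr_gt0// ltr_wpDl.
  have e0 : 0 < e by near: e; exact: nbhs_right_gt.
  have : e * (c + 1) <= eta by rewrite -ler_pdivlMr// ltr_wpDl.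
  by move: e0; lra.
pose S e := (1 - e%:C) *: T + e%:C *: diag_mx d_.
have [e [e01 eE eS]] : exists e : R, [/\ 0 < e <= 1,
    forall r c, e * normc (E r c) <= eta & forall i j, i != j -> S e i i != S e j j].
  near (0 : R)^'+ => e; exists e; split.
  - by apply/andP; split; near: e; [exact: nbhs_right_gt|exact: nbhs_right_ltW].
  - near: e; apply: filter_forall => r; apply: filter_forall => c.
    exact: small (normc_ge0 _).
  near: e; apply: filter_forall => i; apply: filter_forall => j.
  have [->|ij] := eqVneq i j; first by apply: nearW.
  pose x := T i i - T j j; pose y := d_ 0 i - d_ 0 j.
  have y0 : y != 0 by rewrite subr_eq0; apply/eqP => /d_inj /eqP; exact/negP.
  have diff (e : R) : S e i i - S e j j = x + e%:C * (y - x).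
    by rewrite !mxE !eqxx !mulr1n /x /y !mxE; ring.
  have [x0|x0] := eqVneq x 0.
    near=> e => _; rewrite -subr_eq0 diff x0 add0r subr0 mulf_neq0// -normc_gt0 normcR.
    by rewrite normr_gt0 gt_eqF//; near: e; exact: nbhs_right_gt.
  have x1 : 0 < normc x by rewrite normc_gt0.
  have yx0 : 0 < normc (y - x) + 1 by have := normc_ge0 (y - x); lra.
  near=> e => _; rewrite -subr_eq0 diff.
  have e0 : 0 < e by near: e; exact: nbhs_right_gt.
  have exy : e < normc x / (normc (y - x) + 1).
    by near: e; apply: nbhs_right_lt; exact: divr_gt0.
  have : e * (normc (y - x) + 1) < normc x by rewrite -ltr_pdivlMr.
  have := lB_normcD x (e%:C * (y - x)); rewrite normcM normcR gtr0_norm// -normc_gt0.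
  by move: e0; lra.
have Sinj : injective (fun i => S e i i).
  by move=> i j Sij; apply/eqP; apply: contraT => /eS; rewrite Sij eqxx.
have Strig : is_trig_mx (S e).
  apply/is_trig_mxP => i j ij; have /is_trig_mxP/(_ i j ij) Tij := Ttrig.
  by rewrite !mxE Tij -val_eqE ltn_eqF// mulr0n !mulr0 addr0.
have [X Xu [d Sd]] := trig_diag_fun Strig Sinj.
have XU : X *m U \in unitmx by rewrite unitmx_mul Xu.
have ME : diag_fun (X *m U) d id = M + e%:C *: E.
  rewrite -diag_fun_unitary// -Sd /S mulmxDr mulmxDl -!scalemxAr -!scalemxAl -MT.
  by rewrite /E scalerBr scalerBl scale1r addrAC addrA.
exists (X *m U) => //; exists d; rewrite ME; split=> [_ [x /= x1 <-]|r c].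
  rewrite quad_mxD quad_mxZ /E quad_mxD -scaleN1r quad_mxZ mulN1r quad_compression.
  apply: W_convex; [by apply: MW; exists x| |by case/andP: e01 => /ltW->].
  by apply: d_W; rewrite nsq_isometry.
have -> : (M + e%:C *: E) r c - M r c = e%:C * E r c.
  by rewrite [(M + _) r c]mxE [(_ *: E) r c]mxE addrC addKr.
by rewrite normcM normcR gtr0_norm; [exact: eE|case/andP: e01].
Unshelve. all: by end_near. Qed.

End Perturbation.

(** * Comparing the Taylor and the Faber series at a matrix *)

Section Compare.
Context {R : realType}.
Local Notation C := R[i].
Variable m : nat.
Implicit Types (M G : 'M[C]_m.+1) (r c : 'I_m.+1).

Lemma dotc_delta G r c : dotc (delta_mx r 0) (G *m delta_mx c 0) = G r c.
Proof.
rewrite dotcE (bigD1 r)//= big1 => [|i ir]; rewrite mxE.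
  by rewrite !eqxx conjc1 mul1r addr0 -colE mxE.
by rewrite (negbTE ir) conjc0 mul0r.
Qed.

Lemma nsq_delta r : nsq (delta_mx r 0 : 'cV[C]_m.+1) = 1.
Proof. by apply: complexI; rewrite -dotcc -[X in dotc _ X]mul1mx dotc_delta mxE eqxx. Qed.

Lemma mx_pow_le M (B : R) i r c : 0 <= B -> (forall r c, normc (M r c) <= B) ->
  normc ((M ^+ i) r c) <= (m.+1%:R * B) ^+ i.
Proof.
move=> B0 MB; elim: i r c => [|i IH] r c.
  by rewrite !expr0 mxE; case: eqP => _; rewrite ?normc1 ?normc0 ?ler01.
rewrite exprS mxE (le_trans (normc_sum _ _ _))//.
apply: (@le_trans _ _ (\sum_(l < m.+1) B * (m.+1%:R * B) ^+ i)).
  by apply: ler_sum => l _; rewrite normcM ler_pM ?normc_ge0.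
by rewrite sumr_const card_ord -[(B * _) *+ _]mulr_natl mulrA exprS.
Qed.

Lemma horner_mx_clim (M_ : nat -> 'M[C]_m.+1) M (p : {poly C}) r c :
  (forall r c, clim (fun N => M_ N r c) (M r c)) ->
  clim (fun N => horner_mx (M_ N) p r c) (horner_mx M p r c).
Proof.
move=> HM; elim/poly_ind: p r c => [|p a IH] r c.
  rewrite rmorph0 mxE; apply: eq_clim (clim_cst 0) => N.
  by rewrite rmorph0 mxE.
have E M' : horner_mx M' (p * 'X + a%:P) r c =
    \sum_l horner_mx M' p r l * M' l c + a%:M r c.
  by rewrite rmorphD rmorphM /= horner_mx_X horner_mx_C mxE [X in X + _]mxE.
rewrite E; apply: eq_clim (climD (clim_sum (fun l => climM (IH r l) (HM l c))) (clim_cst _)) => N.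
by rewrite E.
Qed.

Variables (W : set C) (phi : C -> C).
Hypothesis W_convex : forall a b (s : R), W a -> W b -> 0 <= s <= 1 ->
  W (a + s%:C * (b - a)).
Hypothesis W_closed : forall z, ~ W z ->
  exists2 r : R, 0 < r & forall w, normc (w - z) < r -> ~ W w.
Hypothesis W_bounded : exists B : R, forall z, W z -> normc z <= B.
Hypothesis phi_ext : exterior_map W phi.
Variable Phi : nat -> {poly C}.
Hypothesis Phi_faber : faber_polynomials phi Phi.
Variables (F : C -> C) (f a : nat -> C).
Hypothesis F_faber : forall z, W z -> clim (fun N => \sum_(0 <= j < N) f j * (Phi j).[z]) (F z).
Hypothesis F_taylor : forall z, clim (fun N => \sum_(0 <= i < N) a i * z ^+ i) (F z).

Let T N := \sum_(0 <= i < N) a i *: 'X^i.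
Let P N := \sum_(0 <= j < N) f j *: Phi j.

Let T_horner N z : (T N).[z] = \sum_(0 <= i < N) a i * z ^+ i.
Proof. by rewrite /T horner_sum; apply: eq_bigr => i _; rewrite hornerZ hornerXn. Qed.

Let P_horner N z : (P N).[z] = \sum_(0 <= i < N) f i * (Phi i).[z].
Proof. by rewrite /P horner_sum; apply: eq_bigr => i _; rewrite hornerZ. Qed.

(** [T K - P J] differs from [T N - P N] by the tails of the two series, to which
[faber_bound] and the bound on the powers apply; [T N - P N] tends to zero at the
matrix because it does so at the eigenvalues, which lie in [W]. *)
Lemma diag_estimate (X : 'M[C]_m.+1) (d : 'rV[C]_m.+1) (r0 S e : R) K J r c :
  X \in unitmx -> (forall z, NR (diag_fun X d id) z -> W z) ->
  (forall i r c, normc ((diag_fun X d id ^+ i) r c) <= r0 ^+ i) ->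
  (forall N, \sum_(K <= i < N) normc (a i) * r0 ^+ i <= e) ->
  (forall N, \sum_(J <= j < N) normc (f j) <= S) ->
  normc (horner_mx (diag_fun X d id) (T K - P J) r c) <= e + 2 * S.
Proof.
move=> Xu MW Mr0 ae fS; set M := diag_fun X d id.
have L0 : clim (fun N => horner_mx M (T N - P N) r c) 0.
  have dE N : horner_mx M (T N - P N) r c =
      \sum_i ((T N).[d 0 i] - (P N).[d 0 i]) * diag_weight X (delta_mx r 0) (delta_mx c 0) i.
    rewrite -dotc_delta /M diag_fun_poly//.
    apply: etrans (dotc_diag_fun _ _ _ _ _) _.
    by apply: eq_bigr => i _; rewrite hornerD hornerN.
  have : forall i, clim (fun N => ((T N).[d 0 i] - (P N).[d 0 i]) *
      diag_weight X (delta_mx r 0) (delta_mx c 0) i) 0.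
    move=> i; have dW : W (d 0 i) by exact/MW/NR_eigenvalue.
    have := climM (climB (F_taylor (d 0 i)) (F_faber dW))
      (clim_cst (diag_weight X (delta_mx r 0) (delta_mx c 0) i)).
    by rewrite subrr mul0r; apply: eq_clim => N; rewrite T_horner P_horner.
  move=> /clim_sum; rewrite big1//; apply: eq_clim => N; exact/esym/dE.
have := climB (clim_cst (horner_mx M (T K - P J) r c)) L0; rewrite subr0.
move=> /clim_le; apply; exists (maxn K J) => N; rewrite geq_max => /andP[KN JN].
have TN : T N = T K + \sum_(K <= i < N) a i *: 'X^i by rewrite /T (@big_cat_nat _ _ _ K).
have PN : P N = P J + \sum_(J <= j < N) f j *: Phi j by rewrite /P (@big_cat_nat _ _ _ J).
have -> : horner_mx M (T K - P J) r c - horner_mx M (T N - P N) r c =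
    \sum_(J <= j < N) f j * horner_mx M (Phi j) r c - \sum_(K <= i < N) a i * (M ^+ i) r c.
  have hs (I : Type) (s : seq I) (u : I -> C) (q : I -> {poly C}) :
      \sum_(i <- s) u i * horner_mx M (q i) r c = horner_mx M (\sum_(i <- s) u i *: q i) r c.
    rewrite linear_sum summxE; apply: eq_bigr => i _.
    by rewrite linearZ /= mxE.
  have -> : \sum_(K <= i < N) a i * (M ^+ i) r c =
      \sum_(K <= i < N) a i * horner_mx M 'X^i r c.
    by apply: eq_bigr => i _; rewrite rmorphXn /= horner_mx_X.
  have hB p q : horner_mx M (p - q) r c = horner_mx M p r c - horner_mx M q r c.
    by rewrite rmorphB 2!mxE.
  have hD p q : horner_mx M (p + q) r c = horner_mx M p r c + horner_mx M q r c.
    by rewrite rmorphD mxE.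
  rewrite !hs TN PN hB hB hD hD; ring.
rewrite [e + _]addrC (le_trans (le_normcB _ _))//; apply: lerD; last first.
  rewrite (le_trans _ (ae N))// (le_trans (normc_sum _ _ _))//; apply: ler_sum => i _.
  by rewrite normcM ler_wpM2l ?normc_ge0.
apply: (@le_trans _ _ (2 * \sum_(J <= j < N) normc (f j))); last by rewrite ler_wpM2l.
rewrite mulr_sumr (le_trans (normc_sum _ _ _))//; apply: ler_sum => j _.
rewrite normcM mulrC ler_wpM2r ?normc_ge0// -dotc_delta.
apply: (faber_bound W_convex W_closed W_bounded phi_ext Xu MW (nsq_delta r) (nsq_delta c)).
exact: polynomial_part_infty (Phi_faber j).
Qed.

Variables (M0 : 'M[C]_m.+1) (u v : C) (S : R) (L : C).
Hypothesis M0W : forall z, NR M0 z -> W z.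
Hypotheses (Wu : W u) (Wv : W v) (uv : u != v).
Hypothesis M0_hess : forall i j : 'I_m.+1, (j.+1 < i)%N -> M0 i j = 0.
Hypothesis a_tail : forall r e : R, 0 <= r -> 0 < e -> exists K0, forall K N, (K0 <= K)%N ->
  \sum_(K <= i < N) normc (a i) * r ^+ i <= e.
Hypothesis fS : forall N, \sum_(m <= j < N) normc (f j) <= S.
Hypothesis L_lim : clim (fun N => \sum_(0 <= i < N) a i * (M0 ^+ i) ord_max ord0) L.

(** The Faber polynomials of degree less than [m] do not contribute to the
corner entry, by the Hessenberg shape. *)
Lemma corner_entry_le : normc L <= 2 * S.
Proof.
pose B := 1 + \sum_i \sum_j normc (M0 i j).
have M0B i j : normc (M0 i j) + 1 <= B.
  rewrite addrC lerD2l (bigD1 i)//= (bigD1 j)//= -addrA lerDl addr_ge0//.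
    by apply: sumr_ge0 => l _; exact: normc_ge0.
  by apply: sumr_ge0 => l _; apply: sumr_ge0 => q _; exact: normc_ge0.
have B0 : 0 <= B by apply: le_trans (M0B ord0 ord0); rewrite addr_ge0 ?normc_ge0.
pose r0 := m.+1%:R * B; have r00 : 0 <= r0 by apply: mulr_ge0.
have /choice[M_ HM_] : forall n : nat, exists M, (exists2 X, X \in unitmx & exists d,
    M = diag_fun X d id /\ forall z, NR M z -> W z) /\
    forall r c, normc (M r c - M0 r c) <= n.+1%:R^-1.
  move=> n; have n0 : 0 < n.+1%:R^-1 :> R by rewrite invr_gt0.
  have [X Xu [d [MW MM]]] := diagonalizable_approx W_convex Wu Wv uv M0W n0.
  by exists (diag_fun X d id); split => //; exists X => //; exists d.
have M_lim r c : clim (fun n => M_ n r c) (M0 r c).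
  move=> e e0; exists (Num.truncn e^-1) => n en; have [_ /(_ r c)] := HM_ n.
  move=> /le_lt_trans; apply.
  rewrite invf_plt ?posrE// (lt_le_trans (truncnS_gt _))//.
  by rewrite ler_nat ltnS.
apply/ler_addgt0Pl => e e0.
have [K0 HK0] := a_tail r00 e0.
apply: (clim_le _ L_lim); exists K0 => K KK0.
have -> : \sum_(0 <= i < K) a i * (M0 ^+ i) ord_max ord0 =
    horner_mx M0 (T K - P m) ord_max ord0.
  rewrite raddfB /= mxE [X in _ = _ + X]mxE.
  have -> : horner_mx M0 (P m) ord_max ord0 = 0.
    rewrite /P linear_sum summxE big_nat big1// => j /andP[_ jm].
    rewrite linearZ /= mxE (hessenberg_horner M0_hess (leqnn _)) ?mulr0//=.
    by rewrite (leq_trans (faber_size W_bounded phi_ext j Phi_faber)).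
  rewrite subr0 /T linear_sum summxE; apply: eq_bigr => i _.
  by rewrite linearZ /= mxE rmorphXn /= horner_mx_X.
apply: clim_le (horner_mx_clim _ _ _ M_lim); exists 0%N => n _.
have [[X Xu [d [ME MW]]] MM] := HM_ n; rewrite ME in MW MM *.
apply: (@diag_estimate X d r0) => // [i r c|N]; last exact: HK0.
apply: mx_pow_le => // r' c'.
have := MM r' c'; have := M0B r' c'.
have : n.+1%:R^-1 <= 1 :> R by rewrite invf_le1// ler1n.
have := lB_normcB (diag_fun X d id r' c') (M0 r' c'); move: (n.+1%:R^-1) => q; lra.
Qed.

End Compare.

(** * The error bound *)

Section ErrorBound.
Context {R : realType}.
Local Open Scope sesquilinear_scope.
Local Notation C := R[i].

Lemma cmx_tr n p (V : 'M[R]_(n, p)) : (cmx V) ^t* = cmx V^T.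
Proof. by apply/matrixP => i j; rewrite !mxE; exact: conjc_real. Qed.

Lemma cmxX k (H : 'M[R]_k.+1) i : cmx (H ^+ i) = cmx H ^+ i.
Proof. exact: rmorphXn. Qed.

Lemma clim_real (u : nat -> R) (l : R) : u @ \oo --> l ->
  clim (fun N => (u N)%:C) l%:C.
Proof. by move=> ul; apply: clim_ReIm => //=; exact: cvg_cst. Qed.

Lemma exp_tail (t r e : R) : 0 <= r -> 0 < e -> exists K0, forall K N, (K0 <= K)%N ->
  \sum_(K <= i < N) normc (t * (- t) ^+ i / (i.+1)`!%:R)%:C * r ^+ i <= e.
Proof.
move=> r0 e0; pose q := `|t| * r; have q0 : 0 <= q by rewrite mulr_ge0.
pose s := series (exp_coeff q).
have s_nd : nondecreasing_seq s.
  apply/nondecreasing_seqP => N; rewrite /s /series /= big_nat_recr//= lerDl.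
  exact: exp_coeff_ge0.
have sl : s @ \oo --> limn s by exact: is_cvg_series_exp_coeff.
have t1 : 0 < `|t| + 1 by rewrite ltr_wpDl.
have d0 : 0 < e / (`|t| + 1) by rewrite divr_gt0.
move/cvgrPdist_lt : (sl) => /(_ _ d0)[K0 _ HK0]; exists K0 => K N K0K.
have [NK|KN] := leqP N K; first by rewrite big_geq// ltW.
apply: (@le_trans _ _ ((`|t| + 1) * (s N - s K))).
  have -> : s N - s K = \sum_(K <= i < N) exp_coeff q i.
    by rewrite /s /series /= (@big_cat_nat _ _ _ K 0 N)//= ?(ltnW KN)// addrAC subrr add0r.
  rewrite mulr_sumr; apply: ler_sum => i _.
  rewrite normcR !normrM normrX normrN normfV normr_nat /exp_coeff /= /q exprMn.
  rewrite -!mulrA; apply: ler_pM => //.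
    by rewrite mulr_ge0 ?exprn_ge0// mulr_ge0 ?invr_ge0// exprn_ge0.
    by rewrite lerDl.
  apply: ler_wpM2l; first exact: exprn_ge0.
  rewrite mulrC; apply: ler_wpM2l; first exact: exprn_ge0.
  by rewrite lef_pV2 ?posrE ?ltr0n ?fact_gt0// ler_nat factS leq_pmull.
rewrite mulrC -ler_pdivlMr//; have /= := HK0 K K0K.
have : s N <= limn s by apply: nondecreasing_cvgn_le => //; apply: cvgP sl.
have : s K <= limn s by apply: nondecreasing_cvgn_le => //; apply: cvgP sl.
move=> h1 h2; rewrite ger0_norm ?subr_ge0//.
by move: h1 h2; lra.
Qed.

Lemma tphi_mx_clim k (H : 'M[R]_k.+1) t r c :
  clim (fun N => \sum_(0 <= i < N) (t * (- t) ^+ i / (i.+1)`!%:R)%:C * (cmx H ^+ i) r c)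
    (tphi_mx H t r c)%:C.
Proof.
have HE := @egf_cvg _ _ t (phi_coef_bounded H r c).
rewrite -(cvg_shiftS (pseries (egf_coef (phi_coef H r c)) t)) in HE.
rewrite mxE; apply: eq_clim (clim_real HE) => N.
rewrite /pseries /series /= big_nat_recl// /egf_coef /= mul0r mul0r add0r rmorph_sum.
apply: eq_bigr => i _; rewrite -cmxX [cmx _ _ _]mxE /=.
rewrite -[RHS](rmorphM (real_complex R)) /=; congr (_%:C).
rewrite -scaleN1r exp_scalemx mxE [(- t) ^+ i]exprNn exprS; ring.
Qed.

End ErrorBound.

Theorem proposition4p1 (R : realType) (n k : nat)
  (A : 'M[R]_n) (g : 'cV[R]_n) (t : R)
  (hA : forall z : 'cV[R[i]]_n, 0 <= complex.Re (qform A z))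
  (hg : vnorm2 g = 1) (ht : 0 <= t) (hk : (1 <= k)%N)
  (V : 'M[R]_(n, k)) (v : 'cV[R]_n) (H : 'M[R]_k) (h : R)
  (harn : arnoldi A g V v H h)
  (hW : forall z : R[i], numerical_range A <> [set z])
  (phi : R[i] -> R[i]) (hphi : exterior_map (numerical_range A) phi)
  (Phi : nat -> {poly R[i]}) (hPhi : faber_polynomials phi Phi)
  (* any rho > 1 is admissible, z |-> t phi1(- t z) being entire *)
  (rho : R) (hrho : 1 < rho) (f : nat -> R[i])
  (hf : forall j, f j = faber_coef (numerical_range A) phi
          (fun z => t%:C * phi1 (- t%:C * z)) rho j)
  (hseries : forall z, numerical_range A z ->
     series (fun j => f j * (Phi j).[z] : R[i]^o) @ \oo -->
       (t%:C * phi1 (- t%:C * z) : R[i]^o)) :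
  ((vnorm2 (residual A g (krylov_approx V H) t))%:E <=
     (2 * h)%:E * \sum_(k.-1 <= j <oo) (normc (f j))%:E)%E /\
  ((2 * h)%:E * \sum_(k.-1 <= j <oo) (normc (f j))%:E <=
     (2 * mxnorm2 A)%:E * \sum_(k.-1 <= j <oo) (normc (f j))%:E)%E.
Proof.
case: k hk V H harn => [//|m] _ V H harn; rewrite [m.+1.-1]/=.
rewrite numerical_rangeE in hW hphi hseries; set W := NR (cmx A) in hW hphi hseries.
have n0 : (0 < n)%N.
  have := arnoldi_orthonormal harn; case: (n) V {harn} => // V' /matrixP/(_ ord0 ord0).
  by rewrite !mxE big_ord0 eqxx => /esym/eqP; rewrite oner_eq0.
have W_convex a b (s : R) : W a -> W b -> 0 <= s <= 1 -> W (a + s%:C * (b - a)).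
  exact: NR_convex.
have W_closed z : ~ W z -> exists2 r : R, 0 < r & forall w, normc (w - z) < r -> ~ W w.
  exact: NR_closed.
have W_bounded := NR_bounded A n0.
have HW z : NR (cmx H) z -> W z.
  move=> [x /= x1 <-]; exists (cmx V *m x) => /=.
    rewrite nsq_isometry// cmx_tr /cmx -map_mxM (arnoldi_orthonormal harn).
    by rewrite map_mx1.
  rewrite -quad_compression cmx_tr /cmx -!map_mxM.
  by rewrite (arnoldi_compression harn).
have [u Wu] : exists u, W u.
  exists (quad (cmx H) (delta_mx ord0 0)); apply: HW; exists (delta_mx ord0 0) => //=.
  exact: nsq_delta.
have [w Ww uw] : exists2 w, W w & u != w.
  apply: contrapT => no; apply: (hW u); apply/seteqP; split => [w Ww|_ ->//].
  by apply: contrapT => wu; apply: no; exists w => //; apply/eqP => /esym.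
have corner S : (forall N, \sum_(m <= j < N) normc (f j) <= S) ->
    `|tphi_mx H t ord_max ord0| <= 2 * S.
  move=> fS; rewrite -normcR.
  apply: (corner_entry_le W_convex W_closed W_bounded hphi hPhi
    (F := fun z => t%:C * phi1 (- t%:C * z)) (f := f)
    (a := fun i => (t * (- t) ^+ i / (i.+1)`!%:R)%:C) _ _ HW Wu Ww uw) => //.
  - by move=> z /hseries /climP.
  - by move=> z; apply: eq_clim (tphi1_series t z) => N; rewrite big_mkord.
  - by move=> i j ij; rewrite mxE (arnoldi_hessenberg harn)// rmorph0.
  - exact: exp_tail.
  - exact: tphi_mx_clim.
have h0 := arnoldi_subdiag harn.
have E0 : (0 <= \sum_(m <= j <oo) (normc (f j))%:E)%E.
  by apply: nneseries_ge0 => j _ _; rewrite lee_fin normc_ge0.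
split; last first.
  by rewrite lee_wpmul2r// lee_fin ler_wpM2l// (subdiag_le harn).
rewrite (vnorm2_residual harn)//.
have partial N : ((\sum_(m <= j < N) normc (f j))%:E <= \sum_(m <= j <oo) (normc (f j))%:E)%E.
  rewrite -sumEFin; apply: nneseries_lim_ge => j _ _.
  by rewrite lee_fin normc_ge0.
case: (\sum_(m <= j <oo) _)%E E0 partial => [S _ fS|_ _|//].
  rewrite -EFinM lee_fin -mulrA [h * S]mulrC mulrA mulrC ler_wpM2r//.
  by apply: corner => N; rewrite -lee_fin; exact: fS.
(* if the series diverges, both sides vanish or the right one is infinite *)
have [->|hn0] := eqVneq h 0; first by rewrite mul0r mulr0 mul0e.
by rewrite gt0_muley ?leey// lte_fin mulr_gt0// lt_neqAle eq_sym hn0.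
Qed.
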